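(* Fix an integer $d\ge 2$. Let $Z$ be a standard normal random variable. Let $\mathrm{Hop}_d(n)$ denote the hopcount between the vertices corresponding to two active cliques chosen independently and uniformly at random among the active cliques of $\mathrm{RAN}_d(n)$. Then, as $n\to\infty$, $$\frac{\mathrm{Hop}_d(n)-\frac{2}{\mu_d}\frac{d+1}{d}\log n}{\sqrt{2\,\frac{\sigma_d^2+\mu_d}{\mu_d^3}\,\frac{d+1}{d}\log n}}\ \xrightarrow{\ d\ }\ Z .$$ Further, the same central limit theorem (same centering and scaling, same limit) holds for the graph distance in $\mathrm{RAN}_d(n)$ between two vertices that, given the graph, are picked independently of each other, each according to the size-biased law in which a vertex $v$ of degree $D_v(n)=k$ is picked with probability proportional to $(d-1)k-d^2+d+2$.
   Context: Random Apollonian network $\mathrm{RAN}_d(n)$: at step $0$, take a $d$-dimensional simplex ($d+1$ mutually adjacent vertices) with one additional interior vertex joined to all $d+1$ vertices of the simplex (so the graph is the complete graph on $d+2$ vertices). The $d+1$ sets consisting of the interior vertex and $d$ of the simplex vertices are the initial active cliques. At each step $n\ge1$, pick an active clique $C_n$ (a set of $d+1$ mutually adjacent vertices) of $\mathrm{RAN}_d(n-1)$ uniformly at random, insert a new vertex $v_n$ joined to all $d+1$ vertices of $C_n$; $C_n$ becomes inactive, and the $d+1$ cliques formed by $v_n$ with each choice of $d$ vertices of $C_n$ become active. The result is $\mathrm{RAN}_d(n)$; it has $n+d+2$ vertices and $nd+d+1$ active cliques. The hopcount between two vertices is their graph distance (number of edges on a shortest path). The vertex corresponding to an active clique $C$ is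 the vertex that would be inserted into $C$ (joined to all vertices of $C$); the hopcount between the vertices corresponding to two active cliques is their graph distance once these vertices are inserted into those cliques. $D_v(n)$ is the degree of $v$ in $\mathrm{RAN}_d(n)$. $Y_d:=\sum_{i=1}^{d+1}X_i$, where $X_1,\dots,X_{d+1}$ are independent and $X_i$ is geometric (values in $\{1,2,\dots\}$) with success probability $\frac{i}{d+1}$. $\mu_d:=\mathbb{E}[Y_d]=(d+1)\sum_{i=1}^{d+1}\frac1i$ and $\sigma_d^2:=\mathrm{Var}(Y_d)$. *)

(* Defs.v *)
From HB Require Import structures.
From mathcomp Require Import all_boot all_order all_algebra finmap.
From mathcomp Require Import all_classical all_reals all_analysis.

Set Implicit Arguments.
Unset Strict Implicit.
Unset Printing Implicit Defensive.

Import Order.TTheory GRing.Theory Num.Theory.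
Import numFieldNormedType.Exports.

Local Open Scope fset_scope.
Local Open Scope classical_set_scope.
Local Open Scope ring_scope.

(* The vertices of [g] are the numbers below [nverts g], in order of
   insertion; a clique is identified with its set of vertices. *)
Record apollonian := Apollonian {
  nverts : nat;
  adj : rel nat;
  active : {fset {fset nat}} }.

(* The vertices [0 .. d] span the initial simplex and [d + 1] is its interior
   vertex. *)
Definition ran0 (d : nat) : apollonian :=
  Apollonian d.+2
    (fun x y => [&& x != y, x < d.+2 & y < d.+2]%N)
    [fset [fset x in iota 0 d.+2 | x != j] | j in iota 0 d.+1].

(* Insertion of a new vertex, numbered [nverts g], into the clique [C]. *)
Definition insert_vertex (C : {fset nat}) (g : apollonian) : apollonian :=
  let v := nverts g in
  Apollonian v.+1
    (fun x y => [|| adj g x y, (x == v) && (y \in C) | (y == v) && (x \in C)])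
    ((active g `\ C) `|` [fset (v |` (C `\ j)) | j in C])%fset.

(* [c k] is the clique subdivided at step [k + 1]. *)
Fixpoint ran (d : nat) (c : nat -> {fset nat}) (n : nat) : apollonian :=
  if n is m.+1 then insert_vertex (c m) (ran d c m) else ran0 d.

Definition is_walk (e : rel nat) (x y k : nat) : Prop :=
  exists p : seq nat, [/\ path e x p, last x p = y & size p = k].

(* Junk value 0 for vertices that are not connected. *)
Definition gdist (e : rel nat) (x y : nat) : nat :=
  if pselect (exists k, `[< is_walk e x y k >]) is left h then ex_minn h else 0%N.

Definition degree (g : apollonian) (v : nat) : nat :=
  count (adj g v) (iota 0 (nverts g)).

(* If the two cliques coincide, they correspond to one and the same vertex. *)
Definition clique_hop (g : apollonian) (C C' : {fset nat}) : nat :=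
  if C == C' then 0%N
  else gdist (adj (insert_vertex C' (insert_vertex C g))) (nverts g) (nverts g).+1.

Definition vertex_hop (g : apollonian) (v w : nat) : nat := gdist (adj g) v w.

Definition active_pmf {R : realType} (g : apollonian) (C : {fset nat}) : R :=
  (C \in active g)%:R / #|` active g|%:R.

Definition size_bias {R : realType} (d : nat) (g : apollonian) (v : nat) : R :=
  (d%:R - 1) * (degree g v)%:R - d%:R ^+ 2 + d%:R + 2.

Definition size_biased_pmf {R : realType} (d : nat) (g : apollonian) (v : nat) : R :=
  if (v < nverts g)%N
  then size_bias d g v / \sum_(0 <= u < nverts g) size_bias d g u
  else 0.

Section random.
Context {R : realType} {dT : measure_display} {T : measurableType dT}.
Variable P : probability T R.

Definition discrete_rv {K : Type} (X : T -> K) : Prop :=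
  forall x : K, measurable (X @^-1` [set x]).

Definition history (C : nat -> T -> {fset nat}) (c : nat -> {fset nat}) (n : nat)
  : set T := [set w | forall k, (k < n)%N -> C k w = c k].

(* Given the first [n] choices, the next clique is uniform among the active
   cliques of the current network. *)
Definition ran_process (d : nat) (C : nat -> T -> {fset nat}) : Prop :=
  (forall k, discrete_rv (C k)) /\
  forall (n : nat) (c : nat -> {fset nat}),
    P (history C c n.+1) =
    (P (history C c n) * (active_pmf (ran d c n) (c n))%:E)%E.

(* Given the first [n] choices (equivalently, given the labelled network at
   time [n]), [U] and [V] are independent with probability mass function [q]. *)
Definition iid_given_ran (d : nat) (C : nat -> T -> {fset nat}) (n : nat)
    {K : Type} (q : apollonian -> K -> R) (U V : T -> K) : Prop :=
  [/\ discrete_rv U, discrete_rv V &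
    forall (c : nat -> {fset nat}) (u v : K),
      P (history C c n `&` (U @^-1` [set u] `&` V @^-1` [set v])) =
      (P (history C c n) * (q (ran d c n) u * q (ran d c n) v)%:E)%E].

Definition independent_rvs {I : finType} (X : I -> {RV P >-> R}) : Prop :=
  forall B : I -> set R, (forall i, measurable (B i)) ->
    P (\bigcap_(i in [set: I]) (X i @^-1` B i)) =
    (\prod_(i : I) P (X i @^-1` B i))%E.

Definition geometric_rv (X : {RV P >-> R}) (p : R) : Prop :=
  forall k : nat, pmf X k.+1%:R = p * (1 - p) ^+ k.

Definition cvg_in_distribution (X : nat -> T -> R) {dZ : measure_display}
    {TZ : measurableType dZ} {PZ : probability TZ R} (Z : {RV PZ >-> R}) : Prop :=
  (forall n, measurable_fun [set: T] (X n)) /\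
  forall x : R, {for x, continuous (cdf Z)} ->
    P [set w | X n w <= x] @[n --> \oo] --> cdf Z x.

End random.

Definition hop_center {R : realType} (d : nat) (mu : R) (n : nat) : R :=
  2 / mu * (d.+1%:R / d%:R) * ln n%:R.

Definition hop_scale {R : realType} (d : nat) (mu sigma2 : R) (n : nat) : R :=
  Num.sqrt (2 * ((sigma2 + mu) / mu ^+ 3) * (d.+1%:R / d%:R) * ln n%:R).

(* Main.v *)
(* Give every vertex its distance to the initial simplex as a level. The levels
   in an active clique differ by at most one, so the sum [t] of the [d + 1]
   levels determines them up to order, and a child has sum [t + 1] or [t], the
   former for [d + 1 - t mod (d + 1)] of the [d + 1] children. Hence along a line
   of descent [t] climbs like a coupon collector, needing on average [mu_d] births
   per level.

   A walk to the initial simplex gives [hop <= level + level + O(1)]. Conversely,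
   two vertices inserted into different active cliques of the network at time
   [n0] are separated by the vertices of that network, whose levels are at most
   [n0 + 1], so [hop >= level + level - O(n0)]; two random cliques descend from the
   same clique of time [n0] with probability [O(1 / n0)].

   It remains to prove a central limit theorem for the sum of the levels of two
   random active cliques. The mean over pairs of active cliques of a function of
   the two sums satisfies a recursion in [n] with the generators of two
   independent birth chains, up to a summable error [O(1 / n^2)]. The level is
   replaced by a corrected function [phi] of constant drift, and the recursion is
   applied to [Phi ((y - phi s - phi t) / sqrt V)], with [V] and [y] moving so that
   the first order terms cancel (the heat equation); a bounded correction [chi] of
   [V] makes the conditional variance constant. The expectation is thus
   nearly constant from time [n0], where it is close to [Phi x], to time [N],
   where [V] is a small multiple of [log N] and the test function is close to an
   indicator. *)
Require Import Defs.
From mathcomp Require Import all_boot all_order all_algebra finmap.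
From mathcomp Require Import all_classical all_reals all_analysis.
From mathcomp Require Import measurable_realfun zify ring lra.
Import Order.TTheory GRing.Theory Num.Theory.
Import numFieldNormedType.Exports.
Local Open Scope classical_set_scope.
Local Open Scope ring_scope.
Set Implicit Arguments.
Unset Strict Implicit.
Unset Printing Implicit Defensive.

(** * Active cliques and levels *)

Section Trees.
Local Open Scope nat_scope.
Variable d : nat.
Implicit Types (c : nat -> {fset nat}) (X : {fset nat}) (n k x y : nat).

(** Two sampled lines of descent share their early history and are never exactly independent, so no
    pair of chains is followed. The proof uses the exact one-step identity for the double sum over
    active cliques: what the two generators leave out, in particular both members of a pair being
    children of the same clique, has weight [O(1 / n^2)]. The scaling has a heuristic reading:
    births along a line of descent are nearly Poisson, which adds [mu_d] to [sigma_d^2].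
    Analytically [sigma_d^2 + mu_d] is the sum of [1 / p^2] over the phases of the coupon collector.
    The Taylor errors up to time [N] add up to order [log N / u^3], with [u] the smallest standard
    deviation in use, so [u] may be a small multiple of [sqrt (log N)] but not bounded. Hence the
    order of choices: the smoothing parameter, then [n0], then [N]. *)

Definition valid c n := forall k, k < n -> c k \in active (ran d c k).

Lemma validS c n : valid c n.+1 -> valid c n /\ c n \in active (ran d c n).
Proof. by move=> h; split=> [k kn|]; apply: h => //; apply: ltnW. Qed.

Lemma nverts_ran c n : nverts (ran d c n) = n + d.+2.
Proof. by elim: n => //= n ->. Qed.

(* The levels in an active clique take at most two consecutive values (see
   [active_two_levels]), so the quotient is the least of them and [level] is the
   distance to [0 .. d]. *)
Fixpoint level c n : nat -> nat :=
  if n is m.+1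
  then fun v => if v == m + d.+2
                then ((\sum_(x <- c m) level c m x) %/ d.+1).+1
                else level c m v
  else fun v => (d < v) : nat.

Definition total c n X := \sum_(x <- X) level c n x.

Definition child n C j : {fset nat} := ((n + d.+2)%N |` (C `\ j))%fset.

Lemma active_ranS c n : active (ran d c n.+1) =
  ((active (ran d c n) `\ c n) `|` [fset child n (c n) j | j in c n])%fset.
Proof. by rewrite /= nverts_ran. Qed.

Lemma active_ranSP c n X : reflect
  ((X \in active (ran d c n) /\ X != c n) \/ exists2 j, j \in c n & X = child n (c n) j)
  (X \in active (ran d c n.+1)).
Proof.
rewrite active_ranS inE in_fsetD1; apply: (iffP orP) => -[].
- by case/andP=> ? ?; left.
- by case/imfsetP=> j /= jc ->; right; exists j.
- by case=> -> ->; left.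
- by case=> j jc ->; right; apply/imfsetP; exists j.
Qed.

Lemma in_facet x j :
  (x \in [fset x in iota 0 d.+2 | x != j]%fset) = (x < d.+2) && (x != j).
Proof.
apply/imfsetP/andP => [[y + ->]|[xd xj]].
  by rewrite -[in_mem _ _]/((y \in iota 0 d.+2) && (y != j)) mem_iota => /andP[].
by exists x => //; rewrite -[in_mem _ _]/((x \in iota 0 d.+2) && (x != j)) mem_iota xd.
Qed.

Lemma active_ran0P c X : reflect
  (exists2 j, j <= d & X = [fset x in iota 0 d.+2 | x != j]%fset)
  (X \in active (ran d c 0)).
Proof.
change (active (ran d c 0)) with
  ([fset [fset x in iota 0 d.+2 | x != j] | j in iota 0 d.+1]%fset).
apply: (iffP (imfsetP _ _ _ _)) => [[j + ->]|[j jd ->]].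
  by rewrite -[in_mem _ _]/(j \in iota 0 d.+1) mem_iota => jd; exists j.
by exists j => //; rewrite -[in_mem _ _]/(j \in iota 0 d.+1) mem_iota.
Qed.

Lemma active_lt c n : valid c n ->
  forall X x, X \in active (ran d c n) -> x \in X -> x < n + d.+2.
Proof.
elim: n => [_|n IHn /validS[vn cn]] X x.
  by move=> /active_ran0P[j jd ->]; rewrite in_facet => /andP[].
move/active_ranSP=> [[Xa _] xX|[j jc ->]].
  by rewrite addSn ltnS ltnW// (IHn vn X).
rewrite !inE => /orP[/eqP ->|/andP[_ xc]]; first by rewrite addSn.
by rewrite addSn ltnS ltnW// (IHn vn (c n)).
Qed.

Lemma new_notin c n : valid c n ->
  forall X, X \in active (ran d c n) -> n + d.+2 \notin X.
Proof.
move=> vn X Xa; apply/negP => /(active_lt vn Xa).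
by rewrite ltnn.
Qed.

Lemma child_inj n C i j : n + d.+2 \notin C -> i \in C -> j \in C ->
  child n C i = child n C j -> i = j.
Proof.
move=> nC iC jC /fsetP/(_ i); rewrite !inE iC eqxx /= orbF andbT.
case: (i =P j) => // _; rewrite orbT => /eqP e.
by rewrite -e iC in nC.
Qed.

(** Both sides are duplicate-free, since a child contains the fresh vertex and an older clique does
    not. Keeping [c n] on the left turns the replacement of a clique into an identity between
    sums. *)
Lemma perm_active_ranS c n : valid c n.+1 ->
  perm_eq (c n :: active (ran d c n.+1))
    (active (ran d c n) ++ [seq child n (c n) j | j <- c n]).
Proof.
move=> /validS[vn cn]; have nc := new_notin vn cn.
apply: uniq_perm.
- rewrite /= fset_uniq andbT; apply/active_ranSP => -[[_ /eqP//]|[j jc e]].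
  by move: nc; rewrite e !inE eqxx.
- rewrite cat_uniq fset_uniq /= map_inj_in_uniq ?fset_uniq ?andbT; last first.
    by move=> i j ic jc; apply: child_inj.
  apply/hasPn => X /mapP[j jc ->]; apply/negP => /(new_notin vn).
  by rewrite !inE eqxx.
move=> X; rewrite in_cons mem_cat; apply/orP/orP => -[].
- by move=> /eqP ->; left.
- by move/active_ranSP=> [[]|[j jc ->]]; [left|right; apply: map_f].
- by move=> Xa; case: (X =P c n) => [->|/eqP ne]; [left|right; apply/active_ranSP; left].
- by move=> /mapP[j jc ->]; right; apply/active_ranSP; right; exists j.
Qed.

Lemma card_active_clique c n : valid c n ->
  forall X, X \in active (ran d c n) -> #|` X| = d.+1.
Proof.
elim: n => [_|n IHn /validS[vn cn]] X.
  move=> /active_ran0P[j jd ->].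
  have -> : [fset x in iota 0 d.+2 | x != j]%fset = ([fset x in iota 0 d.+2] `\ j)%fset.
    by apply/fsetP => x; rewrite in_facet in_fsetD1 in_fset mem_iota andbC.
  apply/eqP; rewrite -(eqn_add2l (j \in [fset x in iota 0 d.+2]%fset)) -cardfsD1.
  rewrite card_fseq undup_id ?iota_uniq// size_iota in_fset mem_iota.
  by rewrite add0n ltnS (leq_trans jd).
move/active_ranSP=> [[Xa _]|[j jc ->]]; first exact: IHn.
rewrite cardfsU1 inE negb_and (new_notin vn cn) orbT.
by have := IHn vn _ cn; rewrite (cardfsD1 j) jc.
Qed.

Lemma card_active c n : valid c n -> #|` active (ran d c n)| = n * d + d.+1.
Proof.
elim: n => [_|n IHn vn1].
  rewrite card_in_imfset; first by rewrite [enum_finmem _]undup_id ?iota_uniq ?size_iota.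
  move=> i j; rewrite !mem_iota => /andP[_ id] /andP[_ jd] /fsetP/(_ j).
  by rewrite !in_facet eqxx ltnS ltnW//= => /negbFE/eqP.
have [vn cn] := validS vn1.
have /perm_size := perm_active_ranS vn1; rewrite /= size_cat size_map.
rewrite (card_active_clique vn cn) IHn// mulSn; lia.
Qed.

End Trees.

(** * Totals of the levels in an active clique *)

Section Levels.
Local Open Scope nat_scope.
Variable d : nat.
Implicit Types (c : nat -> {fset nat}) (X : {fset nat}) (n k : nat).

Lemma sum_two_values (T : Type) (s : seq T) (f : T -> nat) m :
  all (fun x => m <= f x <= m.+1) s ->
  \sum_(x <- s) f x = m * size s + count (fun x => f x == m.+1) s.
Proof.
elim: s => [_|x s IHs]; first by rewrite big_nil muln0.
rewrite /= big_cons => /andP[fx /IHs ->]; rewrite mulnS.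
by case: eqP fx => /=; lia.
Qed.

(** A sum of [k + 1] values in [{m, m + 1}] determines them up to order. The quotient is [m] unless
    all values are [m + 1], when it is [m + 1] with remainder 0; stating the result with [q] covers
    both cases. *)
Lemma two_values_div (T : eqType) (s : seq T) (f : T -> nat) m k :
  {in s, forall x, m <= f x <= m.+1} -> size s = k.+1 ->
  let q := (\sum_(x <- s) f x) %/ k.+1 in
  {in s, forall x, q <= f x <= q.+1} /\
  count (fun x => f x == q) s = k.+1 - (\sum_(x <- s) f x) %% k.+1.
Proof.
move=> /allP fs sk q; have sumE := sum_two_values fs.
have cntle := count_size (fun x => f x == m.+1) s.
have cnt2 : count (fun x => f x == m) s + count (fun x => f x == m.+1) s = size s.
  elim: s fs {sk q sumE cntle} => //= x s IHs /andP[fx /IHs].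
  by case: eqP => /=; case: eqP => /=; lia.
rewrite /q sumE sk divnMDl// modnMDl.
have [ltk|] := ltnP (count (fun x => f x == m.+1) s) k.+1.
  rewrite divn_small// modn_small// addn0; split; first exact/allP.
  by rewrite -sk -cnt2 addnK.
move=> gek; have eqk : count (fun x => f x == m.+1) s = k.+1 by lia.
rewrite eqk divnn modnn addn1 /= subn0.
split; last exact: eqk.
have : all (fun x => f x == m.+1) s by rewrite all_count eqk sk.
by move=> /allP h x /h /eqP ->; rewrite leqnn leqnSn.
Qed.

Lemma level_old c n x : x < n + d.+2 -> level d c n.+1 x = level d c n x.
Proof. by move=> /= xn; rewrite ltn_eqF. Qed.

Lemma level_new c n :
  level d c n.+1 (n + d.+2) = (total d c n (c n) %/ d.+1).+1.
Proof. by rewrite /= eqxx. Qed.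

Lemma total_old c n X : {in X, forall x, x < n + d.+2} ->
  total d c n.+1 X = total d c n X.
Proof. by move=> Xn; apply: eq_big_seq => x /Xn; apply: level_old. Qed.

Lemma total_active c n X : valid d c n -> X \in active (ran d c n) ->
  total d c n.+1 X = total d c n X.
Proof. by move=> vn Xa; apply: total_old => x; apply: (active_lt vn Xa). Qed.

Lemma total_child c n j : valid d c n.+1 -> j \in c n ->
  total d c n.+1 (child d n (c n) j) + level d c n j =
  total d c n (c n) + (total d c n (c n) %/ d.+1).+1.
Proof.
move=> /validS[vn cn] jc; have nc := new_notin vn cn.
rewrite {1}/total /child big_fsetU1 ?inE ?negb_and ?nc ?orbT//.
rewrite level_new -[\sum_(_ <- _) _]/(total d c n.+1 (c n `\ j)%fset) total_old; last first.
  by move=> x; rewrite !inE => /andP[_]; exact: (active_lt vn cn).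
set q := _.+1; rewrite [in RHS]/total (big_fsetD1 j)//=.
rewrite -/(total d c n (c n `\ j)%fset); lia.
Qed.

(** The new vertex lies one level above the lowest level [q] of its clique, and the old levels are
    [q] or [q + 1], so a child again uses only these two values. *)
Lemma active_two_levels c n : valid d c n ->
  forall X, X \in active (ran d c n) ->
  exists m, {in X, forall x, m <= level d c n x <= m.+1}.
Proof.
elim: n => [_ X _|n IHn vn1 X].
  by exists 0 => x _ /=; case: ltnP.
have [vn cn] := validS vn1.
move=> /active_ranSP[[Xa _]|[j jc ->]].
  have [m h] := IHn vn X Xa; exists m => x xX.
  by rewrite level_old; [apply: h|apply: (active_lt vn Xa)].
have [m h] := IHn vn _ cn.
have [h2 _] := two_values_div h (card_active_clique vn cn).
exists (total d c n (c n) %/ d.+1) => x; rewrite !inE => /orP[/eqP ->|/andP[_ xc]].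
  by rewrite level_new leqnn leqnSn.
by rewrite level_old; [apply: h2|apply: (active_lt vn cn)].
Qed.

Lemma level_range c n X x : valid d c n -> X \in active (ran d c n) -> x \in X ->
  total d c n X %/ d.+1 <= level d c n x <= (total d c n X %/ d.+1).+1.
Proof.
move=> vn Xa xX; have [m h] := active_two_levels vn Xa.
by have [h2 _] := two_values_div h (card_active_clique vn Xa); apply: h2.
Qed.

Lemma count_low c n X : valid d c n -> X \in active (ran d c n) ->
  count (fun x => level d c n x == total d c n X %/ d.+1) X =
  d.+1 - total d c n X %% d.+1.
Proof.
move=> vn Xa; have [m h] := active_two_levels vn Xa.
by have [] := two_values_div h (card_active_clique vn Xa).
Qed.

Lemma level_le c n : valid d c n -> forall x, x < n + d.+2 -> level d c n x <= n.+1.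
Proof.
elim: n => [_ x _ /=|n IHn /validS[vn cn] x]; first by case: ltnP.
rewrite addSn ltnS leq_eqVlt => /orP[/eqP ->|xn]; last first.
  by rewrite level_old// ltnW// ltnS IHn.
rewrite level_new ltnS.
have : 0 < size (c n) by rewrite (card_active_clique vn cn).
case E : (c n : seq nat) => [//|y s] _.
have yc : y \in c n by rewrite -[_ \in _]/(y \in (c n : seq nat)) E inE eqxx.
have /andP[h _] := level_range vn cn yc.
by apply: (leq_trans h); apply: IHn => //; apply: (active_lt vn cn).
Qed.

Lemma total_le c n X : valid d c n -> X \in active (ran d c n) ->
  total d c n X <= n.+1 * d.+1.
Proof.
move=> vn Xa; rewrite -(card_active_clique vn Xa) /total.
rewrite (leq_trans (_ : _ <= \sum_(x <- X) n.+1))//; last first.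
  by rewrite big_const_seq iter_addn_0 count_predT.
rewrite !big_seq; apply: leq_sum => x xX; apply: level_le => //.
exact: (active_lt vn Xa).
Qed.

Lemma sum_active_ranS (V : zmodType) c n (F : {fset nat} -> V) : valid d c n.+1 ->
  (\sum_(X <- active (ran d c n.+1)) F X =
   \sum_(X <- active (ran d c n)) F X +
   (\sum_(j <- c n) F (child d n (c n) j) - F (c n)))%R.
Proof.
move=> vn1.
have : (\sum_(X <- c n :: active (ran d c n.+1)) F X = \sum_(X <-
    active (ran d c n) ++ [seq child d n (c n) j | j <- c n]) F X)%R.
  exact/perm_big/perm_active_ranS.
rewrite big_cons big_cat big_map => /(canRL (addKr _)) ->.
by rewrite addrC addrA.
Qed.

(** Net change of the sum of [f] over the totals when a clique of total [t] is subdivided. *)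
Definition branch (V : zmodType) (f : nat -> V) (t : nat) : V :=
  (f t.+1 *+ (d.+1 - t %% d.+1) + f t *+ (t %% d.+1) - f t)%R.

Lemma sum_total_children (V : zmodType) c n (f : nat -> V) : valid d c n.+1 ->
  (\sum_(j <- c n) f (total d c n.+1 (child d n (c n) j)) - f (total d c n (c n)) =
   branch f (total d c n (c n)))%R.
Proof.
move=> vn1; have [vn cn] := validS vn1.
set t := total d c n (c n); congr (_ - _)%R.
(* [b j] marks the vertices of least level: replacing such a [j] by a vertex one level above the
   least raises the total by one, replacing any other leaves it unchanged. *)
pose b j := level d c n j == t %/ d.+1.
have -> : (\sum_(j <- c n) f (total d c n.+1 (child d n (c n) j)) =
           \sum_(j <- c n) f (t + b j)%N)%R.
  apply: eq_big_seq => j jc; congr f.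
  have := total_child vn1 jc; have /andP[] := level_range vn cn jc.
  by rewrite -/t /b; case: eqP; lia.
have -> : t %% d.+1 = count (predC b) (c n).
  have := count_predC b (c n); rewrite (card_active_clique vn cn).
  rewrite [count b _]count_low// -/t.
  by have := ltn_pmod t (ltn0Sn d); lia.
have -> : d.+1 - count (predC b) (c n) = count b (c n).
  by rewrite -(card_active_clique vn cn) -(count_predC b) addnK.
elim: (c n : seq nat) => [|j s IHs]; first by rewrite big_nil addr0.
rewrite big_cons IHs /=; case: (b j); rewrite /= ?add0n ?addn0 ?addn1 ?add1n mulrS.
  by rewrite addrA.
by rewrite addrCA.
Qed.

Lemma sum_total_ranS (V : zmodType) c n (f : nat -> V) : valid d c n.+1 ->
  (\sum_(X <- active (ran d c n.+1)) f (total d c n.+1 X) =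
   \sum_(X <- active (ran d c n)) f (total d c n X) +
   branch f (total d c n (c n)))%R.
Proof.
move=> vn1; have [vn cn] := validS vn1.
rewrite sum_active_ranS// total_active// sum_total_children//; congr (_ + _)%R.
by apply: eq_big_seq => X Xa; rewrite total_active.
Qed.

End Levels.

(** * Graph distance and levels *)

Section Walks.
Local Open Scope nat_scope.
Implicit Types (e : rel nat) (k : nat).

Lemma walk0 e x : is_walk e x x 0.
Proof. by exists [::]. Qed.

Lemma walkS e x y z k : e x y -> is_walk e y z k -> is_walk e x z k.+1.
Proof. by move=> exy [p [ep pz pk]]; exists (y :: p); split => /=; rewrite ?exy ?pk. Qed.

Lemma walk_trans e x y z k l :
  is_walk e x y k -> is_walk e y z l -> is_walk e x z (k + l).
Proof.
move=> [p [ep py pk]] [q [eq qz ql]]; exists (p ++ q).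
by rewrite cat_path last_cat size_cat py ep eq pk ql.
Qed.

Lemma walk_sym e x y k : symmetric e -> is_walk e x y k -> is_walk e y x k.
Proof.
move=> es [p [ep py pk]]; exists (rev (belast x p)); split.
- by rewrite -py rev_path (eq_path (e' := e))// => u v; rewrite es.
- by case: p py {ep pk} => [<-//|z p _ /=]; rewrite rev_cons last_rcons.
- by rewrite size_rev size_belast.
Qed.

Lemma sub_walk e e' x y k : subrel e e' -> is_walk e x y k -> is_walk e' x y k.
Proof. by move=> ee' [p [ep py pk]]; exists p; split => //; apply: sub_path ep. Qed.

Lemma gdist_le_walk e x y k : is_walk e x y k -> gdist e x y <= k.
Proof.
move=> w; rewrite /gdist; case: pselect => [h|//].
by case: ex_minnP => m _; apply; apply/asboolP.
Qed.

Lemma gdist_walk e x y k : is_walk e x y k -> is_walk e x y (gdist e x y).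
Proof.
move=> w; rewrite /gdist; case: pselect => [h|[]]; last by exists k; apply/asboolP.
by case: ex_minnP => m /asboolP.
Qed.

Lemma walk_lipschitz e (f : nat -> nat) x y k :
  (forall u v, e u v -> f u <= f v + 1) -> is_walk e x y k -> f x <= f y + k.
Proof.
move=> fe [p [ep <- <-]] {y k}; elim: p x ep => [x _|z p IHp x /= /andP[xz zp]].
  by rewrite addn0.
by have := fe _ _ xz; have := IHp _ zp; lia.
Qed.

(** Since [lab] cannot change along an edge inside the region, a walk between different labels must
    step outside at some [z]. The premise on the endpoints is conditional, so that an endpoint
    already outside serves as [z]. *)
Lemma walk_leaves_region (L : eqType) e (inside : pred nat) (lab : nat -> L) x y k :
  (forall u v, e u v -> inside u -> inside v -> lab u = lab v) ->
  is_walk e x y k -> (inside x -> inside y -> lab x <> lab y) ->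
  exists z a b, [/\ ~~ inside z, is_walk e x z a, is_walk e z y b & a + b = k].
Proof.
move=> labe [p [ep py pk]]; elim: p x k ep py pk => [|u p IHp] x k /=.
  move=> _ -> <- h; exists y, 0, 0; split; try exact: walk0; last by [].
  by apply/negP => iy; apply: h.
move=> /andP[exu ep] py <- h.
have [ix|nix] := boolP (inside x); last first.
  by exists x, 0, (size p).+1; split => //; [exact: walk0|exists (u :: p); rewrite /= exu].
have [|z [a [b [nz wa wb ab]]]] := IHp u (size p) ep py erefl.
  by move=> iu iy; rewrite -(labe _ _ exu)//; apply: h.
exists z, a.+1, b; split => //; [exact: walkS wa|by rewrite addSn ab].
Qed.

End Walks.

Section Distances.
Local Open Scope nat_scope.
Variable d : nat.
Implicit Types (c : nat -> {fset nat}) (X : {fset nat}) (n : nat).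

Lemma adj_ranS c n x y : adj (ran d c n.+1) x y =
  [|| adj (ran d c n) x y, (x == n + d.+2) && (y \in c n)
                         | (y == n + d.+2) && (x \in c n)].
Proof. by rewrite /= nverts_ran. Qed.

Lemma adj_sym c n : symmetric (adj (ran d c n)).
Proof.
elim: n => [|n IHn] x y.
  by rewrite /= eq_sym; congr (_ && _); rewrite andbC.
by rewrite !adj_ranS IHn; congr (_ || _); rewrite orbC.
Qed.

Lemma adj_lt c n : valid d c n ->
  forall x y, adj (ran d c n) x y -> x < n + d.+2 /\ y < n + d.+2.
Proof.
elim: n => [_ x y|n IHn /validS[vn cn] x y]; first by move=> /and3P[].
rewrite adj_ranS addSn !ltnS => /or3P[/(IHn vn)[] ? ?|/andP[/eqP-> yc]|/andP[/eqP-> xc]].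
- by split; apply: ltnW.
- by rewrite leqnn ltnW// (active_lt vn cn).
- by rewrite leqnn ltnW// (active_lt vn cn).
Qed.

Lemma level_adj c n : valid d c n -> forall x y, adj (ran d c n) x y ->
  level d c n x <= level d c n y + 1.
Proof.
elim: n => [_ x y _ /=|n IHn vn1 x y]; first by rewrite addn1 (leq_trans (leq_b1 _)).
have [vn cn] := validS vn1.
rewrite adj_ranS => /or3P[axy|/andP[/eqP-> yc]|/andP[/eqP-> xc]].
- by have [xn yn] := adj_lt vn axy; rewrite !level_old ?IHn.
- rewrite level_new level_old ?(active_lt vn cn)//.
  by have := level_range vn cn yc; lia.
- rewrite level_new level_old ?(active_lt vn cn)//.
  by have := level_range vn cn xc; lia.
Qed.

Lemma exists_low c n X : valid d c n -> X \in active (ran d c n) ->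
  exists2 x, x \in X & level d c n x = total d c n X %/ d.+1.
Proof.
move=> vn Xa; have : 0 < count (fun x => level d c n x == total d c n X %/ d.+1) X.
  by rewrite count_low// subn_gt0 ltn_pmod.
by rewrite -has_count => /hasP[x xX /eqP ex]; exists x.
Qed.

(** A new vertex is adjacent to a vertex of level exactly one less ([exists_low]), so following such
    neighbours down takes [level] steps. *)
Lemma walk_to_root c n : valid d c n -> forall x, x < n + d.+2 ->
  exists2 z, z <= d & is_walk (adj (ran d c n)) x z (level d c n x).
Proof.
elim: n => [_ x xd|n IHn vn1 x].
  rewrite /=; case: ltnP => [dx|xd']; last by exists x => //; exact: walk0.
  exists 0 => //; exists [:: 0]; split => //=.
  by rewrite xd andbT andbT; case: x dx {xd}.
have [vn cn] := validS vn1.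
have sub : subrel (adj (ran d c n)) (adj (ran d c n.+1)).
  by move=> u v; rewrite adj_ranS => ->.
rewrite addSn ltnS leq_eqVlt => /orP[/eqP ->|xn]; last first.
  have [z zd w] := IHn vn x xn; exists z => //.
  by rewrite level_old//; apply: sub_walk w.
have [y yc ey] := exists_low vn cn.
have [z zd w] := IHn vn y (active_lt vn cn yc); exists z => //.
rewrite level_new -ey; apply: (@walkS _ _ y); last exact: sub_walk w.
by rewrite adj_ranS eqxx yc !orbT.
Qed.

Lemma adj_root c n z z' : z <= d -> z' <= d -> z != z' -> adj (ran d c n) z z'.
Proof.
elim: n => [|n IHn] zd zd' zz'; last by rewrite adj_ranS IHn.
by rewrite /= zz' !ltnS !leqW.
Qed.

(** Descend from both ends; the extra [1] is the edge between the two vertices of the initial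
    simplex that are reached. *)
Lemma walk_level c n x y : valid d c n -> x < n + d.+2 -> y < n + d.+2 ->
  exists2 k, k <= level d c n x + level d c n y + 1 & is_walk (adj (ran d c n)) x y k.
Proof.
move=> vn xn yn; have [z zd wx] := walk_to_root vn xn.
have [z' zd' /(walk_sym (@adj_sym c n)) wy] := walk_to_root vn yn.
have [e|zz'] := eqVneq z z'.
  exists (level d c n x + level d c n y); first by rewrite leq_addr.
  by apply: walk_trans wx _; rewrite e.
exists (level d c n x + (level d c n y).+1); first by lia.
by apply: walk_trans wx (walkS _ wy); apply: adj_root.
Qed.

Lemma gdist_le_levels c n x y : valid d c n -> x < n + d.+2 -> y < n + d.+2 ->
  gdist (adj (ran d c n)) x y <= level d c n x + level d c n y + 1.
Proof.
move=> vn xn yn; have [k kle /gdist_le_walk] := walk_level vn xn yn.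
by move=> h; apply: leq_trans h kle.
Qed.

Variable n0 : nat.

(* The active clique of the network at time [n0] into which [X] was inserted. *)
Fixpoint ancestor c n X : {fset nat} :=
  if n is m.+1 then
    if (n0 <= m) && (m + d.+2 \in X) then ancestor c m (c m) else ancestor c m X
  else X.

(** The vertex numbered [m + d + 2] was inserted into [c m], so its label is the ancestor of that
    clique. The subtraction truncates for the smallest vertices; labels are compared only from
    [n0 + d + 2] on. *)
Definition vancestor c x := ancestor c (x - d.+2) (c (x - d.+2)).

Lemma ancestor_old c n X : n + d.+2 \notin X -> ancestor c n.+1 X = ancestor c n X.
Proof. by move=> /negbTE /= ->; rewrite andbF. Qed.

Lemma ancestor_start c X : ancestor c n0 X = X.
Proof.
suff h : forall m, m <= n0 -> ancestor c m X = X by apply: h.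
by elim=> //= m IHm mn; rewrite leqNgt mn IHm// ltnW.
Qed.

Lemma ancestor_child c n j : n0 <= n ->
  ancestor c n.+1 (child d n (c n) j) = ancestor c n (c n).
Proof. by move=> nn /=; rewrite nn !inE eqxx. Qed.

Lemma vancestor_new c n : vancestor c (n + d.+2) = ancestor c n (c n).
Proof. by rewrite /vancestor addnK. Qed.

Lemma vancestor_active c n : valid d c n -> forall X x, X \in active (ran d c n) ->
  x \in X -> n0 + d.+2 <= x -> vancestor c x = ancestor c n X.
Proof.
elim: n => [vn|n IHn vn1] X x.
  by move=> Xa /(active_lt vn Xa); rewrite add0n; lia.
have [vn cn] := validS vn1.
move=> /active_ranSP[[Xa _]|[j jc ->]] xX xn.
  by rewrite ancestor_old ?(new_notin vn)//; apply: IHn.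
have nn : n0 <= n.
  have := active_lt vn1 (_ : child d n (c n) j \in _) xX; rewrite addSn ltnS => h.
  suff : n0 + d.+2 <= n + d.+2 by rewrite leq_add2r.
  by apply: leq_trans xn (h _); apply/active_ranSP; right; exists j.
rewrite ancestor_child//; move: xX; rewrite !inE => /orP[/eqP ->|/andP[_ xc]].
  exact: vancestor_new.
exact: IHn.
Qed.

(** An edge between two vertices inserted after time [n0] joins the later one to a member of the
    clique it entered, so both descend from the same clique of time [n0]. Deleting the vertices of
    time [n0] thus disconnects different labels. *)
Lemma vancestor_adj c n : valid d c n -> forall x y, adj (ran d c n) x y ->
  n0 + d.+2 <= x -> n0 + d.+2 <= y -> vancestor c x = vancestor c y.
Proof.
elim: n => [vn|n IHn vn1] x y.
  by move=> /(adj_lt vn)[]; rewrite !add0n; lia.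
have [vn cn] := validS vn1.
rewrite adj_ranS => /or3P[axy|/andP[/eqP-> yc]|/andP[/eqP-> xc]] xn yn.
- exact: IHn.
- by rewrite vancestor_new (vancestor_active vn cn yc).
- by rewrite vancestor_new (vancestor_active vn cn xc).
Qed.

Lemma level_mono c n m x : x < n + d.+2 -> n <= m -> level d c m x = level d c n x.
Proof.
move=> xn /subnK <-; elim: (m - n) => // k IHk.
by rewrite addSn level_old//; lia.
Qed.

Lemma valid_le c n m : valid d c n -> m <= n -> valid d c m.
Proof. by move=> vn mn k km; apply: vn; apply: leq_trans mn. Qed.

(** A shortest walk visits a vertex [z] of time [n0], of level at most [n0 + 1]. Levels change by at
    most one per edge, so each half of the walk is at least as long as the level of its endpoint
    minus [n0 + 1]. *)
Lemma levels_le_gdist c n x y : valid d c n -> n0 <= n -> x < n + d.+2 -> y < n + d.+2 ->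
  (n0 + d.+2 <= x -> n0 + d.+2 <= y -> vancestor c x <> vancestor c y) ->
  level d c n x + level d c n y <= gdist (adj (ran d c n)) x y + n0.+1.*2.
Proof.
move=> vn nn xn yn xy; have [k _ /gdist_walk w] := walk_level vn xn yn.
have [|z [a [b [nz wa wb <-]]]] := walk_leaves_region
  (inside := fun x => n0 + d.+2 <= x) (lab := vancestor c) _ w xy.
  by move=> u v auv un1 un2; apply: vancestor_adj auv un1 un2.
have zl : level d c n z <= n0.+1.
  move: nz; rewrite -ltnNge => zn; rewrite (level_mono c zn nn).
  by apply: level_le => //; apply: valid_le vn nn.
have := walk_lipschitz (level_adj vn) wa.
have := walk_lipschitz (level_adj vn) (walk_sym (@adj_sym c n) wb).
lia.
Qed.

End Distances.

(** * Hopcounts of sampled cliques and vertices *)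

Section Histories.
Local Open Scope nat_scope.
Variable d : nat.
Implicit Types (c : nat -> {fset nat}) (X C : {fset nat}) (n : nat).

Definition upd c n C : nat -> {fset nat} := fun k => if k == n then C else c k.

Lemma upd_same c n C : upd c n C n = C.
Proof. by rewrite /upd eqxx. Qed.

Lemma upd_lt c n C k : k < n -> upd c n C k = c k.
Proof. by move=> kn; rewrite /upd ltn_eqF. Qed.

Lemma ran_ext c c' n : (forall k, k < n -> c k = c' k) -> ran d c n = ran d c' n.
Proof.
elim: n => //= n IHn cc'; rewrite cc'// IHn// => k kn.
by rewrite cc'// ltnW.
Qed.

Lemma level_ext c c' n : (forall k, k < n -> c k = c' k) ->
  forall v, level d c n v = level d c' n v.
Proof.
elim: n => //= n IHn cc' v; rewrite cc'//.
have lv : forall v, level d c n v = level d c' n v.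
  by apply: IHn => k kn; rewrite cc'// ltnW.
by rewrite lv; congr (if _ then (_ %/ _).+1 else _); apply: eq_bigr.
Qed.

Lemma total_ext c c' n X : (forall k, k < n -> c k = c' k) ->
  total d c n X = total d c' n X.
Proof. by move=> cc'; apply: eq_bigr => x _; apply: level_ext. Qed.

Lemma ancestor_ext n0 c c' n : (forall k, k < n -> c k = c' k) ->
  forall X, ancestor d n0 c n X = ancestor d n0 c' n X.
Proof.
elim: n => //= n IHn cc' X; rewrite cc'//.
by rewrite !IHn// => k kn; rewrite cc'// ltnW.
Qed.

Lemma valid_upd c n C : valid d c n -> C \in active (ran d c n) ->
  valid d (upd c n C) n.+1.
Proof.
move=> vn Ca k; rewrite ltnS => kn.
rewrite (@ran_ext _ c) => [|j jk]; last by rewrite upd_lt// (leq_trans jk).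
by move: kn; rewrite /upd leq_eqVlt; case: eqP => [->//|_ /= kn]; apply: vn.
Qed.

Lemma ran_upd c n C : ran d (upd c n C) n = ran d c n.
Proof. by apply: ran_ext => k; apply: upd_lt. Qed.

(** The two insertions are read as two more steps of a prolonged history, which makes the results on
    [ran] available. For [C != C'] the second clique is still active after the first insertion, so
    validity is kept. *)
Lemma clique_hopE c n C C' : C != C' ->
  clique_hop (ran d c n) C C' =
  gdist (adj (ran d (upd (upd c n C) n.+1 C') n.+2)) (n + d.+2) (n.+1 + d.+2).
Proof.
move=> /negbTE CC'; rewrite /clique_hop CC' nverts_ran addSn; congr (gdist (adj _)).
by rewrite /= upd_same upd_lt// upd_same (@ran_ext _ c)// => k kn; rewrite !upd_lt// ltnW.
Qed.

Section ActivePair.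
Variables (c : nat -> {fset nat}) (n : nat) (C C' : {fset nat}).
Hypotheses (vn : valid d c n) (Ca : C \in active (ran d c n))
  (Ca' : C' \in active (ran d c n)) (CC' : C != C').

Let c2 := upd (upd c n C) n.+1 C'.

Let valid2 : valid d c2 n.+2.
Proof.
apply: valid_upd; first exact: valid_upd.
by apply/active_ranSP; left; rewrite ran_upd upd_same eq_sym.
Qed.

Let c2E k : k < n -> c2 k = c k.
Proof. by move=> kn; rewrite /c2 !upd_lt// ltnW. Qed.

Let lt_first : n + d.+2 < n.+2 + d.+2. Proof. by lia. Qed.
Let lt_second : n.+1 + d.+2 < n.+2 + d.+2. Proof. by lia. Qed.

Let level_first : level d c2 n.+2 (n + d.+2) = (total d c n C %/ d.+1).+1.
Proof.
rewrite level_old ?addSn// level_new.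
by rewrite (_ : c2 n = C) ?(total_ext _ c2E)// /c2 upd_lt// upd_same.
Qed.

Let level_second : level d c2 n.+2 (n.+1 + d.+2) = (total d c n C' %/ d.+1).+1.
Proof.
rewrite level_new (_ : c2 n.+1 = C') ?/c2 ?upd_same//.
rewrite total_old ?(total_ext _ c2E)// => x.
exact: (active_lt vn Ca').
Qed.

Lemma clique_hop_le :
  clique_hop (ran d c n) C C' <= total d c n C %/ d.+1 + total d c n C' %/ d.+1 + 3.
Proof.
rewrite clique_hopE//.
have := gdist_le_levels valid2 lt_first lt_second.
by rewrite level_first level_second -/c2; lia.
Qed.

Lemma clique_hop_ge n0 : n0 <= n -> ancestor d n0 c n C <> ancestor d n0 c n C' ->
  total d c n C %/ d.+1 + total d c n C' %/ d.+1 <=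
  clique_hop (ran d c n) C C' + n0.+1.*2.
Proof.
move=> nn anc; rewrite clique_hopE//.
have anc_first : vancestor d n0 c2 (n + d.+2) = ancestor d n0 c n C.
  rewrite vancestor_new (_ : c2 n = C) ?(ancestor_ext _ c2E)//.
  by rewrite /c2 upd_lt// upd_same.
have anc_second : vancestor d n0 c2 (n.+1 + d.+2) = ancestor d n0 c n C'.
  rewrite vancestor_new (_ : c2 n.+1 = C') ?/c2 ?upd_same//.
  by rewrite ancestor_old ?(new_notin vn Ca')// -/c2 (ancestor_ext _ c2E).
have := levels_le_gdist valid2 (leqW (leqW nn)) lt_first lt_second.
rewrite anc_first anc_second level_first level_second -/c2.
by move=> /(_ (fun _ _ => anc)); lia.
Qed.

End ActivePair.

Lemma vertex_hop_le c n C C' v w : valid d c n ->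
  C \in active (ran d c n) -> C' \in active (ran d c n) -> v \in C -> w \in C' ->
  vertex_hop (ran d c n) v w <= total d c n C %/ d.+1 + total d c n C' %/ d.+1 + 3.
Proof.
move=> vn Ca Ca' vC wC.
have := gdist_le_levels vn (active_lt vn Ca vC) (active_lt vn Ca' wC).
have /andP[_] := level_range vn Ca vC; have /andP[_] := level_range vn Ca' wC.
rewrite /vertex_hop; lia.
Qed.

Lemma vertex_hop_ge c n n0 C C' v w : valid d c n -> n0 <= n ->
  C \in active (ran d c n) -> C' \in active (ran d c n) -> v \in C -> w \in C' ->
  ancestor d n0 c n C <> ancestor d n0 c n C' ->
  total d c n C %/ d.+1 + total d c n C' %/ d.+1 <=
  vertex_hop (ran d c n) v w + n0.+1.*2.
Proof.
move=> vn nn Ca Ca' vC wC anc.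
have := levels_le_gdist vn nn (active_lt vn Ca vC) (active_lt vn Ca' wC).
have /andP[+ _] := level_range vn Ca vC; have /andP[+ _] := level_range vn Ca' wC.
rewrite /vertex_hop => h1 h2 h3.
suff /h3 : n0 + d.+2 <= v -> n0 + d.+2 <= w -> vancestor d n0 c v <> vancestor d n0 c w.
  by lia.
by move=> vn0 wn0; rewrite (vancestor_active vn Ca vC)// (vancestor_active vn Ca' wC).
Qed.

End Histories.

(** * The size-biased law *)

Section SizeBias.
Variables (R : realType) (d : nat).
Implicit Types (c : nat -> {fset nat}) (n : nat).

Lemma count_iota_last (p : pred nat) n :
  count p (iota 0 n.+1) = (count p (iota 0 n) + p n)%N.
Proof. by rewrite -(addn1 n) iotaD count_cat /= addn0. Qed.

Lemma adj_new c n y : valid d c n.+1 ->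
  adj (ran d c n.+1) (n + d.+2)%N y = (y \in c n).
Proof.
move=> /validS[vn cn]; rewrite adj_ranS eqxx (negbTE (new_notin vn cn)) andbF orbF.
by case: (boolP (adj _ _ _)) => [/(adj_lt vn)[]|//]; rewrite ltnn.
Qed.

Lemma degree_new c n : valid d c n.+1 -> degree (ran d c n.+1) (n + d.+2)%N = d.+1.
Proof.
move=> vn1; have [vn cn] := validS vn1.
rewrite /degree nverts_ran (eq_count (a2 := mem (c n))); last first.
  by move=> y; rewrite adj_new.
rewrite -[RHS](card_active_clique vn cn) -size_filter; apply: perm_size.
apply: uniq_perm => [||y]; rewrite ?filter_uniq ?iota_uniq ?fset_uniq//.
rewrite mem_filter mem_iota add0n leq0n andTb.
case: (boolP (y \in c n)) => yc; last by rewrite inE (negbTE yc).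
by rewrite inE yc addSn ltnS ltnW// (active_lt vn cn).
Qed.

Lemma degree_old c n v : valid d c n.+1 -> (v < n + d.+2)%N ->
  degree (ran d c n.+1) v = (degree (ran d c n) v + (v \in c n))%N.
Proof.
move=> vn1 vlt; have [vn cn] := validS vn1.
rewrite /degree !nverts_ran addSn count_iota_last.
congr (_ + _)%N; last first.
  rewrite adj_ranS eqxx (ltn_eqF vlt)/=.
  by case: (boolP (adj _ _ _)) => [/(adj_lt vn)[_]|//]; rewrite ltnn.
apply: eq_in_count => y; rewrite mem_iota add0n leq0n andTb => yn.
by rewrite adj_ranS (ltn_eqF vlt) (ltn_eqF yn) !orbF.
Qed.

Lemma degree0 c v : (v < d.+2)%N -> degree (ran d c 0) v = d.+1.
Proof.
move=> vd; rewrite /degree -[nverts _]/d.+2.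
rewrite (_ : count _ _ = count (predC (pred1 v)) (iota 0 d.+2)).
  apply/eqP; rewrite -(eqn_add2l (count (pred1 v) (iota 0 d.+2))) count_predC.
  by rewrite count_uniq_mem ?iota_uniq// mem_iota vd size_iota.
apply: eq_in_count => y; rewrite mem_iota add0n /= => yd.
by rewrite vd yd !andbT eq_sym.
Qed.

Lemma sum_natr_count (T : Type) (s : seq T) (p : pred T) :
  \sum_(x <- s) (p x)%:R = (count p s)%:R :> R.
Proof.
elim: s => [|x s IHs]; first by rewrite big_nil.
by rewrite big_cons IHs /= natrD.
Qed.

Lemma perm_active_ran0 c : perm_eq (active (ran d c 0))
  [seq [fset x in iota 0 d.+2 | x != j]%fset | j <- iota 0 d.+1].
Proof.
apply: uniq_perm => [||X]; first exact: fset_uniq.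
  rewrite map_inj_in_uniq ?iota_uniq// => i j.
  rewrite !mem_iota => /andP[_ id] /andP[_ jd] /fsetP/(_ j).
  by rewrite !in_facet eqxx ltnS ltnW//= => /negbFE/eqP.
apply/active_ran0P/mapP => -[j jd ->]; exists j => //; first by rewrite mem_iota.
by move: jd; rewrite mem_iota.
Qed.

Lemma count_neq (T : eqType) (s : seq T) (x : T) : uniq s ->
  (count (fun y => x != y) s + (x \in s) = size s)%N.
Proof.
move=> us; rewrite -(count_uniq_mem x us) -(count_predC (pred1 x)) addnC; congr (_ + _)%N.
by apply: eq_count => y /=; rewrite eq_sym.
Qed.

(** A new vertex has degree [d + 1] and lies in [d + 1] active cliques, and each later neighbour
    replaces one active clique through the vertex by [d]; this is the slope [d - 1] of the weight.
    The extra 1 for [v <= d] stands for the initial simplex, which is never active: the law is that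
    of a uniform vertex of a uniform clique among the active ones and this simplex. *)
Lemma size_bias_ran c n : valid d c n -> forall v, (v < n + d.+2)%N ->
  size_bias d (ran d c n) v =
  \sum_(X <- active (ran d c n)) (v \in X)%:R + (v <= d)%N%:R :> R.
Proof.
rewrite /size_bias; elim: n => [_ v vd|n IHn vn1 v].
  rewrite degree0// (perm_big _ (perm_active_ran0 c)) big_map /=.
  under eq_bigr do rewrite in_facet vd.
  rewrite sum_natr_count -natrD.
  have := count_neq v (iota_uniq 0 d.+1); rewrite mem_iota size_iota add0n ltnS leq0n andTb => ->.
  by rewrite -[d.+1]addn1 natrD; ring.
have [vn cn] := validS vn1.
rewrite sum_active_ranS// addSn ltnS leq_eqVlt => /orP[/eqP ->|vlt].
  rewrite degree_new// big_seq big1 ?add0r; last first.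
    by move=> X Xa; rewrite (negbTE (new_notin vn Xa)).
  rewrite (negbTE (new_notin vn cn)) subr0.
  have -> : \sum_(j <- c n) ((n + d.+2)%N \in child d n (c n) j)%:R = d.+1%:R :> R.
    rewrite (sum_natr_count (c n) (fun j => (n + d.+2)%N \in child d n (c n) j)).
    rewrite -[in RHS](card_active_clique vn cn); congr _%:R.
    by apply/eqP; rewrite -all_count; apply/allP => j _; rewrite !inE eqxx.
  rewrite [(_ <= d)%N]leqNgt (leq_trans (ltnSn d)) ?addr0; last by lia.
  by rewrite -[d.+1]addn1 natrD; ring.
rewrite degree_old// natrD mulrDr.
have -> : \sum_(j <- c n) (v \in child d n (c n) j)%:R = (v \in c n)%:R * d%:R :> R.
  rewrite (sum_natr_count (c n) (fun j => v \in child d n (c n) j)) -natrM; congr _%:R.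
  case: (boolP (v \in c n)) => vc.
    have := count_neq v (fset_uniq (c n)); rewrite vc (card_active_clique vn cn) addn1 => -[e].
    rewrite mul1n -[RHS]e; apply: eq_in_count => j jc.
    by rewrite !inE vc (ltn_eqF vlt) andbT.
  rewrite mul0n; apply/eqP; rewrite -leqn0 leqNgt -has_count; apply/hasPn => j jc.
  by rewrite !inE (negbTE vc) (ltn_eqF vlt) andbF.
by have := IHn vn v vlt; lra.
Qed.

End SizeBias.

(** * Expectations over the choices *)

Section Expectation.
Variables (R : realType) (d : nat).
Implicit Types (F G : (nat -> {fset nat}) -> R) (n : nat).

Definition average (A : {fset {fset nat}}) (f : {fset nat} -> R) : R :=
  (\sum_(X <- A) f X) / #|` A|%:R.

Lemma average_le A f g : {in A, forall X, f X <= g X} -> average A f <= average A g.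
Proof.
move=> fg; rewrite /average ler_wpM2r ?invr_ge0 ?ler0n//.
by rewrite big_seq [leRHS]big_seq; apply: ler_sum.
Qed.

Lemma average_cst A k : (0 < #|` A|)%N -> average A (fun=> k) = k.
Proof.
move=> A0; rewrite /average big_const_seq count_predT iter_addr_0.
by rewrite -[k *+ _]mulr_natr mulfK// pnatr_eq0 -lt0n.
Qed.

Lemma averageD A f g : average A (fun X => f X + g X) = average A f + average A g.
Proof. by rewrite /average big_split mulrDl. Qed.

Lemma averageZ A k f : average A (fun X => k * f X) = k * average A f.
Proof. by rewrite /average -mulr_sumr mulrA. Qed.

(* Expectation of a functional of the first [n] choices; the recursion averages
   over the last choice first. *)
Fixpoint expect n F : R :=
  if n is m.+1
  then expect m (fun c => average (active (ran d c m)) (fun C => F (upd c m C)))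
  else F (fun=> fset0).

Lemma expect_le n F G : (forall c, valid d c n -> F c <= G c) -> expect n F <= expect n G.
Proof.
elim: n F G => [|n IHn] F G FG /=; first exact: FG.
apply: IHn => c vn; apply: average_le => X Xa; apply: FG; exact: valid_upd.
Qed.

Lemma eq_expect n F G : (forall c, valid d c n -> F c = G c) -> expect n F = expect n G.
Proof. by move=> FG; apply/eqP; rewrite eq_le !expect_le// => c /FG ->. Qed.

Lemma expectD n F G : expect n (fun c => F c + G c) = expect n F + expect n G.
Proof.
elim: n F G => [//|n IHn] F G /=; rewrite -IHn; apply: eq_expect => c _.
exact: averageD.
Qed.

Lemma expect_cst n k : expect n (fun=> k) = k.
Proof.
elim: n => //= n IHn; rewrite -[RHS]IHn; apply: eq_expect => c vn.
by rewrite average_cst// card_active// addnS.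
Qed.

End Expectation.

(** * Sampling probabilities as expectations over histories *)

Section Probability.
Context {R : realType} {dT : measure_display} {T : measurableType dT}.
Variables (P : probability T R) (d : nat) (C : nat -> T -> {fset nat}).
Hypothesis C_ran : ran_process P d C.
Implicit Types (n : nat) (c : nat -> {fset nat}).

Let pr (A : set T) : R := fine (P A).

Lemma prE A : measurable A -> P A = (pr A)%:E.
Proof. by move=> mA; rewrite fineK// fin_num_measure. Qed.

Lemma sum_disjoint_le (I : eqType) (s : seq I) (F : I -> set T) B :
  uniq s -> measurable B -> {in s, forall i, measurable (F i) /\ F i `<=` B} ->
  (forall i j, i != j -> F i `&` F j = set0) -> \sum_(i <- s) pr (F i) <= pr B.
Proof.
elim: s B => [B _ mB _ _|i s IHs B]; first by rewrite big_nil fine_ge0.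
move=> /= /andP[iNs us] mB FB Fd; rewrite big_cons.
have [mFi FiB] := FB i (mem_head _ _).
have mD : measurable (B `\` F i) by apply: measurableD.
have -> : pr B = pr (F i) + pr (B `\` F i).
  apply: EFin_inj; rewrite EFinD -!prE// -measureU//; last by rewrite setDIK.
  by congr (P _); rewrite setDUK.
rewrite lerD2l; apply: IHs => // j js.
have [mFj FjB] := FB j (mem_behead (s := i :: s) js); split => // w Fjw; split; first exact: FjB.
move=> Fiw; have ij : i != j by apply: contraNneq iNs => ->.
by have := Fd _ _ ij; rewrite -subset0; apply; split; [exact: Fiw|].
Qed.

Lemma historyS c n :
  history C c n.+1 = history C c n `&` C n @^-1` [set c n].
Proof.
apply/seteqP; split => [w h|w [h1 h2] k].
  by split => [k kn|]; apply: h => //; apply: ltnW.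
by rewrite ltnS leq_eqVlt => /orP[/eqP ->//|]; apply: h1.
Qed.

Lemma measurable_history c n : measurable (history C c n).
Proof.
elim: n => [|n IHn]; last by rewrite historyS; apply: measurableI => //; apply: C_ran.1.
by rewrite (_ : history _ _ _ = setT)//; apply/seteqP; split.
Qed.

Lemma history_upd c n X : history C (upd c n X) n = history C c n.
Proof.
by apply/seteqP; split => w h k kn; have := h k kn; rewrite upd_lt.
Qed.

(** Induction on the last choice, adding up over the disjoint events that fix it. Only the mass of
    valid histories is collected, hence an inequality; [sample_probE] gets equality by applying it
    to an event and to its complement, whose expectations add up to 1. *)
Lemma expect_le_prob n (f : (nat -> {fset nat}) -> R) (A : set T) : measurable A ->
  (forall c, valid d c n -> pr (history C c n) * f c <= pr (history C c n `&` A)) ->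
  expect d n f <= pr A.
Proof.
move=> mA; elim: n f => [|n IHn] f fA /=.
  have := fA (fun=> fset0) (fun k => ltac:(done)).
  rewrite (_ : history _ _ _ = setT); last by apply/seteqP; split.
  by rewrite /pr probability_setT mul1r setTI.
apply: IHn => c vn; set h := history C c n.
have mh : measurable h by exact: measurable_history.
apply: (le_trans (_ : _ <=
  \sum_(X <- active (ran d c n)) pr (history C (upd c n X) n.+1 `&` A))); last first.
  apply: sum_disjoint_le => //; first exact: measurableI.
    move=> X _; split; first by apply: measurableI => //; exact: measurable_history.
    by move=> w; rewrite historyS history_upd => -[[hw _] Aw].
  move=> X Y XY; rewrite -subset0 => w; rewrite !historyS !upd_same.
  by case=> -[[_ /= e1] _] [[_ /= e2] _]; move/eqP: XY; apply; rewrite -e1 -e2.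
rewrite /average mulrCA mulr_suml.
rewrite big_seq [leRHS]big_seq; apply: ler_sum => X Xa.
apply: le_trans (fA _ (valid_upd vn Xa)).
have -> : pr (history C (upd c n X) n.+1) = pr h * #|` active (ran d c n)|%:R^-1.
  rewrite /pr C_ran.2 history_upd upd_same ran_upd /active_pmf Xa.
  by rewrite prE// -EFinM /= div1r.
by rewrite mulrC.
Qed.

Section Samples.
Variables (K : countType) (n : nat) (U V : T -> K) (q : apollonian -> K -> R).
Hypothesis UV : iid_given_ran P d C n q U V.
Variable supp : apollonian -> seq K.
Hypothesis supp_uniq : forall c, valid d c n -> uniq (supp (ran d c n)).
Hypothesis supp_sum : forall c, valid d c n -> \sum_(u <- supp (ran d c n)) q (ran d c n) u = 1.
Variable E : apollonian -> K -> K -> bool.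

(** The first [n] choices and the two samples form one variable with values in a countable type, so
    the event is a countable union of its fibres. *)
Lemma measurable_sample (D : apollonian -> K -> K -> bool) :
  measurable [set w | D (ran d (fun k => C k w) n) (U w) (V w)].
Proof.
pose code w := (mkseq (fun k => C k w) n, U w, V w).
pose holds (x : seq {fset nat} * K * K) := D (ran d (nth fset0 x.1.1) n) x.1.2 x.2.
rewrite (_ : [set w | _] = \bigcup_(i : nat)
  (if @choice.unpickle (seq {fset nat} * K * K)%type i is Some x then
    if holds x then code @^-1` [set x] else set0 else set0)); last first.
  apply/seteqP; split => [w Dw|w [i _]].
    exists (choice.pickle (code w)) => //; rewrite choice.pickleK.
    suff -> : holds (code w) by [].
    rewrite /holds /= (@ran_ext _ _ (fun k => C k w))// => k kn.
    by rewrite nth_mkseq.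
  case: choice.unpickle => // x; case: ifP => // hx /= xE.
  move: hx; rewrite -xE /holds /= (@ran_ext _ _ (fun k => C k w))// => k kn.
  by rewrite nth_mkseq.
apply: bigcupT_measurable => i; case: choice.unpickle => // -[[s u] v]; case: ifP => // _.
have [mU mV _] := UV.
rewrite (_ : _ @^-1` _ =
  [set w | mkseq (fun k => C k w) n = s] `&` (U @^-1` [set u] `&` V @^-1` [set v])).
  apply: measurableI; last by apply: measurableI; [exact: mU|exact: mV].
  elim: n s => [|m IHm] s.
    by case: s => [|x s]; [rewrite (_ : [set _ | _] = setT)|rewrite (_ : [set _ | _] = set0)];
      rewrite //; apply/seteqP; split.
  case/lastP: s => [|s x].
    by rewrite (_ : [set _ | _] = set0)//; apply/seteqP; split => w.
  rewrite (_ : [set _ | _] = [set w | mkseq (fun k => C k w) m = s] `&` (C m @^-1` [set x])).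
    by apply: measurableI => //; exact: C_ran.1.
  apply/seteqP; split => w /=; rewrite mkseqS.
    by move/rcons_inj => -[].
  by move=> [-> ->].
apply/seteqP; split => w /=; first by rewrite /code => -[<- <- <-].
by move=> [<- [<- <-]].
Qed.

Let samples_le (D : apollonian -> K -> K -> bool) :
  expect d n (fun c => let g := ran d c n in
    \sum_(u <- supp g) \sum_(v <- supp g) q g u * q g v * (D g u v)%:R) <=
  pr [set w | D (ran d (fun k => C k w) n) (U w) (V w)].
Proof.
have [mU mV UVq] := UV.
apply: expect_le_prob => [|c vn /=]; first exact: measurable_sample.
set g := ran d c n; set h := history C c n.
have mh : measurable h by exact: measurable_history.
pose F (x : K * K) := h `&` (U @^-1` [set x.1] `&` V @^-1` [set x.2]).
have mF x : measurable (F x).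
  by apply: measurableI => //; apply: measurableI; [exact: mU|exact: mV].
have -> : \sum_(u <- supp g) \sum_(v <- supp g) q g u * q g v * (D g u v)%:R =
    \sum_(x <- [seq (u, v) | u <- supp g, v <- supp g])
      q g x.1 * q g x.2 * (D g x.1 x.2)%:R by rewrite big_allpairs.
rewrite (_ : _ * _ =
  \sum_(x <- [seq x <- [seq (u, v) | u <- supp g, v <- supp g] | D g x.1 x.2]) pr (F x)).
  apply: sum_disjoint_le.
  - rewrite filter_uniq// allpairs_uniq ?supp_uniq//.
    by move=> [u v] [u' v'] _ _ [-> ->].
  - by apply: measurableI => //; exact: measurable_sample.
  - move=> x; rewrite mem_filter => /andP[Dx _]; split=> // w [hw [/= Uw Vw]].
    split => //=; rewrite Uw Vw (@ran_ext _ _ c)// => k kn; exact: hw.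
  - move=> [u v] [u' v'] ne; rewrite -subset0 => w [[_ [/= e1 e2]] [_ [/= e3 e4]]].
    by move/eqP: ne; apply; rewrite -e1 -e2 -e3 -e4.
rewrite big_filter [RHS]big_mkcond mulr_sumr; apply: eq_bigr => -[u v] _ /=.
case: (D g u v); last by rewrite !mulr0.
by apply: EFin_inj; rewrite mulr1 EFinM -!prE// /F UVq.
Qed.

Lemma sample_probE : P [set w | E (ran d (fun k => C k w) n) (U w) (V w)] =
  (expect d n (fun c => let g := ran d c n in
    \sum_(u <- supp g) \sum_(v <- supp g) q g u * q g v * (E g u v)%:R))%:E.
Proof.
have mE := measurable_sample E.
rewrite prE//; congr _%:E; apply/eqP; rewrite eq_le samples_le andbT.
pose E' g u v := ~~ E g u v; have := samples_le E'.
have -> : [set w | E' (ran d (fun k => C k w) n) (U w) (V w)] =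
          ~` [set w | E (ran d (fun k => C k w) n) (U w) (V w)].
  by apply/seteqP; split => w /= /negP.
have -> : pr (~` [set w | E (ran d (fun k => C k w) n) (U w) (V w)]) =
  1 - pr [set w | E (ran d (fun k => C k w) n) (U w) (V w)].
  by apply: EFin_inj; rewrite EFinB -!prE//; [exact: probability_setC|exact: measurableC].
set e := expect _ _ _; set e' := expect _ _ _.
suff <- : e' + e = 1 by lra.
rewrite -(expect_cst d n (1 : R)) -expectD; apply: eq_expect => c vn /=.
rewrite -big_split /= -[RHS](supp_sum vn); apply: eq_bigr => u _.
rewrite -big_split /= -[RHS]mulr1 -[in RHS](supp_sum vn) mulr_sumr.
apply: eq_bigr => v _; rewrite -mulrDr /E'; case: E; by rewrite /= ?addr0 ?add0r mulr1.
Qed.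

End Samples.
End Probability.

(** * The recursion for means over pairs of active cliques *)

Section PairMeans.
Variables (R : realType) (d : nat).
Implicit Types (c : nat -> {fset nat}) (n : nat) (X Y C : {fset nat}).

Definition nactive n : R := (n * d + d.+1)%:R.

Lemma nactive_gt0 n : 0 < nactive n.
Proof. by rewrite ltr0n addnS. Qed.

Lemma nactiveS n : nactive n.+1 = nactive n + d%:R.
Proof. by rewrite /nactive mulSn -natrD; congr _%:R; lia. Qed.

Definition pmean c n (F : {fset nat} -> {fset nat} -> R) : R :=
  (\sum_(X <- active (ran d c n)) \sum_(Y <- active (ran d c n)) F X Y) / nactive n ^+ 2.

Lemma pmean_le c n F G :
  {in active (ran d c n) &, forall X Y, F X Y <= G X Y} -> pmean c n F <= pmean c n G.
Proof.
move=> FG; rewrite /pmean ler_wpM2r ?invr_ge0 ?exprn_ge0 ?(ltW (nactive_gt0 _))//.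
rewrite big_seq [leRHS]big_seq; apply: ler_sum => X Xa.
rewrite big_seq [leRHS]big_seq; apply: ler_sum => Y Ya; exact: FG.
Qed.

Lemma pmean_cst c n k : valid d c n -> pmean c n (fun _ _ => k) = k.
Proof.
move=> vn; rewrite /pmean !big_const_seq !count_predT !iter_addr_0 card_active//.
by rewrite -mulrnA -[k *+ _]mulr_natr natrM -expr2 mulfK// expf_neq0// gt_eqF ?nactive_gt0.
Qed.

Lemma pmeanD c n F G : pmean c n (fun X Y => F X Y + G X Y) = pmean c n F + pmean c n G.
Proof.
rewrite /pmean -mulrDl -big_split; congr (_ / _); apply: eq_bigr => X _.
by rewrite -big_split.
Qed.

Lemma pmeanZ c n k F : pmean c n (fun X Y => k * F X Y) = k * pmean c n F.
Proof.
rewrite /pmean mulrA mulr_sumr; congr (_ / _); apply: eq_bigr => X _.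
by rewrite -mulr_sumr.
Qed.

Lemma normr_pmean_le c n F k : valid d c n ->
  {in active (ran d c n) &, forall X Y, `|F X Y| <= k} -> `|pmean c n F| <= k.
Proof.
move=> vn Fk; rewrite ler_norml -{1}(pmean_cst (- k) vn) -{2}(pmean_cst k vn).
by apply/andP; split; apply: pmean_le => X Y Xa Ya; have := Fk _ _ Xa Ya;
  rewrite ler_norml => /andP[].
Qed.

(** The clique to be subdivided is itself uniform among the active ones, so it acts as the second
    member of a random pair; this closes the recursion for pair means. *)
Lemma average_pmean c n F : valid d c n ->
  average (active (ran d c n)) (fun C => \sum_(X <- active (ran d c n)) F X C) =
  nactive n * pmean c n F.
Proof.
move=> vn; rewrite /average card_active// -/(nactive n) /pmean exchange_big /=.
by field; rewrite gt_eqF// nactive_gt0.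
Qed.

Lemma average_pmeanl c n F : valid d c n ->
  average (active (ran d c n)) (fun C => \sum_(X <- active (ran d c n)) F C X) =
  nactive n * pmean c n F.
Proof.
move=> vn; rewrite /average card_active// -/(nactive n) /pmean.
by field; rewrite gt_eqF// nactive_gt0.
Qed.

Lemma sum_ancestor_ranS (f : {fset nat} -> R) n0 c n : (n0 <= n)%N -> valid d c n.+1 ->
  \sum_(X <- active (ran d c n.+1)) f (ancestor d n0 c n.+1 X) =
  \sum_(X <- active (ran d c n)) f (ancestor d n0 c n X) + d%:R * f (ancestor d n0 c n (c n)).
Proof.
move=> nn vn1; have [vn cn] := validS vn1; rewrite sum_active_ranS//; congr (_ + _).
  by apply: eq_big_seq => X Xa; rewrite ancestor_old// (new_notin vn).
rewrite ancestor_old ?(new_notin vn)//.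
under eq_bigr do rewrite ancestor_child//.
rewrite big_const_seq count_predT iter_addr_0 (card_active_clique vn cn).
by rewrite mulrSr addrK mulr_natl.
Qed.

(** As in a Polya urn, subdividing [C] adds [d] cliques with the ancestor of [C]: the number [S] of
    pairs with a common ancestor grows by [2 d] times the number of cliques sharing that ancestor,
    plus [d^2]. *)
Lemma average_collision n0 c n : (n0 <= n)%N -> valid d c n ->
  average (active (ran d c n)) (fun C => let c' := upd c n C in
    pmean c' n.+1 (fun X Y => (ancestor d n0 c' n.+1 X == ancestor d n0 c' n.+1 Y)%:R)) =
  (pmean c n (fun X Y => (ancestor d n0 c n X == ancestor d n0 c n Y)%:R)
     * (nactive n ^+ 2 + 2 * d%:R * nactive n) + d%:R ^+ 2) / nactive n.+1 ^+ 2.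
Proof.
move=> nn vn; pose e X Y : R := (ancestor d n0 c n X == ancestor d n0 c n Y)%:R.
pose sumC C := \sum_(X <- active (ran d c n)) e X C.
pose S := \sum_(X <- active (ran d c n)) \sum_(Y <- active (ran d c n)) e X Y.
have anc C X : ancestor d n0 (upd c n C) n X = ancestor d n0 c n X.
  by apply: ancestor_ext => k; apply: upd_lt.
transitivity (average (active (ran d c n)) (fun C =>
    (nactive n.+1 ^+ 2)^-1 * (S + d%:R ^+ 2) + (nactive n.+1 ^+ 2)^-1 * 2 * d%:R * sumC C)).
  rewrite /average; congr (_ / _); apply: eq_big_seq => C Ca /=.
  have vC := valid_upd vn Ca.
  rewrite /pmean [X in X / _ = _](_ : _ = S + 2 * d%:R * sumC C + d%:R ^+ 2); last first.
    pose a X := ancestor d n0 (upd c n C) n.+1 X.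
    under eq_bigr => X _ do
      rewrite (@sum_ancestor_ranS (fun A => (a X == A)%:R))// upd_same !ran_upd.
    rewrite big_split -mulr_sumr /=.
    rewrite (@sum_ancestor_ranS (fun B => \sum_(Y <- active (ran d c n))
      (B == ancestor d n0 (upd c n C) n Y)%:R))//.
    rewrite (@sum_ancestor_ranS (fun B => (B == ancestor d n0 (upd c n C) n C)%:R))//.
    rewrite upd_same !ran_upd eqxx mulr1.
    under eq_bigr do under eq_bigr do rewrite !anc.
    under [\sum_(Y <- _) (_ == _)%:R]eq_bigr do rewrite !anc eq_sym.
    under [X in _ + d%:R * (X + _)]eq_bigr do rewrite !anc.
    by rewrite -/S /sumC /e; ring.
  by ring.
rewrite averageD average_cst; last by rewrite card_active// addnS.
rewrite averageZ average_pmean// /pmean -/S.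
by field; rewrite !gt_eqF ?nactive_gt0.
Qed.

Lemma collision_step n0 c n : (n0 <= n)%N -> valid d c n ->
  average (active (ran d c n)) (fun C => let c' := upd c n C in
    pmean c' n.+1 (fun X Y => (ancestor d n0 c' n.+1 X == ancestor d n0 c' n.+1 Y)%:R)) <=
  pmean c n (fun X Y => (ancestor d n0 c n X == ancestor d n0 c n Y)%:R) + (n.+1%:R ^+ 2)^-1.
Proof.
move=> nn vn; rewrite average_collision//; set m := pmean _ _ _.
have m0 : 0 <= m by rewrite -(pmean_cst 0 vn); apply: pmean_le => X Y _ _; rewrite ler0n.
have A1 := nactive_gt0 n.+1; have An := nactiveS n.
have dA : d%:R * n.+1%:R <= nactive n.+1.
  by rewrite /nactive -natrM ler_nat; lia.
rewrite ler_pdivrMr ?exprn_gt0// [leRHS]mulrDl; apply: lerD.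
  rewrite ler_wpM2l// An; have := sqr_ge0 (d%:R : R); nra.
by rewrite mulrC ler_pdivlMr ?exprn_gt0 ?ltr0n// -exprMn ler_sqr ?nnegrE// (ltW A1).
Qed.

Lemma collision_le n0 n : (0 < d)%N -> (0 < n0 <= n)%N -> expect d n (fun c =>
  pmean c n (fun X Y => (ancestor d n0 c n X == ancestor d n0 c n Y)%:R)) <= 2 / n0%:R.
Proof.
move=> d_gt0 /andP[n0_gt0 /subnKC <-].
(* The subtracted term closes the induction, since [1 / m - 1 / (m + 1)] exceeds the increment
   [1 / (m + 1)^2]. At [k = 0] the mean is [1 / nactive n0], the probability of drawing the same
   clique twice. *)
suff h k : expect d (n0 + k) (fun c => pmean c (n0 + k) (fun X Y =>
    (ancestor d n0 c (n0 + k) X == ancestor d n0 c (n0 + k) Y)%:R)) <=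
    2 / n0%:R - (n0 + k)%:R^-1.
  by apply: (le_trans (h _)); rewrite gerBl invr_ge0.
have n0R : 0 < n0%:R :> R by rewrite ltr0n.
elim: k => [|k IHk].
  rewrite addn0 -[leRHS](expect_cst d n0); apply: expect_le => c vn.
  rewrite /pmean.
  under eq_big_seq => X Xa.
    under eq_bigr do rewrite !ancestor_start.
    rewrite (bigD1_seq X) ?fset_uniq//= eqxx big1 ?addr0; last first.
      by move=> Y; rewrite eq_sym => /negbTE ->.
    over.
  rewrite big_const_seq count_predT iter_addr_0 card_active// -/(nactive n0).
  rewrite [X in X <= _](_ : _ = (nactive n0)^-1); last first.
    by field; rewrite gt_eqF ?nactive_gt0.
  rewrite [leRHS](_ : _ = n0%:R^-1); last by field; rewrite gt_eqF.
  by rewrite lef_pV2 ?posrE ?nactive_gt0// ler_nat; nia.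
rewrite addnS /=.
apply: le_trans (_ : _ <= 2 / n0%:R - (n0 + k)%:R^-1 + ((n0 + k).+1%:R ^+ 2)^-1) _.
  apply: le_trans (lerD IHk (lexx _)); rewrite -[X in _ + X](expect_cst d (n0 + k)) -expectD.
  by apply: expect_le => c vn; apply: collision_step; rewrite ?leq_addr.
rewrite -[_.+1%:R]natr1; set m : R := (n0 + k)%:R.
have m_gt0 : 0 < m by rewrite ltr0n addn_gt0 n0_gt0.
rewrite -addrA lerD2l -subr_ge0.
rewrite (_ : _ - _ = (m * (m + 1) ^+ 2)^-1); last first.
  by field; rewrite -natrD -/m !gt_eqF// addr_gt0.
by rewrite invr_ge0 mulr_ge0 ?exprn_ge0 ?addr_ge0 ?ltW.
Qed.

(* A uniformly chosen child of an active clique of total [t] has total [t + 1]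
   with probability [prob_up t], and [t] otherwise; [gen] is the generator of
   this chain. *)
Definition prob_up (t : nat) : R := (d.+1 - t %% d.+1)%:R / d.+1%:R.

Definition gen (g : nat -> R) (t : nat) : R := prob_up t * (g t.+1 - g t).

Lemma prob_up_gt0 t : 0 < prob_up t.
Proof. by rewrite divr_gt0// ltr0n subn_gt0 ltn_pmod. Qed.

Lemma prob_up_le1 t : prob_up t <= 1.
Proof. by rewrite ler_pdivrMr// mul1r ler_nat leq_subr. Qed.

Lemma branchE (g : nat -> R) t : branch d g t = d%:R * g t + d.+1%:R * gen g t.
Proof.
rewrite /branch /gen /prob_up mulrA mulrCA divff ?pnatr_eq0// mulr1.
have tl : (t %% d.+1 <= d.+1)%N by rewrite ltnW// ltn_pmod.
rewrite -[g t *+ _]mulr_natl -[g t.+1 *+ _]mulr_natl natrB// -[d.+1%:R]natr1; ring.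
Qed.

Lemma normr_branch_le (g : nat -> R) t k :
  (forall t, `|g t| <= k) -> `|branch d g t| <= d.+2%:R * k.
Proof.
move=> gk; rewrite /branch; apply: le_trans (ler_normB _ _) _.
rewrite -natr1 mulrDl mul1r lerD//; apply: le_trans (ler_normD _ _) _.
have tl : (t %% d.+1 <= d.+1)%N by rewrite ltnW// ltn_pmod.
rewrite !normrMn mulr_natl -[in leRHS](subnK tl) mulrnDr.
by rewrite lerD// lerMn2r gk orbT.
Qed.

Definition tmean c n (f : nat -> nat -> R) : R :=
  pmean c n (fun X Y => f (total d c n X) (total d c n Y)).

(** Bounds the numerator over [nactive (n + 1)^2] in [tmean_step]: [d^2] times a mean bounded by 1,
    [d (d + 1)] times two generator means bounded by 2 each, and the doubly branched term, at most
    [(d + 2)^2]. *)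
Definition stepK : R := d%:R ^+ 2 + 4 * d%:R * d.+1%:R + d.+2%:R ^+ 2.

(** Subdividing [C] changes the double sum in each argument separately, which after averaging over
    [C] gives the generators, and in both at once, which gives [e C]. The last premise says that
    [f0] is one backward Kolmogorov step of [f], up to [delta]. *)
Lemma tmean_step c n (f f0 : nat -> nat -> R) delta : (0 < d)%N -> valid d c n ->
  (forall s t, `|f s t| <= 1) ->
  (forall s t, `|f s t - f0 s t + d.+1%:R / nactive n.+1 *
     (gen (f^~ t) s + gen (f s) t)| <= delta) ->
  `|average (active (ran d c n)) (fun C => tmean (upd c n C) n.+1 f) - tmean c n f0|
  <= delta + stepK / n.+1%:R ^+ 2.
Proof.
move=> d_gt0 vn f1 fd; pose act := active (ran d c n); pose A := nactive n.
pose A' := nactive n.+1.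
pose t X := total d c n X; pose g s s' := gen (f^~ s') s + gen (f s) s'.
pose e C := branch d (fun s => branch d (f s) (t C)) (t C).
have gen_le h s : (forall s, `|h s| <= 1) -> `|gen h s| <= 2.
  move=> h1; rewrite /gen normrM ger0_norm ?(ltW (prob_up_gt0 _))//.
  apply: (@le_trans _ _ (1 * (1 + 1))); last by rewrite mul1r.
  apply: ler_pM => //; first exact: ltW (prob_up_gt0 _).
  - exact: prob_up_le1.
  - by apply: le_trans (ler_normB _ _) _; rewrite lerD.
have branch_sum F s : branch d (fun s => \sum_(Y <- act) F s Y) s =
    \sum_(Y <- act) branch d (fun s => F s Y) s :> R.
  by rewrite /branch -!sumrMnl -big_split -sumrB.
have branchD F G s : branch d (fun s => F s + G s) s = branch d F s + branch d G s :> R.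
  by rewrite /branch !mulrnDl; ring.
have -> : average act (fun C => tmean (upd c n C) n.+1 f) =
    average act (fun C => (A' ^+ 2)^-1 * (A ^+ 2 * tmean c n f) +
      ((A' ^+ 2)^-1 * (\sum_(X <- act) branch d (f (t X)) (t C)) +
       ((A' ^+ 2)^-1 * (\sum_(Y <- act) branch d (f^~ (t Y)) (t C)) +
        (A' ^+ 2)^-1 * e C))).
  rewrite /average; congr (_ / _); apply: eq_big_seq => C Ca.
  have vC := valid_upd vn Ca.
  have tC X : total d (upd c n C) n X = t X by apply: total_ext => k; apply: upd_lt.
  rewrite -!mulrDr /tmean /pmean mulrC; congr (_ * _).
  under eq_bigr => X _ do rewrite sum_total_ranS// upd_same ran_upd tC.
  rewrite (@sum_total_ranS d R _ _ (fun s => \sum_(Y <- active (ran d c n))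
    f s (total d (upd c n C) n Y) + branch d (f s) (t C)))//.
  rewrite upd_same ran_upd tC branchD big_split /= branch_sum -/act.
  rewrite mulrC divfK ?expf_neq0 ?gt_eqF ?nactive_gt0// -!addrA.
  congr (_ + (_ + (_ + _))); last first.
  - by apply: eq_bigr => Y _; rewrite tC.
  - by apply: eq_bigr => Y _; rewrite tC.
  by apply: eq_bigr => X _; apply: eq_bigr => Y _; rewrite !tC.
rewrite !averageD average_cst; last by rewrite card_active// addnS.
rewrite !averageZ (@average_pmean c n (fun X C => branch d (f (t X)) (t C)))//.
rewrite (@average_pmeanl c n (fun C Y => branch d (f^~ (t Y)) (t C)))//.
have -> : pmean c n (fun X C => branch d (f (t X)) (t C)) =
    d%:R * tmean c n f + d.+1%:R * tmean c n (fun s s' => gen (f s) s').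
  by rewrite /tmean -!pmeanZ -pmeanD; congr (_ / _); apply: eq_bigr => X _;
    apply: eq_bigr => Y _; exact: branchE.
have -> : pmean c n (fun C Y => branch d (f^~ (t Y)) (t C)) =
    d%:R * tmean c n f + d.+1%:R * tmean c n (fun s s' => gen (f^~ s') s).
  by rewrite /tmean -!pmeanZ -pmeanD; congr (_ / _); apply: eq_bigr => X _;
    apply: eq_bigr => Y _; exact: branchE.
set m := tmean c n f; set m0 := tmean c n f0; set ae := average _ _.
set m1 := tmean c n (fun s s' => gen (f s) s').
set m2 := tmean c n (fun s s' => gen (f^~ s') s).
have hm : `|m| <= 1 by apply: normr_pmean_le.
have hm1 : `|m1| <= 2 by apply: normr_pmean_le => // X Y _ _; apply: gen_le.
have hm2 : `|m2| <= 2 by apply: normr_pmean_le => // X Y _ _; apply: gen_le.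
have hae : `|ae| <= d.+2%:R ^+ 2.
  have he C : `|e C| <= d.+2%:R ^+ 2.
    rewrite expr2; apply: normr_branch_le => s; rewrite -[leRHS]mulr1.
    exact: normr_branch_le.
  have card0 : (0 < #|` act|)%N by rewrite card_active// addnS.
  rewrite ler_norml -{1}(average_cst (- d.+2%:R ^+ 2) card0) -{2}(average_cst (d.+2%:R ^+ 2) card0).
  by apply/andP; split; apply: average_le => C _; have := he C; rewrite ler_norml => /andP[].
have hd : `|m - m0 + d.+1%:R / A' * (m2 + m1)| <= delta.
  have -> : m - m0 + d.+1%:R / A' * (m2 + m1) = pmean c n (fun X Y =>
      f (t X) (t Y) + - 1 * f0 (t X) (t Y) + d.+1%:R / A' * g (t X) (t Y)).
    by rewrite !pmeanD !pmeanZ pmeanD mulN1r.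
  by apply: normr_pmean_le => // X Y _ _; rewrite mulN1r; apply: fd.
have A_gt0 := nactive_gt0 n; have A'_gt0 := nactive_gt0 n.+1.
have A'E := nactiveS n; rewrite -/A in A_gt0 A'E; rewrite -/A' in A'_gt0 A'E.
(* As [A = A' - d], one has [A^2 + 2 d A = A'^2 - d^2]: the mean [m] survives with weight 1 and the
   discrepancies carry [A'^-2]. *)
rewrite (_ : _ - _ = (m - m0 + d.+1%:R / A' * (m2 + m1)) +
   (ae - (d%:R ^+ 2 * m + d%:R * d.+1%:R * (m1 + m2))) / A' ^+ 2); last first.
  rewrite -/A (_ : A = A' - d%:R); last by rewrite A'E addrK.
  by field; rewrite gt_eqF.
apply: le_trans (ler_normD _ _) _; apply: lerD => //.
rewrite normrM (ger0_norm (_ : 0 <= (A' ^+ 2)^-1)); last by rewrite invr_ge0 exprn_ge0 ?ltW.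
apply: ler_pM => //; first by rewrite invr_ge0 exprn_ge0 ?ltW.
  apply: le_trans (ler_normB _ _) _; rewrite /stepK addrC; apply: lerD => //.
  apply: le_trans (ler_normD _ _) _; apply: lerD.
    by rewrite normrM ger0_norm ?exprn_ge0// ler_piMr ?exprn_ge0.
  rewrite normrM ger0_norm ?mulr_ge0// (_ : 4 * _ * _ = d%:R * d.+1%:R * 4); last by ring.
  rewrite ler_wpM2l ?mulr_ge0//; apply: le_trans (ler_normD _ _) _.
  by rewrite (le_trans (lerD hm1 hm2))//; lra.
rewrite lef_pV2 ?posrE ?exprn_gt0// ler_sqr ?nnegrE ?(ltW A'_gt0)//.
by rewrite ler_nat; nia.
Qed.

End PairMeans.

(** * Gaussian test functions *)

Section Gauss.
Variable R : realType.
Implicit Types x y z h V a b c e M : R.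

Local Lemma derM (f g : R -> R) x df dg :
  is_derive x 1 f df -> is_derive x 1 g dg ->
  is_derive x 1 (fun t => f t * g t) (df * g x + f x * dg).
Proof.
by move=> hf hg; apply: (is_derive_eq (is_deriveM hf hg)); rewrite addrC mulrC.
Qed.

Local Lemma derD (f g : R -> R) x df dg :
  is_derive x 1 f df -> is_derive x 1 g dg ->
  is_derive x 1 (fun t => f t + g t) (df + dg).
Proof. by move=> hf hg; apply: is_deriveD. Qed.

Definition between (a b c : R) : Prop := a <= c <= b \/ b <= c <= a.

Lemma between_dist a b c : between a b c -> `|c - a| <= `|b - a|.
Proof.
case=> /andP[h1 h2]; first by rewrite !ger0_norm; lra.
by rewrite !ler0_norm; lra.
Qed.

Lemma mvt_between (f f1 : R -> R) a b :
  (forall c, between a b c -> is_derive c 1 f (f1 c)) ->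
  exists2 c, between a b c & f b - f a = f1 c * (b - a).
Proof.
move=> h; have [ab|/ltW ba] := leP a b.
  have [||c + ->] := @MVT_segment R f f1 a b ab.
  - by move=> x; rewrite in_itv /= => /andP[/ltW ? /ltW ?]; apply: h; left; apply/andP.
  - apply: derivable_within_continuous => x; rewrite in_itv /= => xab.
    by have [] := h x (or_introl xab).
  by rewrite in_itv => cab; exists c => //; left.
have [||c + e] := @MVT_segment R f f1 b a ba.
- by move=> x; rewrite in_itv /= => /andP[/ltW ? /ltW ?]; apply: h; right; apply/andP.
- apply: derivable_within_continuous => x; rewrite in_itv /= => xab.
  by have [] := h x (or_intror xab).
rewrite in_itv => cab; exists c; first by right.
by rewrite -opprB e -mulrN opprB.
Qed.

Lemma taylor1 (f f1 : R -> R) M a b :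
  (forall c, between a b c -> is_derive c 1 f (f1 c)) ->
  (forall c, between a b c -> `|f1 c| <= M) ->
  `|f b - f a| <= M * `|b - a|.
Proof.
move=> /mvt_between[c cab ->] /(_ c cab) h.
by rewrite normrM ler_wpM2r.
Qed.

Lemma between_trans a b c e : between a b c -> between a c e -> between a b e.
Proof. by case=> /andP[? ?] [] /andP[? ?]; [left|left|right|right]; apply/andP; split; lra. Qed.

Lemma taylor2 (f f1 f2 : R -> R) M a b :
  (forall c, between a b c -> is_derive c 1 f (f1 c)) ->
  (forall c, between a b c -> is_derive c 1 f1 (f2 c)) ->
  (forall c, between a b c -> `|f2 c| <= M) ->
  `|f b - f a - f1 a * (b - a)| <= M * `|b - a| ^+ 2.
Proof.
move=> hf hf1 hM; have [c cab ->] := mvt_between hf.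
rewrite -mulrBl normrM expr2 mulrA ler_wpM2r//.
apply: le_trans (taylor1 (f1 := f2) (M := M) _ _) _ => [e ace|e ace|].
- exact/hf1/(between_trans cab).
- exact/hM/(between_trans cab).
rewrite ler_wpM2l ?between_dist//; apply: le_trans (hM c cab) => //.
Qed.

Lemma taylor3 (f f1 f2 f3 : R -> R) M a b :
  (forall c, is_derive c 1 f (f1 c)) ->
  (forall c, is_derive c 1 f1 (f2 c)) ->
  (forall c, is_derive c 1 f2 (f3 c)) ->
  (forall c, `|f3 c| <= M) ->
  `|f b - f a - f1 a * (b - a) - f2 a * (b - a) ^+ 2 / 2| <= M * `|b - a| ^+ 3.
Proof.
move=> hf hf1 hf2 hM.
pose G x := f x - f1 a * (x - a) - f2 a * (x - a) ^+ 2 / 2.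
pose G1 x := f1 x - f1 a - f2 a * (x - a).
have GE c : is_derive c 1 G (G1 c).
  have h1 : is_derive c 1 (fun x => x - a) 1.
    by apply: (is_derive_eq (derD (is_derive_id _ _) (is_derive_cst (- a) _ _))); rewrite addr0.
  have h2 := derM (is_derive_cst (- f1 a) c 1) h1.
  have h3 := derM (is_derive_cst (- f2 a / 2) c 1) (derM h1 h1).
  have := derD (derD (hf c) h2) h3.
  rewrite [fun t => _](_ : _ = G); last by apply/funext => x; rewrite /G /cst; ring.
  by move=> h; apply: (is_derive_eq h); rewrite /G1 /cst; field.
have [c cab e] := @mvt_between G G1 a b (fun c _ => GE c).
rewrite (_ : _ - _ = G b - G a); last by rewrite /G; ring.
rewrite e normrM exprS mulrCA mulrC ler_wpM2l//.
apply: le_trans (@taylor2 f1 f2 f3 M a c (fun x _ => hf1 x) (fun x _ => hf2 x) (fun x _ => hM x)) _.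
rewrite ler_wpM2l//; first exact: le_trans (hM a).
by rewrite ler_sqr ?nnegrE// between_dist.
Qed.

Definition gauss x : R := normal_pdf 0 1 x.

Definition Phi x : R := fine (normal_prob 0 1 `]-oo, x]).

Lemma gaussE x : gauss x = normal_peak 1 * expR (- (x * x) / 2).
Proof.
rewrite /gauss normal_pdfE ?oner_neq0// /normal_fun subr0; congr (_ * expR _).
by rewrite expr2 expr1n.
Qed.

Lemma is_derive_gauss x : is_derive x 1 gauss (- x * gauss x).
Proof.
have h1 := derM (is_derive_cst (- (1/2) : R) x 1) (derM (is_derive_id x 1) (is_derive_id x 1)).
have h2 := is_derive1_comp (is_derive_expR _) h1.
have := derM (is_derive_cst (normal_peak 1 : R) x 1) h2.
rewrite [fun t => _](_ : _ = gauss); last first.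
  by apply/funext => t; rewrite gaussE /cst /=; congr (_ * expR _); field.
move=> h; apply: (is_derive_eq h); rewrite gaussE /cst /= mul0r add0r.
rewrite (_ : - (1 / 2) * (x * x) = - (x * x) / 2); last by field.
by set e := expR _; field.
Qed.

Lemma is_derive_Phi x : is_derive x 1 Phi (gauss x).
Proof.
have xu : x < x + 1 by rewrite ltrDl.
have intf : lebesgue_measure.-integrable [set` `]-oo, x + 1]] (EFin \o gauss).
  by apply: (integrableS _ _ _ (integrable_normal_pdf 0 1)).
have xb : ((-oo)%O < BRight x :> \bar R)%E by exact: ltNyr.
have cx : {for x, continuous gauss} by apply: continuous_normal_pdf; exact: oner_neq0.
have [d1 d2] := continuous_FTC1 xu intf xb cx.
by apply: DeriveDef; rewrite -?derive1E.
Qed.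

Lemma Phi_ge0 x : 0 <= Phi x.
Proof. by rewrite fine_ge0// probability_ge0. Qed.

Lemma Phi_le1 x : Phi x <= 1.
Proof. by rewrite -lee_fin fineK ?fin_num_measure// probability_le1. Qed.

Lemma Phi_mono x y : x <= y -> Phi x <= Phi y.
Proof.
move=> xy; rewrite fine_le ?fin_num_measure//.
by rewrite le_measure ?inE//; apply: subitvPr.
Qed.

Definition gaussB : R := 4 * normal_peak 1.

Lemma gauss_ge0 x : 0 <= gauss x.
Proof. exact: normal_pdf_ge0. Qed.

Lemma gaussB_gt0 : 0 < gaussB.
Proof. by rewrite mulr_gt0// normal_peak_gt0// oner_neq0. Qed.

(** From [1 + y <= expR y] at [y = x^2 / 4]. As [|x|] and [x^2 / 4] are at most [1 + x^2 / 4],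
    powers of [|x|] up to the third times the density are at most 4 times the peak, which is
    [gaussB]. *)
Lemma gauss_le x : gauss x * (1 + x ^+ 2 / 4) ^+ 2 <= normal_peak 1.
Proof.
rewrite gaussE -mulrA ler_piMr ?normal_peak_ge0//.
have h : 1 + x ^+ 2 / 4 <= expR (x ^+ 2 / 4) by rewrite expR_ge1Dx.
have h0 : 0 <= 1 + x ^+ 2 / 4 by rewrite addr_ge0// mulr_ge0// sqr_ge0.
have -> : expR (- (x * x) / 2) = (expR (x ^+ 2 / 4) ^+ 2)^-1.
  by rewrite -expRM_natl -expRN; congr expR; field.
rewrite mulrC ler_pdivrMr ?mul1r ?exprn_gt0 ?expR_gt0//.
by rewrite ler_sqr ?nnegrE ?expR_ge0.
Qed.

Lemma gauss_pow_le x k : (k <= 3)%N -> `|x| ^+ k * gauss x <= gaussB.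
Proof.
move=> k3; apply: le_trans (_ : _ <= 4 * (gauss x * (1 + x ^+ 2 / 4) ^+ 2)) _; last first.
  by rewrite ler_wpM2l// gauss_le.
rewrite mulrC mulrCA ler_wpM2l ?gauss_ge0//.
rewrite -[x ^+ 2]real_normK ?num_real//; have := normr_ge0 x; set u := `|x| => u0.
have h1 : u <= 1 + u ^+ 2 / 4 by have := sqr_ge0 (u / 2 - 1); nra.
have h2 : u ^+ 2 / 4 <= 1 + u ^+ 2 / 4 by lra.
have h3 : 1 <= 1 + u ^+ 2 / 4 by have := sqr_ge0 u; lra.
case: k k3 => [|[|[|[|//]]]] _; rewrite ?expr0 ?expr1; nra.
Qed.

Lemma gauss_bounds x : [/\ `|gauss x| <= gaussB, `|x * gauss x| <= gaussB,
  `|x ^+ 2 * gauss x| <= gaussB & `|x ^+ 3 * gauss x| <= gaussB].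
Proof.
rewrite (normrM x) (normrM (x ^+ 2)) (normrM (x ^+ 3)) !normrX !(ger0_norm (gauss_ge0 x)).
have h0 := @gauss_pow_le x 0 isT; have h1 := @gauss_pow_le x 1 isT.
rewrite expr0 mul1r in h0; rewrite expr1 in h1.
by split => //; apply: gauss_pow_le.
Qed.

(* [heat V y] is the probability that a centered normal variable of variance
   [V] is at most [y]. *)
Definition heat V y : R := Phi (y / Num.sqrt V).

(** Minus the second derivative of [Phi]. The derivative of [heat] in [V] and half its second
    derivative in [y] both equal [- slope (y / sqrt V) / (2 V)]: the heat equation. *)
Definition slope x : R := x * gauss x.

Lemma is_derive_slope x : is_derive x 1 slope ((1 - x ^+ 2) * gauss x).
Proof.
apply: (is_derive_eq (derM (is_derive_id x 1) (is_derive_gauss x))).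
by rewrite /=; ring.
Qed.

Lemma slope_lipschitz x y : `|slope y - slope x| <= 2 * gaussB * `|y - x|.
Proof.
apply: (taylor1 (fun c _ => is_derive_slope c)) => c _.
have [h0 _ h2 _] := gauss_bounds c.
by rewrite mulrBl mul1r; apply: le_trans (ler_normB _ _) _; lra.
Qed.

Lemma Phi_taylor x y : `|Phi y - Phi x - gauss x * (y - x) + slope x * (y - x) ^+ 2 / 2|
  <= 2 * gaussB * `|y - x| ^+ 3.
Proof.
have hN c : is_derive c 1 (fun t => - slope t) (- ((1 - c ^+ 2) * gauss c)).
  by apply: is_deriveN; exact: is_derive_slope.
have h c : is_derive c 1 gauss (- slope c).
  by apply: (is_derive_eq (is_derive_gauss c)); rewrite /slope mulNr.
have := @taylor3 Phi gauss _ _ (2 * gaussB) x y is_derive_Phi h hN.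
rewrite !mulNr opprK; apply => c; rewrite normrN mulrBl mul1r.
have [h0 _ h2 _] := gauss_bounds c.
by apply: le_trans (ler_normB _ _) _; lra.
Qed.

Lemma is_derive_scaled y V : 0 < V ->
  is_derive V 1 (fun v => y / Num.sqrt v) (- (y / Num.sqrt V) / (2 * V)).
Proof.
move=> V0; have s0 : Num.sqrt V != 0 by rewrite gt_eqF ?sqrtr_gt0.
have h := is_deriveV s0 (is_derive1_sqrt V0).
apply: (is_derive_eq (derM (is_derive_cst y V 1) h)).
have -> : 2 * V = 2 * Num.sqrt V ^+ 2 by rewrite sqr_sqrtr// ltW.
by rewrite /cst mul0r add0r /GRing.scale /=; field.
Qed.

Lemma heat_derive y V : 0 < V ->
  is_derive V 1 (heat^~ y) (- slope (y / Num.sqrt V) / (2 * V)).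
Proof.
move=> V0; have := is_derive1_comp (is_derive_Phi _) (is_derive_scaled y V0).
move=> h; apply: (is_derive_eq h); rewrite /slope; set z := y / _.
by field; rewrite gt_eqF.
Qed.

Lemma heat_derive2 y V : 0 < V ->
  is_derive V 1 (fun v => - slope (y / Num.sqrt v) / (2 * v))
   (let z := y / Num.sqrt V in (z * (1 - z ^+ 2) / 4 + z / 2) * gauss z / V ^+ 2).
Proof.
move=> V0; have V1 : V != 0 by rewrite gt_eqF.
have h1 := is_derive1_comp (is_derive_slope _) (is_derive_scaled y V0).
have h2 := is_deriveV (f := id) V1 (is_derive_id V 1).
have := derM (derM (is_derive_cst (- 1/2 : R) V 1) h1) h2.
rewrite [fun t => _](_ : _ = (fun v => - slope (y / Num.sqrt v) / (2 * v))).
  move=> h; apply: (is_derive_eq h); rewrite /cst /GRing.scale /= /slope.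
  by field; rewrite V1 gt_eqF ?sqrtr_gt0.
by apply/funext => v; rewrite /cst /= invfM; ring.
Qed.

(** Move [y] with [V] fixed, then [V] with [y'] fixed; the heat equation merges the quadratic term
    in [y] with the linear term in [V]. The mixed remainder is the cost of evaluating the slope at
    [y] and not at [y']. All intermediate variances are at least [u^2]. *)
Lemma heat_taylor u V V' y y' : 0 < u -> u <= Num.sqrt V -> u <= Num.sqrt V' ->
  `|heat V' y' - heat V y - gauss (y / Num.sqrt V) / Num.sqrt V * (y' - y)
    + slope (y / Num.sqrt V) / (2 * V) * ((y' - y) ^+ 2 + (V' - V))|
  <= 2 * gaussB * (`|y' - y| ^+ 3 / u ^+ 3 + `|y' - y| * `|V' - V| / u ^+ 3
       + `|V' - V| ^+ 2 / u ^+ 4).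
Proof.
move=> u0 uV uV'; have B2 : 0 <= 2 * gaussB by rewrite mulr_ge0// ltW ?gaussB_gt0.
have s0 : 0 < Num.sqrt V by apply: lt_le_trans uV.
have s0' : 0 < Num.sqrt V' by apply: lt_le_trans uV'.
have V0 : 0 < V by rewrite -sqrtr_gt0.
have V0' : 0 < V' by rewrite -sqrtr_gt0.
have uVV : u ^+ 2 <= V by rewrite -(sqr_sqrtr (ltW V0)) ler_sqr ?nnegrE ?(ltW u0) ?sqrtr_ge0.
have uVV' : u ^+ 2 <= V' by rewrite -(sqr_sqrtr (ltW V0')) ler_sqr ?nnegrE ?(ltW u0) ?sqrtr_ge0.
pose z := y / Num.sqrt V; pose z' := y' / Num.sqrt V.
have zz' : z' - z = (y' - y) / Num.sqrt V by rewrite /z /z' mulrBl.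
have btwu c : between V V' c -> u ^+ 2 <= c by case=> /andP[]; lra.
have btw0 c : between V V' c -> 0 < c.
  by move=> /btwu; apply: lt_le_trans; rewrite exprn_gt0.
have stepy : `|heat V y' - heat V y - gauss z * (z' - z) + slope z * (z' - z) ^+ 2 / 2|
    <= 2 * gaussB * (`|y' - y| ^+ 3 / u ^+ 3).
  apply: le_trans (Phi_taylor z z') _; rewrite ler_wpM2l//.
  rewrite zz' normrM exprMn ler_wpM2l ?exprn_ge0// normfV exprVn gtr0_norm//.
  by rewrite lef_pV2 ?posrE ?exprn_gt0// lerXn2r ?nnegrE ?(ltW u0) ?sqrtr_ge0.
have stepV : `|heat V' y' - heat V y' - (- slope z' / (2 * V)) * (V' - V)|
    <= gaussB / u ^+ 4 * `|V' - V| ^+ 2.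
  apply: (@taylor2 (heat^~ y') (fun v => - slope (y' / Num.sqrt v) / (2 * v))
    (fun v => let z := y' / Num.sqrt v in
      (z * (1 - z ^+ 2) / 4 + z / 2) * gauss z / v ^+ 2)).
  - by move=> c /btw0 c0; apply: heat_derive.
  - by move=> c /btw0 c0; apply: heat_derive2.
  move=> c h; set w := y' / _ => /=.
  have [_ h1 _ h3] := gauss_bounds w.
  rewrite normrM ler_pM//.
    have B0 := gaussB_gt0; move: h1 h3; rewrite !ler_norml => /andP[? ?] /andP[? ?].
    by apply/andP; split; lra.
  have c0 := btw0 c h; rewrite normfV normrX gtr0_norm// -[4%N]/(2 * 2)%N exprM.
  rewrite lef_pV2 ?posrE ?exprn_gt0 ?exprn_gt0// ler_sqr ?nnegrE ?exprn_ge0 ?(ltW u0) ?(ltW c0)//.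
  exact: btwu.
have cross : `|(slope z' - slope z) / (2 * V) * (V' - V)| <=
    2 * gaussB * (`|y' - y| * `|V' - V| / u ^+ 3).
  rewrite [leRHS](_ : _ = 2 * gaussB * (`|y' - y| / u) * (u ^+ 2)^-1 * `|V' - V|); last first.
    by field; rewrite gt_eqF.
  rewrite normrM ler_wpM2r// normrM ler_pM//.
    apply: le_trans (slope_lipschitz z z') _; rewrite ler_wpM2l// zz' normrM ler_wpM2l//.
    by rewrite normfV gtr0_norm// lef_pV2 ?posrE.
  rewrite normfV gtr0_norm ?mulr_gt0// lef_pV2 ?posrE ?mulr_gt0 ?exprn_gt0//.
  by lra.
have -> : heat V' y' - heat V y - gauss z / Num.sqrt V * (y' - y)
    + slope z / (2 * V) * ((y' - y) ^+ 2 + (V' - V)) =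
  (heat V y' - heat V y - gauss z * (z' - z) + slope z * (z' - z) ^+ 2 / 2)
  + (heat V' y' - heat V y' - (- slope z' / (2 * V)) * (V' - V))
  - (slope z' - slope z) / (2 * V) * (V' - V).
  rewrite zz' exprMn exprVn sqr_sqrtr ?(ltW V0)//.
  by field; rewrite !gt_eqF.
apply: le_trans (ler_normB _ _) _; rewrite [leRHS]mulrDr [X in _ <= X + _]mulrDr.
apply: le_trans (lerD (ler_normD _ _) (lexx _)) _.
apply: le_trans (lerD (lerD stepy stepV) cross) _.
rewrite -[leRHS]addrA [X in _ <= _ + X]addrC addrA lerD2r lerD2l.
rewrite mulrAC -mulrA ler_wpM2r ?mulr_ge0 ?invr_ge0 ?exprn_ge0 ?(ltW u0)//.
by have := gaussB_gt0; lra.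
Qed.

End Gauss.

(** * Correctors and the near invariance of the test functions *)

Section Correctors.
Variables (R : realType) (d : nat).
Implicit Types (n t : nat).

Local Notation p := (prob_up R d).

(** A period of [d + 1] totals is one level, so [mean_period] is [mu_d]. As a geometric variable has
    variance [1 / p^2 - 1 / p], [square_period] is [sigma_d^2 + mu_d], and [theta] is the
    coefficient in the scaling. *)
Definition mean_period : R := \sum_(i < d.+1) (p i)^-1.
Definition square_period : R := \sum_(i < d.+1) (p i)^-1 ^+ 2.
Definition theta : R := square_period / mean_period ^+ 3.

Local Notation mu := mean_period.

Definition dphi t : R := (mu * p t)^-1.
(** The solution of [p (dphi^2 + dchi) = theta]. The value of [theta] is forced: it is the one for
    which [dchi] sums to 0 over a period, so that [chi] stays bounded. *)
Definition dchi t : R := (theta - (mu ^+ 2 * p t)^-1) / p t.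

(* [phi] linearizes the level: [gen phi] is the constant [1 / mu]; [chi] turns
   the conditional variance of the increments of [phi] into the constant [theta]. *)
Definition phi t : R := \sum_(i < t) dphi i.
Definition chi t : R := \sum_(i < t) dchi i.

Lemma phiS t : phi t.+1 = phi t + dphi t.
Proof. by rewrite /phi big_ord_recr. Qed.

Lemma chiS t : chi t.+1 = chi t + dchi t.
Proof. by rewrite /chi big_ord_recr. Qed.

Lemma prob_up_mod t : p (t %% d.+1) = p t.
Proof. by rewrite /prob_up modn_mod. Qed.

Lemma sum_periodic (a : nat -> R) t : (forall i, a (i %% d.+1)%N = a i) ->
  \sum_(i < t) a i =
  (t %/ d.+1)%:R * \sum_(i < d.+1) a i + \sum_(i < t %% d.+1) a i.
Proof.
move=> aE; rewrite -[LHS](big_mkord xpredT a) {1}(divn_eq t d.+1).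
rewrite (@big_cat_nat _ _ _ (t %/ d.+1 * d.+1)) ?leq_addr//=; congr (_ + _).
  elim: (t %/ d.+1)%N => [|q IHq]; first by rewrite mul0n big_geq// mul0r.
  rewrite mulSn addnC (@big_cat_nat _ _ _ (q * d.+1)) ?leq_addr//= IHq.
  rewrite -natr1 mulrDl mul1r; congr (_ + _).
  rewrite -{1}(add0n (q * d.+1)%N) big_addn addKn big_mkord; apply: eq_bigr => i _.
  by rewrite -aE addnC modnMDl aE.
rewrite -{1}(add0n (t %/ d.+1 * d.+1)%N) big_addn addKn big_mkord; apply: eq_bigr => i _.
by rewrite -aE addnC modnMDl aE.
Qed.

Lemma ler_sum_ord (a : nat -> R) m n : (forall i, 0 <= a i) -> (m <= n)%N ->
  \sum_(i < m) a i <= \sum_(i < n) a i.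
Proof.
move=> a0 /subnK <-; elim: (n - m)%N => // k IHk.
by rewrite addSn big_ord_recr (le_trans IHk)//= lerDl.
Qed.

Lemma mu_gt0 : 0 < mu.
Proof.
rewrite /mean_period big_ord_recl ltr_pwDl ?invr_gt0 ?prob_up_gt0//.
by rewrite sumr_ge0// => i _; rewrite invr_ge0 ltW ?prob_up_gt0.
Qed.

Lemma square_period_gt0 : 0 < square_period.
Proof.
rewrite /square_period big_ord_recl ltr_pwDl ?exprn_gt0 ?invr_gt0 ?prob_up_gt0//.
by rewrite sumr_ge0// => i _; rewrite exprn_ge0 ?invr_ge0 ?ltW ?prob_up_gt0.
Qed.

Lemma theta_gt0 : 0 < theta.
Proof. by rewrite divr_gt0 ?square_period_gt0 ?exprn_gt0 ?mu_gt0. Qed.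

Lemma dphi_gt0 t : 0 < dphi t.
Proof. by rewrite invr_gt0 mulr_gt0 ?mu_gt0 ?prob_up_gt0. Qed.

Lemma phi_period : \sum_(i < d.+1) dphi i = 1.
Proof.
under eq_bigr do rewrite /dphi invfM.
by rewrite -mulr_sumr mulVf// gt_eqF// mu_gt0.
Qed.

Lemma chi_period : \sum_(i < d.+1) dchi i = 0.
Proof.
have mu0 := mu_gt0.
have E i : dchi i = theta * (p i)^-1 - (mu ^+ 2)^-1 * (p i)^-1 ^+ 2.
  by have p0 := prob_up_gt0 R d i; rewrite /dchi; field; rewrite !gt_eqF.
under eq_bigr do rewrite E.
rewrite sumrB -!mulr_sumr -/mean_period -/square_period /theta.
by field; rewrite gt_eqF.
Qed.

(** [phi] gains exactly 1 per period, as the level does, so the two stay within 1 of each other and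
    share their limit law. *)
Lemma phi_bounds t : (t %/ d.+1)%:R <= phi t <= (t %/ d.+1)%:R + 1.
Proof.
rewrite /phi (@sum_periodic dphi) => [|i]; last by rewrite /dphi prob_up_mod.
rewrite phi_period mulr1 lerDl lerD2l sumr_ge0 => [/=|i _]; last exact/ltW/dphi_gt0.
rewrite -phi_period; apply: ler_sum_ord => [i|]; first exact/ltW/dphi_gt0.
by rewrite ltnW// ltn_pmod.
Qed.

Definition chiK : R := \sum_(i < d.+1) `|dchi i|.

Lemma chi_bound t : `|chi t| <= chiK.
Proof.
rewrite /chi (@sum_periodic dchi) => [|i]; last by rewrite /dchi prob_up_mod.
rewrite chi_period mulr0 add0r; apply: le_trans (ler_norm_sum _ _ _) _.
by apply: (ler_sum_ord (a := fun i => `|dchi i|)) => //; rewrite ltnW// ltn_pmod.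
Qed.

Lemma dchi_bound t : `|dchi t| <= 2 * chiK.
Proof.
have -> : dchi t = chi t.+1 - chi t by rewrite chiS addrC addKr.
by apply: le_trans (ler_normB _ _) _; have := chi_bound t; have := chi_bound t.+1; lra.
Qed.

Lemma dphi_bound t : dphi t <= 1.
Proof.
rewrite /dphi -prob_up_mod -/(dphi _) -phi_period.
have tl : (t %% d.+1 < d.+1)%N by rewrite ltn_pmod.
rewrite (bigD1 (Ordinal tl))//= lerDl sumr_ge0// => i _; exact/ltW/dphi_gt0.
Qed.

(** The fraction of active cliques at time [n + 1] that were born at that step; [clock n] is then
    the mean number of births on the line of descent of a uniform active clique. *)
Definition rate n : R := d.+1%:R / nactive R d n.+1.
Definition clock n : R := \sum_(k < n) rate k.

Lemma clockS n : clock n.+1 = clock n + rate n.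
Proof. by rewrite /clock big_ord_recr. Qed.

Lemma rate_gt0 n : 0 < rate n.
Proof. by rewrite divr_gt0// nactive_gt0. Qed.

Lemma rate_le1 n : rate n <= 1.
Proof. by rewrite ler_pdivrMr ?nactive_gt0// mul1r ler_nat leq_addl. Qed.

Lemma rate_le n : (0 < d)%N -> rate n <= 2 / n.+1%:R.
Proof.
move=> d0; rewrite ler_pdivrMr ?nactive_gt0// mulrAC ler_pdivlMr// -!natrM ler_nat; nia.
Qed.

Lemma clock_mono n m : (n <= m)%N -> clock n <= clock m.
Proof.
by apply: ler_sum_ord => k; rewrite ltW// rate_gt0.
Qed.

(* The mean of [test n] over pairs of active cliques is nearly constant in [n]:
   the speeds of the variance and of the center, relative to [clock], cancel the
   first order terms of the generators. *)
Definition test (V0 y0 : R) n (s t : nat) : R :=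
  heat (V0 - 2 * theta * clock n + chi s + chi t)
       (y0 + 2 / mu * clock n - phi s - phi t).

(** Collects the terms of order [rate^2] in [test_step]: the squared displacement [2 / mu * rate] of
    the center, with the slope bounded by [gaussB], and the [heat_taylor] remainder for that
    displacement and the variance change [2 * theta * rate], at [u >= 1]. *)
Definition driftK : R := 4 * gaussB R / mu ^+ 2 +
  2 * gaussB R * ((2 / mu) ^+ 3 + (2 / mu) * (2 * theta) + (2 * theta) ^+ 2).

(** Twice, for the two members of the pair, the [heat_taylor] remainder of one jump with
    [dphi <= 1], [|dchi| <= 2 * chiK] and [u >= 1]. *)
Definition jumpK : R := 4 * gaussB R * (1 + 2 * chiK + (2 * chiK) ^+ 2).

(** Multiplying the expansion of a jump by its probability turns [dphi] into [1 / mu] and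
    [dphi^2 + dchi] into [theta], so the leading terms no longer depend on the phase of [t]. *)
Lemma jump_expansion u V y t : 1 <= u -> u <= Num.sqrt V ->
  u <= Num.sqrt (V + dchi t) ->
  `|p t * (heat (V + dchi t) (y - dphi t) - heat V y)
    + gauss (y / Num.sqrt V) / Num.sqrt V / mu
    + slope (y / Num.sqrt V) / (2 * V) * theta| <= jumpK / 2 / u ^+ 3.
Proof.
move=> u1 uV uV'; have u0 : 0 < u by lra.
have p0 := prob_up_gt0 R d t; have p1 := prob_up_le1 R d t; have m0 := mu_gt0.
have V0 : 0 < V by rewrite -sqrtr_gt0 (lt_le_trans u0).
have := @heat_taylor R u V (V + dchi t) y (y - dphi t) u0 uV uV'.
rewrite (_ : V + dchi t - V = dchi t); last by rewrite addrC addKr.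
rewrite (_ : y - dphi t - y = - dphi t); last by rewrite addrC addKr.
set a := gauss _ / _; set b := slope _ / _.
set D := heat _ _ - heat _ _ => h.
have -> : p t * D + a / mu + b * theta =
    p t * (D - a * - dphi t + b * ((- dphi t) ^+ 2 + dchi t)).
  rewrite /dphi /dchi; field; rewrite !gt_eqF//.
rewrite normrM gtr0_norm//; apply: le_trans (ler_piMl _ p1) _ => //.
apply: (le_trans h); rewrite /jumpK [leRHS](_ : _ =
  2 * gaussB R * ((1 + 2 * chiK + (2 * chiK) ^+ 2) / u ^+ 3)); last first.
  by field; rewrite gt_eqF.
apply: ler_wpM2l.
  by rewrite mulr_ge0// ltW ?gaussB_gt0.
rewrite normrN gtr0_norm ?dphi_gt0// 2!mulrDl.
have f0 := dphi_gt0 t; have f1 := dphi_bound t; have c1 := dchi_bound t.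
have u3 : 0 < u ^+ 3 by rewrite exprn_gt0.
rewrite !lerD//.
- by rewrite ler_wpM2r ?invr_ge0 ?(ltW u3)// exprn_ile1 ?(ltW f0).
- by rewrite ler_wpM2r ?invr_ge0 ?(ltW u3)//; apply: le_trans (ler_piMl _ f1) _.
apply: ler_pM; rewrite ?exprn_ge0 ?invr_ge0 ?exprn_ge0 ?(ltW u0)//.
  by rewrite ler_sqr ?nnegrE// (le_trans _ c1).
by rewrite lef_pV2 ?posrE ?exprn_gt0// ler_weXn2l.
Qed.

Lemma test_step V0 y0 u n s t : 1 <= u ->
  (forall s t, u <= Num.sqrt (V0 - 2 * theta * clock n.+1 + chi s + chi t)) ->
  `|test V0 y0 n.+1 s t - test V0 y0 n s t
    + rate n * (gen d (test V0 y0 n.+1 ^~ t) s + gen d (test V0 y0 n.+1 s) t)|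
  <= driftK * rate n ^+ 2 + jumpK * rate n / u ^+ 3.
Proof.
move=> u1 hu; have u0 : 0 < u by lra.
have r0 := rate_gt0 n; have r1 := rate_le1 n; have m0 := mu_gt0; have t0 := theta_gt0.
set V := V0 - 2 * theta * clock n.+1 + chi s + chi t.
set y := y0 + 2 / mu * clock n.+1 - phi s - phi t.
have uV : u <= Num.sqrt V by exact: hu.
have Vp : 0 < V by rewrite -sqrtr_gt0 (lt_le_trans u0).
have us : u <= Num.sqrt (V + dchi s).
  by rewrite (_ : V + dchi s = V0 - 2 * theta * clock n.+1 + chi s.+1 + chi t)// chiS /V; ring.
have ut : u <= Num.sqrt (V + dchi t).
  by rewrite (_ : V + dchi t = V0 - 2 * theta * clock n.+1 + chi s + chi t.+1)// chiS /V; ring.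
have u_prev : u <= Num.sqrt (V + 2 * theta * rate n).
  by apply: le_trans uV _; rewrite ler_wsqrtr// lerDl ltW// mulr_gt0// mulr_gt0.
have hs := @jump_expansion u V y s u1 uV us.
have ht := @jump_expansion u V y t u1 uV ut.
have := @heat_taylor R u V (V + 2 * theta * rate n) y (y - 2 / mu * rate n) u0 uV u_prev.
rewrite (_ : V + 2 * theta * rate n - V = 2 * theta * rate n); last by rewrite addrC addKr.
rewrite (_ : y - 2 / mu * rate n - y = - (2 / mu * rate n)); last by rewrite addrC addKr.
rewrite normrN (gtr0_norm (_ : 0 < 2 / mu * rate n)); last by rewrite mulr_gt0// divr_gt0.
rewrite (gtr0_norm (_ : 0 < 2 * theta * rate n)); last by rewrite mulr_gt0// mulr_gt0.
rewrite {1}/gen {1}/gen.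
have -> : test V0 y0 n s t = heat (V + 2 * theta * rate n) (y - 2 / mu * rate n).
  have eV c r h cs ct : V0 - 2 * h * c + cs + ct = V0 - 2 * h * (c + r) + cs + ct + 2 * h * r.
    by ring.
  have ey m c r ps pt : y0 + m * c - ps - pt = y0 + m * (c + r) - ps - pt - m * r by ring.
  by rewrite /test /V /y clockS -eV -ey.
have -> : test V0 y0 n.+1 s.+1 t = heat (V + dchi s) (y - dphi s).
  have eV (v cs ct x : R) : v + (cs + x) + ct = v + cs + ct + x by ring.
  have ey (v ps pt x : R) : v - (ps + x) - pt = v - ps - pt - x by ring.
  by rewrite /test chiS phiS eV ey.
have -> : test V0 y0 n.+1 s t.+1 = heat (V + dchi t) (y - dphi t).
  by rewrite /test chiS phiS addrA opprD [_ + (- _ - _)]addrA.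
have -> : test V0 y0 n.+1 s t = heat V y by [].
move: hs ht.
have hb : `|slope (y / Num.sqrt V) / (2 * V)| <= gaussB R.
  have [_ h _ _] := gauss_bounds (y / Num.sqrt V).
  have V1 : 1 <= V.
    rewrite -(sqr_sqrtr (ltW Vp)) -[leLHS](expr1n R 2) ler_sqr ?nnegrE ?sqrtr_ge0//.
    exact: le_trans uV.
  rewrite normrM -[leRHS]mulr1; apply: ler_pM => //.
  by rewrite normfV gtr0_norm ?mulr_gt0// invf_le1 ?mulr_gt0//; lra.
set a := gauss _ / _; set b := slope _ / _ in hb *.
set Hs := heat _ (y - dphi s); set Ht := heat _ (y - dphi t).
set H := heat V y; set H' := heat _ (y - _) => hs ht h0.
(* The time shift contributes [rate * (2 a / mu + 2 b theta)] and the generators its opposite; what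
   survives is the squared shift of the center and the three Taylor remainders. *)
rewrite (_ : H - H' + _ = b * (2 / mu * rate n) ^+ 2
   - (H' - H - a * - (2 / mu * rate n) + b * ((- (2 / mu * rate n)) ^+ 2 + 2 * theta * rate n))
   + rate n * ((p s * (Hs - H) + a / mu + b * theta) + (p t * (Ht - H) + a / mu + b * theta)));
  last by ring.
apply: le_trans (ler_normD _ _) _.
apply: le_trans (lerD (ler_normB _ _) (lexx _)) _.
apply: lerD; last first.
  rewrite normrM gtr0_norm// [leRHS](_ : _ =
    rate n * (jumpK / 2 / u ^+ 3 + jumpK / 2 / u ^+ 3)); last by field; rewrite gt_eqF.
  apply: ler_wpM2l; first exact: ltW.
  exact: le_trans (ler_normD _ _) (lerD hs ht).
rewrite /driftK [leRHS]mulrDl; apply: lerD.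
  rewrite normrM (ger0_norm (sqr_ge0 _)).
  rewrite (_ : 4 * _ / _ * _ = gaussB R * (2 / mu * rate n) ^+ 2); last by field; rewrite gt_eqF.
  by rewrite ler_wpM2r ?sqr_ge0.
apply: (le_trans h0); rewrite -[leRHS]mulrA; apply: ler_wpM2l.
  by rewrite mulr_ge0// ltW ?gaussB_gt0.
set A := 2 / mu; set B := 2 * theta.
have A0 : 0 < A by rewrite divr_gt0.
have B0 : 0 < B by rewrite mulr_gt0.
have Ar := mulr_gt0 A0 r0; have Br := mulr_gt0 B0 r0.
have u3 k : (u ^+ k)^-1 <= 1 by rewrite invf_le1 ?exprn_gt0// exprn_ege1.
have r2 : rate n ^+ 3 <= rate n ^+ 2 by rewrite exprS ler_piMl// exprn_ge0 ?ltW.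
rewrite 2!mulrDl; rewrite !lerD//.
- apply: (@le_trans _ _ ((A * rate n) ^+ 3)).
    by rewrite ler_piMr// exprn_ge0// ltW.
  by rewrite exprMn ler_wpM2l// exprn_ge0 ?ltW.
- apply: (@le_trans _ _ (A * rate n * (B * rate n))).
    by rewrite ler_piMr// mulr_ge0// ltW.
  by rewrite mulrACA expr2.
apply: (@le_trans _ _ ((B * rate n) ^+ 2)); last by rewrite exprMn.
by rewrite ler_piMr// exprn_ge0// ltW.
Qed.

Lemma test_bounds V0 y0 n s t : `|test V0 y0 n s t| <= 1.
Proof. by rewrite /test /heat ger0_norm ?Phi_ge0 ?Phi_le1. Qed.

Lemma expect_dist_le n (F G : (nat -> {fset nat}) -> R) K :
  (forall c, valid d c n -> `|F c - G c| <= K) -> `|expect d n F - expect d n G| <= K.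
Proof.
move=> h; have E k : expect d n (fun c => G c + k) = expect d n G + k.
  by rewrite expectD expect_cst.
rewrite ler_distl -(E K) -(E (- K)).
by apply/andP; split; apply: expect_le => c /h; rewrite ler_distl => /andP[].
Qed.

Definition iterK : R := stepK R d + 4 * driftK.

Lemma driftK_ge0 : 0 <= driftK.
Proof.
have B0 := gaussB_gt0 R; have m0 := mu_gt0; have t0 := theta_gt0.
have A0 : 0 <= 2 / mu by rewrite divr_ge0// ltW.
have C0 : 0 <= 2 * theta by rewrite mulr_ge0// ltW.
apply: addr_ge0; first by apply: divr_ge0; [rewrite mulr_ge0// ltW|rewrite exprn_ge0// ltW].
apply: mulr_ge0; first by rewrite mulr_ge0// ltW.
apply: addr_ge0; last exact: exprn_ge0.
by apply: addr_ge0; [exact: exprn_ge0|exact: mulr_ge0].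
Qed.

Lemma iterK_ge0 : 0 <= iterK.
Proof.
rewrite addr_ge0 ?mulr_ge0 ?driftK_ge0// /stepK.
by rewrite !addr_ge0 ?mulr_ge0 ?exprn_ge0.
Qed.

Lemma jumpK_ge0 : 0 <= jumpK.
Proof.
rewrite /jumpK mulr_ge0//; first by rewrite mulr_ge0// ltW ?gaussB_gt0.
have c0 : 0 <= chiK by rewrite sumr_ge0.
by rewrite !addr_ge0 ?exprn_ge0 ?mulr_ge0.
Qed.

(** The drift and step errors, at most [iterK / (m + 1)^2], telescope against [1 / m]; the 4 in
    [iterK] comes from [rate m <= 2 / (m + 1)]. The jump errors add up to the clock, of order
    [log N], and only [u^3] beats them. *)
Lemma expect_test V0 y0 u n0 k : (0 < d)%N -> (0 < n0)%N -> 1 <= u ->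
  (forall n s t, (n <= n0 + k)%N -> u <= Num.sqrt (V0 - 2 * theta * clock n + chi s + chi t)) ->
  `|expect d (n0 + k) (fun c => tmean d c (n0 + k) (test V0 y0 (n0 + k)))
    - expect d n0 (fun c => tmean d c n0 (test V0 y0 n0))|
  <= iterK * (n0%:R^-1 - (n0 + k)%:R^-1) + jumpK * clock (n0 + k) / u ^+ 3.
Proof.
move=> d0 n00 u1; have u0 : 0 < u by lra.
have J0 : 0 <= jumpK / u ^+ 3.
  by rewrite divr_ge0 ?jumpK_ge0 ?exprn_ge0 ?(ltW u0).
elim: k => [_|k IHk hu].
  rewrite addn0 !subrr normr0 mulr0 add0r mulrAC mulr_ge0//.
  by rewrite sumr_ge0// => i _; rewrite ltW ?rate_gt0.
have hk n s t : (n <= n0 + k)%N -> u <= Num.sqrt (V0 - 2 * theta * clock n + chi s + chi t).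
  by move=> nk; apply: hu; rewrite addnS ltnW.
have {}IHk := IHk hk; rewrite addnS; set m := (n0 + k)%N in IHk *.
have um s t : u <= Num.sqrt (V0 - 2 * theta * clock m.+1 + chi s + chi t).
  by apply: hu; rewrite addnS.
have step : `|expect d m.+1 (fun c => tmean d c m.+1 (test V0 y0 m.+1))
    - expect d m (fun c => tmean d c m (test V0 y0 m))|
    <= driftK * rate m ^+ 2 + jumpK * rate m / u ^+ 3 + stepK R d / m.+1%:R ^+ 2.
  rewrite /=; apply: expect_dist_le => c vn; apply: tmean_step => //.
    by move=> s t; apply: test_bounds.
  by move=> s t; apply: test_step.
rewrite (_ : _ - _ = (expect d m.+1 (fun c => tmean d c m.+1 (test V0 y0 m.+1))
    - expect d m (fun c => tmean d c m (test V0 y0 m))) +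
  (expect d m (fun c => tmean d c m (test V0 y0 m))
    - expect d n0 (fun c => tmean d c n0 (test V0 y0 n0)))); last by rewrite addrA subrK.
apply: le_trans (ler_normD _ _) _; apply: le_trans (lerD step IHk) _.
rewrite clockS [jumpK * (_ + _)]mulrDr [(_ + _) / u ^+ 3]mulrDl.
set cm := jumpK * clock m / _; set rm := jumpK * rate m / _.
have m0 : (0 < m)%N by rewrite addn_gt0 n00.
have mR : 0 < m%:R :> R by rewrite ltr0n.
have hdrift : driftK * rate m ^+ 2 <= driftK * (4 / m.+1%:R ^+ 2).
  apply: ler_wpM2l; first exact: driftK_ge0.
  rewrite (_ : 4 / _ = (2 / m.+1%:R) ^+ 2); last by field.
  by rewrite ler_sqr ?nnegrE ?rate_le// ltW ?rate_gt0.
have hm : iterK / m.+1%:R ^+ 2 <= iterK * (m%:R^-1 - m.+1%:R^-1).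
  apply: ler_wpM2l; first exact: iterK_ge0.
  rewrite -natr1 -subr_ge0 (_ : _ - _ = (m%:R * (m%:R + 1) ^+ 2)^-1); last first.
    by field; rewrite !gt_eqF// addr_gt0.
  by rewrite invr_ge0 mulr_ge0 ?exprn_ge0 ?addr_ge0.
have hK : driftK * (4 / m.+1%:R ^+ 2) + stepK R d / m.+1%:R ^+ 2 = iterK / m.+1%:R ^+ 2.
  by rewrite /iterK; ring.
have -> : iterK * (n0%:R^-1 - m.+1%:R^-1) =
    iterK * (n0%:R^-1 - m%:R^-1) + iterK * (m%:R^-1 - m.+1%:R^-1) by ring.
move: hdrift hm hK; clearbody cm rm.
move: (driftK * rate m ^+ 2) (driftK * (4 / _)) (stepK R d / _) (iterK / _)
  (iterK * (n0%:R^-1 - _)) (iterK * (m%:R^-1 - _)) => *; lra.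
Qed.

End Correctors.

(** * The central limit theorem for the sum of two levels *)

Section Limit.
Variables (R : realType) (d : nat).
Hypothesis d_gt0 : (0 < d)%N.

Local Notation mu := (mean_period R d).
Local Notation th := (theta R d).
Local Notation phi := (phi R d).
Local Notation chi := (chi R d).
Local Notation K_chi := (chiK R d).
Local Notation clock := (clock R d).

Lemma ln_ratio_le (m : nat) : ln (m.+2%:R : R) - ln m.+1%:R <= m.+1%:R^-1.
Proof.
rewrite -lnV ?posrE// -lnM ?posrE ?invr_gt0//.
rewrite (_ : m.+2%:R / _ = 1 + m.+1%:R^-1); last first.
  by rewrite -natr1 mulrDl divff ?mul1r.
by apply: le_ln1Dx; apply: (lt_trans (ltrN10 R)); rewrite invr_gt0.
Qed.

Lemma ln_ratio_ge (m : nat) : m.+2%:R^-1 <= ln (m.+2%:R : R) - ln m.+1%:R.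
Proof.
rewrite -lerN2 opprB -lnV ?posrE// -lnM ?posrE ?invr_gt0//.
rewrite (_ : m.+1%:R / _ = 1 + - m.+2%:R^-1); last first.
  by rewrite -{1}[m.+1%:R](addrK 1) natr1 mulrBl divff ?mul1r.
by apply: le_ln1Dx; rewrite ltrN2 invf_lt1// ltr1n.
Qed.

Let ratio : R := d.+1%:R / d%:R.

Let dR : 0 < d%:R :> R. Proof. by rewrite ltr0n. Qed.

(** The shifts of [n] here and in [clock_ge] come from [d (n + 2) <= nactive (n + 1) <= d (n + 3)],
    as [nactive (n + 1) = d (n + 2) + 1]. *)
Lemma clock_le n : clock n <= ratio * ln n.+1%:R.
Proof.
elim: n => [|n IHn]; first by rewrite /clock big_ord0 ln1 mulr0.
rewrite clockS; apply: le_trans (lerD IHn (lexx _)) _.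
rewrite -lerBrDl -mulrBr; apply: le_trans (ler_wpM2l _ (ln_ratio_ge n)); last first.
  by rewrite divr_ge0.
rewrite /rate /ratio -!mulrA ler_wpM2l// -invfM lef_pV2 ?posrE ?nactive_gt0 ?mulr_gt0//.
by rewrite -natrM ler_nat; nia.
Qed.

Lemma clock_ge n : ratio * (ln n.+3%:R - ln 3) <= clock n.
Proof.
elim: n => [|n IHn]; first by rewrite subrr mulr0 sumr_ge0// => i _; rewrite ltW ?rate_gt0.
rewrite clockS; apply: le_trans (lerD IHn (lexx _)).
rewrite -lerBlDl -mulrBr [X in _ * X](_ : _ = ln n.+4%:R - ln n.+3%:R); last by ring.
apply: le_trans (ler_wpM2l _ (ln_ratio_le n.+2)) _; first by rewrite divr_ge0.
rewrite /rate /ratio -!mulrA ler_wpM2l// -invfM lef_pV2 ?posrE ?nactive_gt0 ?mulr_gt0//.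
by rewrite -natrM ler_nat; nia.
Qed.

Lemma clock_ln n : (0 < n)%N -> `|clock n - ratio * ln n%:R| <= ratio * ln 3.
Proof.
move=> n0; have r0 : 0 <= ratio by rewrite divr_ge0.
have nR : 0 < n%:R :> R by rewrite ltr0n.
rewrite ler_distl; apply/andP; split.
  apply: le_trans (clock_ge n); rewrite -mulrBr ler_wpM2l// lerB// ler_ln ?posrE//.
  by rewrite ler_nat; lia.
apply: le_trans (clock_le n) _; rewrite -mulrDr ler_wpM2l// -lnM ?posrE//.
by rewrite ler_ln ?posrE ?mulr_gt0// -natrM ler_nat; lia.
Qed.

Lemma clock_ge0 n : 0 <= clock n.
Proof. by rewrite sumr_ge0// => i _; rewrite ltW ?rate_gt0. Qed.

Lemma eq_tmean c n (f g : nat -> nat -> R) : (forall s t, f s t = g s t) ->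
  tmean d c n f = tmean d c n g.
Proof.
move=> fg; rewrite /tmean /pmean; congr (_ / _).
by apply: eq_bigr => X _; apply: eq_bigr => Y _; rewrite fg.
Qed.

Lemma normalize (x l Y V A1 A2 : R) : 0 < l -> `|Y - x * l| <= A1 ->
  `|V - l ^+ 2| <= A2 -> l ^+ 2 <= 4 * V ->
  `|Y / Num.sqrt V - x| <= 2 * (A1 + `|x| * (A2 / l)) / l.
Proof.
move=> l0 hY hV lV; have V0 : 0 < V.
  by have : 0 < l ^+ 2; [rewrite exprn_gt0|lra].
have s0 : 0 < Num.sqrt V by rewrite sqrtr_gt0.
have hs : l <= 2 * Num.sqrt V.
  rewrite -ler_sqr ?nnegrE ?mulr_ge0 ?(ltW s0) ?(ltW l0)// exprMn sqr_sqrtr ?(ltW V0)//.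
  by rewrite (_ : 2 ^+ 2 = 4 :> R)//; ring.
have hd : `|Num.sqrt V - l| <= A2 / l.
  rewrite ler_pdivlMr//; apply: le_trans hV.
  rewrite -{2}(sqr_sqrtr (ltW V0)) subr_sqr normrM ler_wpM2l//.
  by rewrite ger0_norm ?lerDr ?addr_ge0 ?ltW.
rewrite (_ : _ - x = (Y - x * Num.sqrt V) / Num.sqrt V); last by field; rewrite gt_eqF.
rewrite normrM normfV (gtr0_norm s0).
rewrite [leRHS](_ : _ = (A1 + `|x| * (A2 / l)) * (2 / l)); last by ring.
apply: ler_pM => //.
  rewrite (_ : Y - _ = (Y - x * l) - x * (Num.sqrt V - l)); last by ring.
  apply: le_trans (ler_normB _ _) _; apply: lerD => //.
  by rewrite normrM ler_wpM2l.
by rewrite -[leRHS]invf_div lef_pV2 ?posrE ?divr_gt0// ler_pdivrMr// mulrC.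
Qed.

Lemma Phi_lipschitz (x y : R) : `|Phi y - Phi x| <= gaussB R * `|y - x|.
Proof.
apply: (@taylor1 R (@Phi R) (@gauss R)) => c _; first exact: is_derive_Phi.
by have [] := gauss_bounds c.
Qed.

(** At time [n0] the variance of the test function is within [delta^4 l^2 + startK] of [l^2], and
    its argument before scaling within [delta l + centerK] of [x l]; the last summands bound [chi]
    and [phi] at that time. *)
Definition startK (n0 : nat) (K1 : R) := K1 + 2 * th * clock n0 + 2 * K_chi.
Definition centerK (n0 : nat) (K2 : R) := K2 + 2 / mu * clock n0 + 2 * (n0%:R + 2).

Lemma phi_total_le c n X : valid d c n -> X \in active (ran d c n) ->
  0 <= phi (total d c n X) <= n%:R + 2.
Proof.
move=> vn Xa; have /andP[h1 h2] := phi_bounds R d (total d c n X).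
rewrite (le_trans _ h1)//=; apply: (le_trans h2).
have tq : (total d c n X %/ d.+1 <= n.+1)%N.
  by rewrite -(mulnK n.+1 (ltn0Sn d)) leq_div2r// total_le.
have : (total d c n X %/ d.+1)%:R <= n.+1%:R :> R by rewrite ler_nat.
by rewrite -natr1; lra.
Qed.

(** The three errors are the summable ones from [n0] on, the Taylor errors with [u] half of
    [delta^2 l], and the distance from [Phi x] of the test function at time [n0], where totals are
    bounded and the variance is close to [l^2]. The premise on [chiK] keeps every variance above
    [u^2]; the last premise gives [l^2 <= 4 V] for [normalize]. *)
Lemma heat_mean (x delta l beta K1 K2 : R) (n0 N : nat) :
  (0 < n0 <= N)%N -> 0 < delta <= 1 -> 2 <= delta ^+ 2 * l ->
  8 * K_chi <= delta ^+ 4 * l ^+ 2 ->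
  `|2 * th * clock N - l ^+ 2| <= K1 ->
  `|beta - 2 / mu * clock N - x * l| <= delta * l + K2 ->
  4 * startK n0 K1 <= 3 * l ^+ 2 ->
  `|expect d N (fun c => tmean d c N (fun s t =>
     heat (delta ^+ 4 * l ^+ 2 + chi s + chi t) (beta - phi s - phi t))) - Phi x|
  <= iterK R d / n0%:R + jumpK R d * clock N * 8 / (delta ^+ 6 * l ^+ 3)
   + gaussB R * (2 * (delta * l + centerK n0 K2 +
       `|x| * ((delta ^+ 4 * l ^+ 2 + startK n0 K1) / l)) / l).
Proof.
move=> /andP[n00 nN] /andP[de0 de1] hdl hchi hK1 hK2 hst.
have l0 : 0 < l.
  by have := exprn_gt0 2 de0; have [//|l0] := ltP 0 l; nra.
pose u := delta ^+ 2 * l / 2.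
have u1 : 1 <= u by rewrite /u; lra.
have u0 : 0 < u by lra.
pose V0 := delta ^+ 4 * l ^+ 2 + 2 * th * clock N.
pose y0 := beta - 2 / mu * clock N.
have th0 := theta_gt0 R d; have mu0 := mu_gt0 R d.
have uE : u ^+ 2 = delta ^+ 4 * l ^+ 2 / 4 by rewrite /u; field.
have hu n s t : (n <= N)%N -> u <= Num.sqrt (V0 - 2 * th * clock n + chi s + chi t).
  move=> nN'; rewrite -[leLHS]ger0_norm ?(ltW u0)// -sqrtr_sqr ler_wsqrtr// uE.
  have cn : 2 * th * clock n <= 2 * th * clock N.
    by apply: ler_wpM2l; [rewrite mulr_ge0// ltW|exact: clock_mono].
  have := chi_bound R d s; have := chi_bound R d t; rewrite !ler_norml /V0 => /andP[? ?] /andP[? ?].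
  by lra.
have := @expect_test R d V0 y0 u n0 (N - n0) d_gt0 n00 u1.
rewrite (subnKC nN) => /(_ hu).
have testN : forall s t, test d V0 y0 N s t =
    heat (delta ^+ 4 * l ^+ 2 + chi s + chi t) (beta - phi s - phi t).
  by move=> s t; rewrite /test /V0 /y0 addrK subrK.
rewrite (eq_expect (fun c _ => eq_tmean c N testN)).
set EN := expect d N _; set E0 := expect d n0 _ => hEN.
have hE0 : `|E0 - Phi x| <= gaussB R * (2 * (delta * l + centerK n0 K2 +
       `|x| * ((delta ^+ 4 * l ^+ 2 + startK n0 K1) / l)) / l).
  rewrite -(expect_cst d n0 (Phi x)); apply: expect_dist_le => c vn.
  rewrite -(pmean_cst (Phi x) vn) /tmean.
  rewrite (_ : _ - _ = pmean d c n0 (fun X Y =>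
    test d V0 y0 n0 (total d c n0 X) (total d c n0 Y) + -1 * Phi x)); last first.
    by rewrite pmeanD pmeanZ mulN1r.
  apply: normr_pmean_le => // X Y Xa Ya; rewrite mulN1r.
  set s := total _ _ _ X; set t := total _ _ _ Y.
  apply: le_trans (Phi_lipschitz _ _) _; apply: ler_wpM2l; first exact/ltW/gaussB_gt0.
  have /andP[cs0 cs1] : - K_chi <= chi s <= K_chi by rewrite -ler_norml chi_bound.
  have /andP[ct0 ct1] : - K_chi <= chi t <= K_chi by rewrite -ler_norml chi_bound.
  have /andP[ps0 ps1] : 0 <= phi s <= n0%:R + 2 by exact: phi_total_le.
  have /andP[pt0 pt1] : 0 <= phi t <= n0%:R + 2 by exact: phi_total_le.
  have c00 : 0 <= 2 / mu * clock n0.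
    apply: mulr_ge0; [by rewrite divr_ge0// ltW|exact: clock_ge0].
  have c01 : 0 <= 2 * th * clock n0.
    apply: mulr_ge0; [by rewrite mulr_ge0// ltW|exact: clock_ge0].
  have d40 : 0 <= delta ^+ 4 * l ^+ 2 by rewrite mulr_ge0 ?exprn_ge0 ?ltW.
  rewrite ler_distl in hK1; rewrite ler_distl in hK2.
  case/andP: hK1 => ? ?; case/andP: hK2 => ? ?.
  apply: normalize => //.
  - by rewrite ler_distl /y0 /centerK; apply/andP; split; lra.
  - by rewrite ler_distl /V0 /startK; apply/andP; split; lra.
  by move: hst; rewrite /V0 /startK; lra.
rewrite (_ : EN - _ = (EN - E0) + (E0 - Phi x)); last by rewrite addrA subrK.
apply: le_trans (ler_normD _ _) _; apply: lerD => //.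
apply: (le_trans hEN); apply: lerD.
  by apply: ler_wpM2l; [exact: iterK_ge0|rewrite gerBl invr_ge0].
rewrite [leRHS](_ : _ = jumpK R d * clock N / u ^+ 3)//.
by rewrite /u; field; rewrite !gt_eqF.
Qed.

End Limit.

(** * From smooth test functions to indicators *)

Section Clt.
Variables (R : realType) (d : nat).
Hypothesis d_gt0 : (0 < d)%N.

Local Notation mu := (mean_period R d).
Local Notation th := (theta R d).
Local Notation phi := (phi R d).
Local Notation chi := (chi R d).
Local Notation K_chi := (chiK R d).
Local Notation clock := (clock R d).

Definition indic_le (b : R) (s t : nat) : R := (phi s + phi t <= b)%R%:R.

(** Two scales: the smoothing has standard deviation at most [2 delta^2 l], while thresholds are
    shifted by [delta l]. The shift is at least [1 / (2 delta)] standard deviations, deep in the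
    tail of [Phi], yet only a fraction [delta] of [l]. *)
Lemma smooth_scale delta l s t : 0 < delta -> 0 < l ->
  8 * K_chi <= delta ^+ 4 * l ^+ 2 ->
  let sq := Num.sqrt (delta ^+ 4 * l ^+ 2 + chi s + chi t) in
  0 < sq /\ (2 * delta)^-1 <= delta * l / sq.
Proof.
move=> de0 l0 hchi sq; rewrite {}/sq.
have /andP[cs0 cs1] : - K_chi <= chi s <= K_chi by rewrite -ler_norml chi_bound.
have /andP[ct0 ct1] : - K_chi <= chi t <= K_chi by rewrite -ler_norml chi_bound.
have D0 : 0 < delta ^+ 4 * l ^+ 2 by rewrite mulr_gt0 ?exprn_gt0.
set V := _ + chi t; have V0 : 0 < V by rewrite /V; lra.
have s0 : 0 < Num.sqrt V by rewrite sqrtr_gt0.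
split=> //; have h : Num.sqrt V <= 2 * delta ^+ 2 * l.
  rewrite -[leRHS]ger0_norm ?mulr_ge0 ?exprn_ge0 ?(ltW l0) ?(ltW de0)//.
  rewrite -sqrtr_sqr ler_wsqrtr//.
  rewrite (_ : (2 * delta ^+ 2 * l) ^+ 2 = 4 * (delta ^+ 4 * l ^+ 2)); last by ring.
  by rewrite /V; lra.
rewrite ler_pdivlMr// ler_pdivrMl ?mulr_gt0//.
by rewrite [leRHS](_ : _ = 2 * delta ^+ 2 * l)//; ring.
Qed.

Lemma indic_le_smooth delta l eta b s t : 0 < delta -> 0 < l ->
  8 * K_chi <= delta ^+ 4 * l ^+ 2 -> 0 <= eta -> 1 - eta <= Phi (2 * delta)^-1 ->
  indic_le b s t <=
  heat (delta ^+ 4 * l ^+ 2 + chi s + chi t) (b + delta * l - phi s - phi t) + eta.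
Proof.
move=> de0 l0 hchi eta0 heta; have [s0 hs] := smooth_scale s t de0 l0 hchi.
rewrite /indic_le /heat; case: (leP (phi s + phi t) b) => [hb|_]; last first.
  by rewrite addr_ge0 ?Phi_ge0.
rewrite -lerBlDr; apply: (le_trans heta); apply: Phi_mono; apply: (le_trans hs).
by rewrite ler_wpM2r ?invr_ge0 ?(ltW s0)//; lra.
Qed.

Lemma smooth_indic_le delta l eta b s t : 0 < delta -> 0 < l ->
  8 * K_chi <= delta ^+ 4 * l ^+ 2 -> 0 <= eta -> Phi (- (2 * delta)^-1) <= eta ->
  heat (delta ^+ 4 * l ^+ 2 + chi s + chi t) (b - delta * l - phi s - phi t) - eta <=
  indic_le b s t.
Proof.
move=> de0 l0 hchi eta0 heta; have [s0 hs] := smooth_scale s t de0 l0 hchi.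
rewrite /indic_le /heat; case: (leP (phi s + phi t) b) => [_|hb]; rewrite lerBlDr.
  by apply: (le_trans (Phi_le1 _)); rewrite lerDl.
rewrite add0r; apply: le_trans heta; apply: Phi_mono.
rewrite lerNr; apply: (le_trans hs); rewrite -mulNr.
by rewrite ler_wpM2r ?invr_ge0 ?(ltW s0)//; lra.
Qed.

Definition log_center (n : nat) : R := 2 / mu * (d.+1%:R / d%:R) * ln n%:R.
Definition log_scale (n : nat) : R := Num.sqrt (2 * th * (d.+1%:R / d%:R) * ln n%:R).

Lemma ln_nat_large (M : R) : exists N0, forall N, (N0 <= N)%N -> M <= ln (N%:R : R).
Proof.
exists (Num.bound (expR M)) => N hN.
have hM : expR M <= N%:R.
  apply: (le_trans (ltW (archi_boundP (expR_ge0 M)))); by rewrite ler_nat.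
by rewrite -[leLHS]expRK ler_ln ?posrE ?expR_gt0// (lt_le_trans (expR_gt0 M)).
Qed.

Lemma log_scale_large (M : R) : exists N0, forall N, (N0 <= N)%N -> M <= log_scale N.
Proof.
have [M0|M0] := leP M 0.
  by exists 0%N => N _; apply: (le_trans M0); rewrite sqrtr_ge0.
have q0 : 0 < 2 * th * (d.+1%:R / d%:R).
  by apply: mulr_gt0; [rewrite mulr_gt0// theta_gt0|rewrite divr_gt0// ltr0n].
have [N0 hN0] := ln_nat_large (M ^+ 2 / (2 * th * (d.+1%:R / d%:R))).
exists N0 => N /hN0; rewrite ler_pdivrMr// mulrC => h.
by rewrite -[leLHS]gtr0_norm// -sqrtr_sqr ler_wsqrtr.
Qed.

Hypothesis Phi_tails : forall eta : R, 0 < eta ->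
  exists M : R, forall y, M <= y -> 1 - eta <= Phi y /\ Phi (- y) <= eta.

(** The bound is uniform over thresholds [b] within a bounded distance [K] of the nominal one, which
    later absorbs the bounded gap between hopcounts and levels. *)
Lemma clt_total (x K eta : R) : 0 <= K -> 0 < eta -> exists N0, forall N, (N0 <= N)%N -> forall b,
  `|b - log_center N - x * log_scale N| <= K ->
  `|expect d N (fun c => tmean d c N (indic_le b)) - Phi x| <= eta.
Proof.
move=> K0 eta0; have B0 := gaussB_gt0 R.
have th0 := theta_gt0 R d; have mu0 := mu_gt0 R d.
have dR : 0 < d%:R :> R by rewrite ltr0n.
have eta4 : 0 < eta / 4 by lra.
have [M hM] := Phi_tails eta4.
(* Makes [W * delta / 8] dominate [2 gaussB (delta + |x| delta^4)], the part of the error at time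
   [n0] that does not vanish as [l] grows. *)
pose W := 16 * gaussB R * (1 + `|x|).
have W0 : 0 < W by apply: mulr_gt0; [rewrite mulr_gt0|rewrite ltr_pwDl].
pose delta := (1 + W / eta + 2 * `|M|)^-1.
have den1 : 1 <= 1 + W / eta + 2 * `|M|.
  by have := divr_gt0 W0 eta0; have := normr_ge0 M; lra.
have de0 : 0 < delta by rewrite invr_gt0; lra.
have de1 : delta <= 1 by rewrite invf_le1; lra.
have deW : W * delta <= eta.
  rewrite ler_pdivrMr; last by lra.
  rewrite -ler_pdivrMl// mulrC; have := normr_ge0 M; lra.
have deM : M <= (2 * delta)^-1.
  rewrite invfM invrK; have := ler_norm M; have : 0 < W / eta by rewrite divr_gt0.
  by lra.
pose ratio : R := d.+1%:R / d%:R.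
have r0 : 0 < ratio by rewrite divr_gt0.
have l30 : 0 <= ln 3 :> R by rewrite ln_ge0// ler1n.
pose K1 := 2 * th * (ratio * ln 3).
pose K2 := K + 2 / mu * (ratio * ln 3).
have th2 : 0 < 2 * th by rewrite mulr_gt0.
have mu2 : 0 < 2 / mu by rewrite divr_gt0.
have rl0 : 0 <= ratio * ln 3 by rewrite mulr_ge0// ltW.
have K10 : 0 <= K1 := mulr_ge0 (ltW th2) rl0.
have K20 : 0 <= K2 := addr_ge0 K0 (mulr_ge0 (ltW mu2) rl0).
have [n0 n00 hn0] : exists2 n0, (0 < n0)%N & iterK R d / n0%:R <= eta / 8.
  exists (Num.bound (iterK R d * (8 / eta))).+1 => //.
  have h : iterK R d * (8 / eta) <= (Num.bound (iterK R d * (8 / eta))).+1%:R.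
    have hi : 0 <= iterK R d * (8 / eta).
      by rewrite mulr_ge0 ?iterK_ge0// divr_ge0// ltW.
    by rewrite -[leRHS]natr1; apply: (le_trans (ltW (archi_boundP hi))); rewrite lerDl.
  rewrite ler_pdivrMr// -ler_pdivrMl ?divr_gt0// mulrC.
  by rewrite [X in _ * X](_ : _ = 8 / eta)// invf_div.
pose S := startK d n0 K1; pose Ce := centerK d n0 K2.
have c0 : 0 <= K_chi by rewrite sumr_ge0.
have cl0 := clock_ge0 R d n0.
have S0 : 0 <= S.
  rewrite /S /startK; apply: addr_ge0; last by rewrite mulr_ge0.
  by apply: addr_ge0 => //; apply: mulr_ge0 => //; apply: ltW.
have C0 : 0 <= Ce.
  rewrite /Ce /centerK; apply: addr_ge0; last by rewrite mulr_ge0// addr_ge0.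
  by apply: addr_ge0 => //; apply: mulr_ge0 => //; apply: ltW.
have J0 := jumpK_ge0 R d.
(* [Q / l] bounds the Taylor errors, as [clock N] is at most [(1 + K1) l^2 / (2 theta)]; [E / l]
   below bounds the part of the error at time [n0] that decays with [l]. *)
pose Q := jumpK R d * 8 * (1 + K1) / (2 * th * delta ^+ 6).
have Q0 : 0 <= Q.
  apply: divr_ge0; first by rewrite mulr_ge0 ?addr_ge0// mulr_ge0.
  by rewrite mulr_ge0 ?exprn_ge0 ?(ltW th2) ?(ltW de0).
pose E := 2 * gaussB R * (Ce + `|x| * S).
have E0 : 0 <= E.
  by apply: mulr_ge0; [rewrite mulr_ge0// ltW|rewrite addr_ge0// mulr_ge0].
(* The summands secure in turn the lower bounds on [l] behind [l1], [h2], [hchi], [hS], [hQ] and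
   [hE]. *)
pose Lam := 1 + 2 / delta ^+ 2 + 8 * K_chi / delta ^+ 4 + 4 * S + Q * (8 / eta) + E * (8 / eta).
have [N1 hN1] := log_scale_large Lam.
exists (maxn n0 N1) => N; rewrite geq_max => /andP[nN /hN1 hl] b hb.
set l := log_scale N in hl hb *.
have t2 : 0 <= 2 / delta ^+ 2 by apply: divr_ge0; [|exact/exprn_ge0/ltW].
have tc : 0 <= 8 * K_chi / delta ^+ 4.
  by apply: divr_ge0; [exact: mulr_ge0|exact/exprn_ge0/ltW].
have e8 : 0 <= 8 / eta by rewrite divr_ge0// ltW.
have tQ : 0 <= Q * (8 / eta) by exact: mulr_ge0.
have tE : 0 <= E * (8 / eta) by exact: mulr_ge0.
have l1 : 1 <= l by apply: le_trans hl; rewrite /Lam; lra.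
have l0 : 0 < l by lra.
have l2 : l <= l ^+ 2 by rewrite expr2 ler_peMl// ltW.
have h2 : 2 <= delta ^+ 2 * l.
  by rewrite -ler_pdivrMl ?exprn_gt0// mulrC; apply: le_trans hl; rewrite /Lam; lra.
have hchi : 8 * K_chi <= delta ^+ 4 * l ^+ 2.
  rewrite -ler_pdivrMl ?exprn_gt0// mulrC; apply: le_trans l2; apply: le_trans hl.
  by rewrite /Lam; lra.
have hS : 4 * S <= 3 * l ^+ 2.
  have : 4 * S <= l by apply: le_trans hl; rewrite /Lam; lra.
  by have := sqr_ge0 l; lra.
have lnN0 : 0 <= ln N%:R :> R by rewrite ln_ge0// ler1n (leq_trans n00).
have lE : l ^+ 2 = 2 * th * (ratio * ln N%:R).
  rewrite /l /log_scale sqr_sqrtr; first by rewrite -mulrA.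
  by apply: mulr_ge0 => //; apply: mulr_ge0; apply: ltW.
have hclock := clock_ln R d_gt0 (leq_trans n00 nN).
have hK1 : `|2 * th * clock N - l ^+ 2| <= K1.
  rewrite lE -mulrBr normrM (gtr0_norm th2) /K1.
  by apply: ler_wpM2l hclock; apply: ltW.
have hctr : `|log_center N - 2 / mu * clock N| <= 2 / mu * (ratio * ln 3).
  rewrite /log_center -mulrA -mulrBr normrM (gtr0_norm mu2) distrC.
  by apply: ler_wpM2l hclock; apply: ltW.
have hbeta sg : `|sg| <= delta * l -> `|b + sg - 2 / mu * clock N - x * l| <= delta * l + K2.
  move=> hsg; rewrite (_ : _ - x * l =
    sg + ((b - log_center N - x * l) + (log_center N - 2 / mu * clock N))); last by ring.
  apply: le_trans (ler_normD _ _) _; apply: lerD => //.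
  by apply: le_trans (ler_normD _ _) _; apply: lerD.
have hn0N : (0 < n0 <= N)%N by rewrite n00.
have hde : 0 < delta <= 1 by rewrite de0.
have hQ : Q / l <= eta / 8.
  rewrite ler_pdivrMr// -ler_pdivrMl ?divr_gt0// invf_div mulrC.
  by apply: le_trans hl; rewrite /Lam; lra.
have hE : E / l <= eta / 8.
  rewrite ler_pdivrMr// -ler_pdivrMl ?divr_gt0// invf_div mulrC.
  by apply: le_trans hl; rewrite /Lam; lra.
have hjump : jumpK R d * clock N * 8 / (delta ^+ 6 * l ^+ 3) <= eta / 8.
  apply: le_trans hQ; rewrite [leRHS](_ : _ =
    jumpK R d * 8 / (delta ^+ 6 * l ^+ 3) * ((1 + K1) * l ^+ 2 / (2 * th))); last first.
    by rewrite /Q; field; rewrite !gt_eqF.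
  rewrite [leLHS](_ : _ = jumpK R d * 8 / (delta ^+ 6 * l ^+ 3) * clock N); last first.
    by field; rewrite !gt_eqF.
  apply: ler_wpM2l.
    by apply: divr_ge0; [exact: mulr_ge0|rewrite mulr_ge0 ?exprn_ge0 ?(ltW l0) ?(ltW de0)].
  rewrite ler_pdivlMr// mulrC; have := hK1; rewrite ler_distl => /andP[_ hK1'].
  apply: (le_trans hK1'); rewrite mulrDl mul1r lerD2l.
  by apply: ler_peMr => //; exact: le_trans l1 l2.
have hgauss : gaussB R * (2 * (delta * l + Ce +
       `|x| * ((delta ^+ 4 * l ^+ 2 + S) / l)) / l) <= eta / 4.
  have il : 0 <= l^-1 by rewrite invr_ge0 ltW.
  have il1 : l^-1 <= 1 by rewrite invf_le1.
  rewrite [leLHS](_ : _ = 2 * gaussB R * (delta + `|x| * delta ^+ 4)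
     + 2 * gaussB R * (Ce + `|x| * (S * l^-1)) / l); last by field; rewrite gt_eqF.
  rewrite (_ : eta / 4 = eta / 8 + eta / 8); last by field.
  have B2 : 0 <= 2 * gaussB R by rewrite mulr_ge0// ltW.
  apply: lerD.
    apply: (@le_trans _ _ (W * delta / 8)); last by rewrite ler_wpM2r.
    rewrite [leRHS](_ : _ = 2 * gaussB R * (delta + `|x| * delta)); last by rewrite /W; field.
    apply: ler_wpM2l => //; rewrite lerD2l ler_wpM2l// exprS ler_piMr ?(ltW de0)//.
    by rewrite exprn_ile1 ?(ltW de0).
  apply: le_trans hE; apply: ler_wpM2r => //; apply: ler_wpM2l => //.
  by rewrite lerD2l ler_wpM2l// ler_piMr.
have near sg : `|sg| <= delta * l ->
  `|expect d N (fun c => tmean d c N (fun s t =>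
     heat (delta ^+ 4 * l ^+ 2 + chi s + chi t) (b + sg - phi s - phi t))) - Phi x| <= eta / 2.
  move=> /hbeta hsg; apply: le_trans (heat_mean d_gt0 hn0N hde h2 hchi hK1 hsg hS) _.
  by rewrite -/S -/Ce; lra.
have [tail1 tail2] := hM _ deM.
have dl : 0 <= delta * l by rewrite mulr_ge0 ?ltW.
have up := near (delta * l); have dn := near (- (delta * l)).
rewrite normrN ger0_norm// lexx in up dn.
move: (up isT) (dn isT); rewrite !ler_distl => /andP[_ up2] /andP[dn1 _].
have addc (f : nat -> nat -> R) k :
    expect d N (fun c => tmean d c N (fun s t => f s t + k)) =
    expect d N (fun c => tmean d c N f) + k.
  rewrite -[in RHS](expect_cst d N k) -expectD; apply: eq_expect => c vn.
  by rewrite /tmean pmeanD pmean_cst.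
apply/andP; split.
  have h : expect d N (fun c => tmean d c N (fun s t =>
      heat (delta ^+ 4 * l ^+ 2 + chi s + chi t) (b + - (delta * l) - phi s - phi t)
        + - (eta / 4))) <= expect d N (fun c => tmean d c N (indic_le b)).
    apply: expect_le => c _; apply: pmean_le => X Y _ _.
    by apply: smooth_indic_le => //; exact: ltW.
  by rewrite addc in h; lra.
have h : expect d N (fun c => tmean d c N (indic_le b)) <=
    expect d N (fun c => tmean d c N (fun s t =>
      heat (delta ^+ 4 * l ^+ 2 + chi s + chi t) (b + delta * l - phi s - phi t)
        + eta / 4)).
  apply: expect_le => c _; apply: pmean_le => X Y _ _.
  by apply: indic_le_smooth => //; exact: ltW.
by rewrite addc in h; lra.
Qed.

End Clt.

(** * Moments of a sum of geometric variables *)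

Section GeometricSeries.
Variables (R : realType) (p : R).
Hypotheses (p_gt0 : 0 < p) (p_le1 : p <= 1).

Let q := 1 - p.
Let q_ge0 : 0 <= q. Proof. by rewrite subr_ge0. Qed.

Lemma eseries_remainder (a rem : nat -> R) (S : R) :
  (forall n, \sum_(0 <= k < n) a k = S - rem n) -> rem n @[n --> \oo] --> (0 : R) ->
  (\sum_(k <oo) (a k)%:E)%E = S%:E.
Proof.
move=> aS rem0; apply/cvg_lim => //.
apply: cvg_EFin; first by apply: nearW => n; rewrite sumEFin.
rewrite [X in X @ _ --> _](_ : _ = (fun n => S - rem n)); last first.
  by apply/funext => n /=; rewrite sumEFin /= aS.
by rewrite -[X in _ --> X]subr0; apply: cvgB => //; exact: cvg_cst.
Qed.

(* A nonnegative remainder makes the series converge. *)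
Lemma term_cvg0 (a rem : nat -> R) (S : R) : (forall n, 0 <= a n) ->
  (forall n, 0 <= rem n) -> (forall n, \sum_(0 <= k < n) a k = S - rem n) ->
  a n @[n --> \oo] --> (0 : R).
Proof.
move=> a0 r0 aS; apply: cvg_series_cvg_0; apply: nondecreasing_is_cvgn.
  by apply/nondecreasing_seqP => n; rewrite /series /= big_nat_recr//= lerDl.
by exists S => _ [n _ <-]; rewrite /series /= aS gerBl.
Qed.

(** The remainders are [P(X > n)], [E[X; X > n]] and [E[X^2; X > n]] for a geometric [X], in closed
    form by lack of memory. *)
Let geo_rem n : R := q ^+ n.
Let mean_rem n : R := q ^+ n * (n%:R + p^-1).
Let square_rem n : R := q ^+ n * (n%:R ^+ 2 + 2 * n%:R / p + (2 - p) / p ^+ 2).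

Lemma geo_sum n : \sum_(0 <= k < n) (p * q ^+ k) = 1 - geo_rem n.
Proof.
elim: n => [|n IHn]; first by rewrite big_geq// /geo_rem expr0 subrr.
by rewrite big_nat_recr//= IHn /geo_rem exprS /q; ring.
Qed.

Lemma mean_sum n : \sum_(0 <= k < n) (k.+1%:R * (p * q ^+ k)) = p^-1 - mean_rem n.
Proof.
have p0 : p != 0 by rewrite gt_eqF.
elim: n => [|n IHn]; first by rewrite big_geq// /mean_rem expr0 mul1r add0r subrr.
by rewrite big_nat_recr//= IHn /mean_rem exprS -natr1 /q; field.
Qed.

Lemma square_sum n : \sum_(0 <= k < n) (k.+1%:R ^+ 2 * (p * q ^+ k)) =
  (2 - p) / p ^+ 2 - square_rem n.
Proof.
have p0 : p != 0 by rewrite gt_eqF.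
elim: n => [|n IHn].
  by rewrite big_geq// /square_rem expr0; field.
by rewrite big_nat_recr//= IHn /square_rem [q ^+ n.+1]exprS -[n.+1%:R]natr1 /q; field.
Qed.

Let geo_cvg : geo_rem n @[n --> \oo] --> (0 : R).
Proof. by apply: cvg_expr; rewrite ger0_norm// gtrBl. Qed.

Let cvgMc (f : nat -> R) c : f n @[n --> \oo] --> (0 : R) ->
  f n * c @[n --> \oo] --> (0 : R).
Proof. by move=> f0; rewrite -(mul0r c); apply: cvgM => //; exact: cvg_cst. Qed.

(** The limit comes from the sum itself: partial sums bounded by [1 / p] force the terms to 0, and
    [mean_rem] is a combination of such terms. *)
Let lin_cvg : n.+1%:R * q ^+ n @[n --> \oo] --> (0 : R).
Proof.
have h : n.+1%:R * (p * q ^+ n) @[n --> \oo] --> (0 : R).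
  apply: (term_cvg0 _ _ mean_sum) => n.
    by rewrite !mulr_ge0 ?exprn_ge0 ?(ltW p_gt0).
  by rewrite /mean_rem mulr_ge0 ?exprn_ge0// addr_ge0// invr_ge0 ltW.
rewrite (_ : (fun n : nat => _) = (fun n : nat => n.+1%:R * (p * q ^+ n) * p^-1)); last first.
  by apply/funext => n; field; rewrite gt_eqF.
exact: cvgMc.
Qed.

Let mean_cvg : mean_rem n @[n --> \oo] --> (0 : R).
Proof.
rewrite (_ : mean_rem = (fun n => n.+1%:R * q ^+ n + q ^+ n * (p^-1 - 1))); last first.
  by apply/funext => n; rewrite /mean_rem -natr1; ring.
by rewrite -[X in _ --> X]addr0; apply: cvgD => //; exact: cvgMc.
Qed.

Let square_cvg : square_rem n @[n --> \oo] --> (0 : R).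
Proof.
have h2 : n.+1%:R ^+ 2 * (p * q ^+ n) @[n --> \oo] --> (0 : R).
  apply: (term_cvg0 _ _ square_sum) => n.
    by rewrite !mulr_ge0 ?exprn_ge0 ?(ltW p_gt0).
  rewrite /square_rem mulr_ge0 ?exprn_ge0// addr_ge0//.
    by rewrite addr_ge0 ?exprn_ge0// !mulr_ge0 ?invr_ge0 ?(ltW p_gt0).
  by rewrite divr_ge0 ?exprn_ge0 ?(ltW p_gt0)// subr_ge0 (le_trans p_le1)// ler1n.
rewrite (_ : square_rem = (fun n => n.+1%:R ^+ 2 * (p * q ^+ n) * p^-1 +
  (n.+1%:R * q ^+ n * (2 / p - 2) + q ^+ n * (1 - 2 / p + (2 - p) / p ^+ 2)))); last first.
  by apply/funext => n; rewrite /square_rem -[n.+1%:R]natr1; field; rewrite gt_eqF.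
rewrite -[X in _ --> X]addr0; apply: cvgD; first exact: cvgMc.
by rewrite -[X in _ --> X]addr0; apply: cvgD; exact: cvgMc.
Qed.

Lemma geo_series : (\sum_(k <oo) (p * (1 - p) ^+ k)%:E)%E = 1%:E.
Proof. exact: eseries_remainder geo_sum geo_cvg. Qed.

Lemma geo_mean_series : (\sum_(k <oo) (k.+1%:R * (p * (1 - p) ^+ k))%:E)%E = (p^-1)%:E.
Proof. exact: eseries_remainder mean_sum mean_cvg. Qed.

Lemma geo_square_series :
  (\sum_(k <oo) (k.+1%:R ^+ 2 * (p * (1 - p) ^+ k))%:E)%E = ((2 - p) / p ^+ 2)%:E.
Proof. exact: eseries_remainder square_sum square_cvg. Qed.

End GeometricSeries.

Section GeometricMoments.
Context {R : realType} {dT : measure_display} {T : measurableType dT}.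
Variable P : probability T R.

Section One.
Variables (X : {RV P >-> R}) (p : R).
Hypotheses (p_gt0 : 0 < p) (p_le1 : p <= 1) (X_geom : geometric_rv X p).

Definition level_set k : set T := X @^-1` [set k.+1%:R].

Lemma measurable_level_set k : measurable (level_set k).
Proof. by rewrite -[level_set k]setTI; apply: measurable_funP. Qed.

Lemma trivIset_level_set : trivIset setT level_set.
Proof.
apply/trivIsetP => i j _ _ ij; rewrite -subset0 => w [/= e1 e2].
have /eqP : i.+1%:R = j.+1%:R :> R by rewrite -e1 -e2.
by rewrite eqr_nat eqSS (negbTE ij).
Qed.

Lemma prob_level_set k : P (level_set k) = (p * (1 - p) ^+ k)%:E.
Proof. by rewrite -X_geom /pmf fineK// fin_num_measure//; exact: measurable_level_set. Qed.

(** The hypothesis gives the masses at 1, 2, and so on; as they sum to 1, the complement of these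
    level sets is null and integrals reduce to series over them. *)
Lemma prob_bigcup_level_set : P (\bigcup_k level_set k) = 1%E.
Proof.
rewrite measure_semi_bigcup//.
- by rewrite -(geo_series p_gt0 p_le1); apply: eq_eseriesr => k _; exact: prob_level_set.
- exact: measurable_level_set.
- exact: trivIset_level_set.
- by apply: bigcup_measurable => k _; exact: measurable_level_set.
Qed.

Let rest := ~` (\bigcup_k level_set k).

Let measurable_bigcup_level : measurable (\bigcup_k level_set k).
Proof. by apply: bigcup_measurable => k _; exact: measurable_level_set. Qed.

Let measurable_rest : measurable rest.
Proof. exact: measurableC. Qed.

Let rest0 : P rest = 0%E.
Proof. by rewrite /rest probability_setC// prob_bigcup_level_set subee. Qed.

Let setD_rest D : D `\` rest = \bigcup_k (D `&` level_set k).
Proof. by rewrite setDE setCK setI_bigcupr. Qed.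

Let triv D : trivIset setT (fun k => D `&` level_set k).
Proof. exact: trivIset_setIl trivIset_level_set. Qed.

Lemma ge0_integral_level_sets D (f : T -> \bar R) : measurable D ->
  measurable_fun D f -> (forall w, D w -> (0 <= f w)%E) ->
  (\int[P]_(w in D) f w = \sum_(k <oo) \int[P]_(w in D `&` level_set k) f w)%E.
Proof.
move=> mD mf f0; rewrite (ge0_negligible_integral measurable_rest)// setD_rest.
rewrite ge0_integral_bigcup//.
- by move=> k; apply: measurableI => //; exact: measurable_level_set.
- by apply: measurable_funS mf => // w [k _ []].
- by move=> w [k _ [Dw _]]; exact: f0.
Qed.

Lemma integral_level_sets D (f : T -> \bar R) : measurable D -> P.-integrable D f ->
  (\int[P]_(w in D) f w = \sum_(k <oo) \int[P]_(w in D `&` level_set k) f w)%E.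
Proof.
move=> mD iF; rewrite (negligible_integral measurable_rest)// setD_rest.
rewrite integral_bigcup//.
- by move=> k; apply: measurableI => //; exact: measurable_level_set.
- rewrite -setD_rest; apply: integrableS iF => //; first exact: measurableD.
Qed.

Lemma geometric_square : (\int[P]_w (X w ^+ 2)%:E = ((2 - p) / p ^+ 2)%:E)%E.
Proof.
rewrite ge0_integral_level_sets//.
- rewrite -geo_square_series//; apply: eq_eseriesr => k _.
  rewrite (eq_integral (cst (k.+1%:R ^+ 2)%:E)); last first.
    by move=> w; rewrite inE => -[_ /= ->].
  rewrite integral_cst; last by apply: measurableI => //; exact: measurable_level_set.
  by rewrite setTI [RHS]EFinM -prob_level_set.
- by apply/measurable_EFinP; apply: measurable_funX.
- by move=> w _; rewrite lee_fin sqr_ge0.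
Qed.

Lemma geometric_Lfun2 : (X : T -> R) \in Lfun P 2%:E.
Proof.
rewrite inE; apply/andP; split; rewrite inE/=; first exact: measurable_funP.
rewrite /finite_norm unlock; apply: poweR_lty.
rewrite (eq_integral (fun w => (X w ^+ 2)%:E)).
  by rewrite geometric_square ltry.
by move=> w _; rewrite /= powR_mulrn// real_normK ?num_real.
Qed.

Lemma geometric_Lfun1 : (X : T -> R) \in Lfun P 1.
Proof. by apply: Lfun_subset12 geometric_Lfun2; exact: fin_num_measure. Qed.

Lemma geometric_expectation : ('E_P[X] = (p^-1)%:E)%E.
Proof.
rewrite unlock integral_level_sets//; last exact/Lfun1_integrable/geometric_Lfun1.
rewrite -geo_mean_series//; apply: eq_eseriesr => k _.
rewrite (eq_integral (cst k.+1%:R%:E)); last by move=> w; rewrite inE => -[_ /= ->].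
rewrite integral_cst; last by apply: measurableI => //; exact: measurable_level_set.
by rewrite setTI [RHS]EFinM -prob_level_set.
Qed.

Lemma geometric_variance : ('V_P[X] = ((1 - p) / p ^+ 2)%:E)%E.
Proof.
rewrite varianceE ?geometric_Lfun2// geometric_expectation.
rewrite [X in (X - _)%E](_ : _ = ((2 - p) / p ^+ 2)%:E); last first.
  by rewrite -geometric_square unlock.
by rewrite -EFin_expe -EFinB; congr _%:E; field; rewrite gt_eqF.
Qed.

End One.

Lemma geometric_covariance (X Y : {RV P >-> R}) p r :
  0 < p -> p <= 1 -> geometric_rv X p -> 0 < r -> r <= 1 -> geometric_rv Y r ->
  (forall k l, P (level_set X k `&` level_set Y l) = (P (level_set X k) * P (level_set Y l))%E) ->
  covariance P X Y = 0%E.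
Proof.
move=> p0 p1 Xp r0 r1 Yr XY.
have X2 := geometric_Lfun2 p0 p1 Xp; have Y2 := geometric_Lfun2 r0 r1 Yr.
have X1 := geometric_Lfun1 p0 p1 Xp; have Y1 := geometric_Lfun1 r0 r1 Yr.
have XY1 := Lfun2_mul_Lfun1 X2 Y2.
rewrite covarianceE// (geometric_expectation p0 p1 Xp) (geometric_expectation r0 r1 Yr).
suff -> : ('E_P[((X : T -> R) * (Y : T -> R))%R] = (p^-1 * r^-1)%:E)%E.
  by rewrite EFinM subee.
rewrite unlock (integral_level_sets p0 p1 Xp)//; last exact/Lfun1_integrable.
rewrite [p^-1 * r^-1]mulrC EFinM -(geo_mean_series p0 p1) -nneseriesZl; last first.
  by move=> k _; rewrite lee_fin !mulr_ge0 ?exprn_ge0 ?(ltW p0) ?subr_ge0.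
apply: eq_eseriesr => k _; rewrite setTI.
have mXk := measurable_level_set X k.
rewrite (eq_integral (fun w => k.+1%:R%:E * (Y w)%:E)%E); last first.
  by move=> w; rewrite inE => /= <-.
have iY : P.-integrable (level_set X k) (fun w => (Y w)%:E).
  by apply: (integrableS _ _ _ ((Lfun1_integrable _ _).1 Y1)).
rewrite integralZl// (integral_level_sets r0 r1 Yr)//.
rewrite (eq_eseriesr (g := fun l => (P (level_set X k)) * (l.+1%:R * (r * (1 - r) ^+ l))%:E)%E).
  rewrite (prob_level_set Xp) nneseriesZl ?(geo_mean_series r0 r1).
    by rewrite -!EFinM; congr _%:E; ring.
  by move=> l _; rewrite lee_fin !mulr_ge0 ?exprn_ge0 ?(ltW r0) ?subr_ge0.
move=> l _; rewrite (eq_integral (cst l.+1%:R%:E)); last first.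
  by move=> w; rewrite inE => -[_ /= ->].
rewrite integral_cst; last by apply: measurableI => //; exact: measurable_level_set.
transitivity (l.+1%:R%:E * P (level_set X k `&` level_set Y l))%E => //.
by rewrite XY (prob_level_set Yr) (prob_level_set Xp) -!EFinM; congr _%:E; ring.
Qed.

End GeometricMoments.

Section SumMoments.
Context {R : realType} {dT : measure_display} {T : measurableType dT}.
Variables (P : probability T R) (d : nat) (X : 'I_d.+1 -> {RV P >-> R}).
Hypothesis X_indep : independent_rvs X.
Hypothesis X_geom : forall i : 'I_d.+1, geometric_rv (X i) (i.+1%:R / d.+1%:R).

Let p (i : 'I_d.+1) : R := i.+1%:R / d.+1%:R.

Let p_gt0 i : 0 < p i. Proof. by rewrite divr_gt0. Qed.

Let p_le1 i : p i <= 1.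
Proof. by rewrite ler_pdivrMr// mul1r ler_nat. Qed.

Lemma independent_pair (i j : 'I_d.+1) (A B : set R) : i != j ->
  measurable A -> measurable B ->
  P ((X i @^-1` A) `&` (X j @^-1` B)) = (P (X i @^-1` A) * P (X j @^-1` B))%E.
Proof.
move=> ij mA mB.
pose C k := if k == i then A else if k == j then B else setT.
have mC k : measurable (C k) by rewrite /C; case: ifP => // _; case: ifP.
have := X_indep mC.
rewrite (_ : \bigcap_(k in [set: 'I_d.+1]) _ = (X i @^-1` A) `&` (X j @^-1` B)); last first.
  apply/seteqP; split => [w h|w [wA wB] k _].
    split; first by have := h i I; rewrite /C eqxx.
    by have := h j I; rewrite /C eqxx eq_sym (negbTE ij).
  by rewrite /C /=; case: (k =P i) => [->//|_]; case: (k =P j) => [->|].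
move=> ->; rewrite (bigD1 i)//= (bigD1 j) /=; last by rewrite eq_sym.
rewrite big1 ?mule1; last first.
  by move=> k /andP[/negbTE ki /negbTE kj]; rewrite /C ki kj preimage_setT probability_setT.
by rewrite /C !eqxx eq_sym (negbTE ij).
Qed.

Let psum (r : seq 'I_d.+1) : T -> R := fun w => \sum_(i <- r) X i w.

Let psum_cons i r : psum (i :: r) = (X i : T -> R) \+ psum r.
Proof. by apply/funext => w; rewrite /psum big_cons. Qed.

Let Lfun2 i : (X i : T -> R) \in Lfun P 2%:E.
Proof. exact: geometric_Lfun2 (p_gt0 i) (p_le1 i) (X_geom i). Qed.

Let psum_Lfun2 r : psum r \in Lfun P 2%:E.
Proof.
elim: r => [|i r IHr].
  rewrite (_ : psum [::] = cst 0); first by rewrite Lfun_cst ?lee1n.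
  by apply/funext => w; rewrite /psum big_nil.
by rewrite psum_cons rpredD ?lee1n.
Qed.

Let psum_expectation r : ('E_P[psum r] = (\sum_(i <- r) (p i)^-1)%:E)%E.
Proof.
elim: r => [|i r IHr].
  rewrite (_ : psum [::] = cst 0); first by rewrite expectation_cst big_nil.
  by apply/funext => w; rewrite /psum big_nil.
have Pfin : P setT \is a fin_num := fin_num_measure P _ measurableT.
rewrite psum_cons expectationD ?(Lfun_subset12 Pfin)// IHr.
by rewrite (geometric_expectation (p_gt0 i) (p_le1 i) (X_geom i)) big_cons EFinD.
Qed.

Let psum_covariance i r : i \notin r -> covariance P (X i) (psum r) = 0%E.
Proof.
elim: r => [_|j r IHr].
  rewrite (_ : psum [::] = cst 0); first by rewrite covariance_cst_r.
  by apply/funext => w; rewrite /psum big_nil.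
rewrite inE negb_or => /andP[ij ir].
rewrite psum_cons covarianceDr// IHr// adde0.
apply: (geometric_covariance (p_gt0 i) (p_le1 i) (X_geom i) (p_gt0 j) (p_le1 j) (X_geom j)).
by move=> k l; apply: independent_pair.
Qed.

Let psum_variance r : uniq r -> ('V_P[psum r] = (\sum_(i <- r) ((1 - p i) / p i ^+ 2))%:E)%E.
Proof.
elim: r => [_|i r IHr /= /andP[ir ur]].
  rewrite (_ : psum [::] = cst 0); first by rewrite variance_cst big_nil.
  by apply/funext => w; rewrite /psum big_nil.
rewrite psum_cons varianceD// psum_covariance// mule0 adde0 IHr//.
by rewrite (geometric_variance (p_gt0 i) (p_le1 i) (X_geom i)) big_cons EFinD.
Qed.

(** The phases of the coupon collector run in the opposite order: [prob_up] decreases from 1, the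
    success probabilities increase to 1. *)
Let prob_up_rev (i : 'I_d.+1) : prob_up R d (rev_ord i) = p i.
Proof.
have := ltn_ord i; rewrite /prob_up /p => id; congr (_%:R / _).
by rewrite modn_small /=; lia.
Qed.

Lemma sum_expectation :
  fine ('E_P[(fun w => \sum_(i < d.+1) X i w)%R])%E = mean_period R d.
Proof.
rewrite (psum_expectation (index_enum _)) /= /mean_period.
rewrite [RHS](reindex_inj rev_ord_inj) /=.
by apply: eq_bigr => i _; rewrite prob_up_rev.
Qed.

Lemma sum_variance :
  fine ('V_P[(fun w => \sum_(i < d.+1) X i w)%R])%E + mean_period R d = square_period R d.
Proof.
rewrite (psum_variance (index_enum_uniq _)) /= /mean_period /square_period.
rewrite [X in _ + X](reindex_inj rev_ord_inj) [RHS](reindex_inj rev_ord_inj) /=.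
rewrite -big_split /=; apply: eq_bigr => i _; rewrite prob_up_rev.
by have := p_gt0 i; move: (p i) => q q0; field; rewrite gt_eqF.
Qed.

End SumMoments.

(** * From levels to hopcounts *)

Section Sandwich.
Variables (R : realType) (d : nat).
Hypothesis d_gt0 : (0 < d)%N.
Implicit Types (c : nat -> {fset nat}) (n N : nat) (X Y : {fset nat}) (b : R).

Definition prob_phi_le N b : R :=
  expect d N (fun c => tmean d c N (indic_le d b)).

(** [2 (n0 + 1)] is the loss through the vertices of time [n0]; the extra 2 covers [phi] exceeding
    the quotient by up to 1 for each clique. The sum is also at least 3, the constant in the upper
    bound on the hopcount. *)
Definition gapK (n0 : nat) : R := (n0.+1.*2.+2)%:R.

Lemma gapK_ge0 n0 : 0 <= gapK n0.
Proof. exact: ler0n. Qed.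

Lemma indic_le_hop n0 h qs qt s t b :
  qs = (s %/ d.+1)%N -> qt = (t %/ d.+1)%N -> (h <= qs + qt + 3)%N ->
  indic_le d (b - gapK n0) s t <= (h%:R <= b)%R%:R.
Proof.
move=> -> -> hle; rewrite /indic_le.
case: (leP (phi R d s + phi R d t) _) => // hb; case: (leP h%:R b) => // hb2.
exfalso; move: hb2; apply/negP; rewrite -leNgt.
have /andP[hs _] := phi_bounds R d s; have /andP[ht _] := phi_bounds R d t.
have : h%:R <= (s %/ d.+1)%:R + (t %/ d.+1)%:R + 3 :> R by rewrite -!natrD ler_nat.
have : 3 <= gapK n0 by rewrite ler_nat; lia.
by lra.
Qed.

(** [same] marks a common ancestor, where no lower bound on the hopcount is at hand; its indicator
    is paid for by [collision_le]. *)
Lemma hop_indic_le n0 h s t (same : bool) b :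
  (~~ same -> s %/ d.+1 + t %/ d.+1 <= h + n0.+1.*2)%N ->
  ((h%:R <= b)%R%:R : R) <= indic_le d (b + gapK n0) s t + same%:R.
Proof.
rewrite /indic_le; case: same => [_|/(_ isT) hle].
  by rewrite ler_wpDl// lern1 leq_b1.
rewrite addr0; case: (leP h%:R b) => // hb.
case: (leP (phi R d s + phi R d t) _) => // hb2.
exfalso; move: hb2; apply/negP; rewrite -leNgt.
have /andP[_ hs] := phi_bounds R d s; have /andP[_ ht] := phi_bounds R d t.
have : (s %/ d.+1)%:R + (t %/ d.+1)%:R <= h%:R + n0.+1.*2%:R :> R.
  by rewrite -!natrD ler_nat.
rewrite /gapK -[n0.+1.*2.+2]addn2 natrD.
by lra.
Qed.

Lemma squeeze n0 N b (F : (nat -> {fset nat}) -> {fset nat} -> {fset nat} -> R) :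
  (0 < n0 <= N)%N ->
  (forall c, valid d c N -> {in active (ran d c N) &, forall X Y,
     indic_le d (b - gapK n0) (total d c N X) (total d c N Y) <= F c X Y /\
     F c X Y <= indic_le d (b + gapK n0) (total d c N X) (total d c N Y)
       + (ancestor d n0 c N X == ancestor d n0 c N Y)%:R}) ->
  prob_phi_le N (b - gapK n0) <= expect d N (fun c => pmean d c N (F c)) /\
  expect d N (fun c => pmean d c N (F c)) <= prob_phi_le N (b + gapK n0) + 2 / n0%:R.
Proof.
move=> hn hF; split.
  apply: expect_le => c vn; apply: pmean_le => X Y Xa Ya.
  by have [] := hF c vn X Y Xa Ya.
apply: le_trans (lerD (lexx _) (collision_le R d_gt0 hn)).
rewrite -expectD; apply: expect_le => c vn; rewrite /tmean -pmeanD.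
by apply: pmean_le => X Y Xa Ya; have [] := hF c vn X Y Xa Ya.
Qed.

Lemma active_pmfE c N X : valid d c N -> X \in active (ran d c N) ->
  active_pmf (ran d c N) X = (nactive R d N)^-1.
Proof. by move=> vn Xa; rewrite /active_pmf Xa card_active// mul1r. Qed.

Lemma active_pmf_sum c N : valid d c N ->
  \sum_(X <- active (ran d c N)) active_pmf (ran d c N) X = 1 :> R.
Proof.
move=> vn; rewrite (eq_big_seq (fun=> (nactive R d N)^-1)); last first.
  by move=> X Xa; rewrite active_pmfE.
rewrite big_const_seq count_predT iter_addr_0 card_active//.
by rewrite -[X in X = _]mulr_natl divff// gt_eqF// nactive_gt0.
Qed.

Lemma active_pmf_pmean c N (f : {fset nat} -> {fset nat} -> R) : valid d c N ->
  \sum_(X <- active (ran d c N)) \sum_(Y <- active (ran d c N))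
    active_pmf (ran d c N) X * active_pmf (ran d c N) Y * f X Y = pmean d c N f.
Proof.
move=> vn; rewrite /pmean mulr_suml; apply: eq_big_seq => X Xa.
rewrite mulr_suml; apply: eq_big_seq => Y Ya.
by rewrite !active_pmfE// mulrC expr2 invfM.
Qed.

Lemma clique_hop_squeeze n0 N b : (0 < n0 <= N)%N ->
  let PN := expect d N (fun c => pmean d c N (fun X Y =>
     (((clique_hop (ran d c N) X Y)%:R <= b)%R%:R : R))) in
  prob_phi_le N (b - gapK n0) <= PN /\ PN <= prob_phi_le N (b + gapK n0) + 2 / n0%:R.
Proof.
move=> hn; apply: squeeze => // c vn X Y Xa Ya; split.
  apply: indic_le_hop; [by []|by []|].
  have [->|XY] := eqVneq X Y; first by rewrite /clique_hop eqxx.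
  exact: clique_hop_le.
apply: hop_indic_le => anc; have XY : X != Y by apply: contraNneq anc => ->.
by apply: clique_hop_ge => //; [case/andP: hn|exact/eqP].
Qed.

Lemma sum_mem_vertices c N X (f : nat -> R) : valid d c N -> X \in active (ran d c N) ->
  \sum_(v <- iota 0 (nverts (ran d c N))) (v \in X)%:R * f v = \sum_(v <- X) f v.
Proof.
move=> vn Xa.
transitivity (\sum_(v <- [seq v <- iota 0 (nverts (ran d c N)) | v \in X]) f v).
  rewrite big_filter [RHS]big_mkcond; apply: eq_bigr => v _.
  by case: (v \in X); rewrite ?mul1r ?mul0r.
apply: perm_big; apply: uniq_perm => [||v]; rewrite ?filter_uniq ?iota_uniq ?fset_uniq//.
rewrite mem_filter mem_iota add0n nverts_ran; case: (boolP (v \in X)) => // vX.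
by rewrite (active_lt vn Xa vX).
Qed.

Definition multiplicity c N (v : nat) : R := \sum_(X <- active (ran d c N)) (v \in X)%:R.

Lemma sum_multiplicity c N (f : nat -> R) : valid d c N ->
  \sum_(v <- iota 0 (nverts (ran d c N))) multiplicity c N v * f v =
  \sum_(X <- active (ran d c N)) \sum_(v <- X) f v.
Proof.
move=> vn; under eq_bigr do rewrite /multiplicity mulr_suml.
rewrite exchange_big; apply: eq_big_seq => X Xa; exact: sum_mem_vertices.
Qed.

Lemma sum_multiplicity1 c N : valid d c N ->
  \sum_(v <- iota 0 (nverts (ran d c N))) multiplicity c N v = d.+1%:R * nactive R d N.
Proof.
move=> vn; under eq_bigr do rewrite -[multiplicity _ _ _]mulr1.
rewrite sum_multiplicity// (eq_big_seq (fun=> d.+1%:R)); last first.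
  move=> X Xa; rewrite big_const_seq count_predT iter_addr_0.
  by rewrite (card_active_clique vn Xa).
by rewrite big_const_seq count_predT iter_addr_0 card_active// mulr_natr.
Qed.

Lemma multiplicity_ge0 c N v : 0 <= multiplicity c N v.
Proof. by apply: sumr_ge0 => X _; rewrite ler0n. Qed.

Lemma size_biasE c N v : valid d c N -> (v < nverts (ran d c N))%N ->
  size_bias d (ran d c N) v = multiplicity c N v + (v <= d)%N%:R.
Proof. by move=> vn; rewrite nverts_ran => /(size_bias_ran R vn). Qed.

Lemma sum_size_bias c N : valid d c N ->
  \sum_(u <- iota 0 (nverts (ran d c N))) size_bias d (ran d c N) u =
  d.+1%:R * (nactive R d N + 1).
Proof.
move=> vn; rewrite (eq_big_seq (fun v => multiplicity c N v + (v <= d)%N%:R)); last first.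
  by move=> v; rewrite mem_iota add0n => /andP[_ vlt]; exact: size_biasE.
rewrite big_split /= sum_multiplicity1// mulrDr mulr1; congr (_ + _).
rewrite (sum_natr_count R _ (fun v => v <= d)%N) nverts_ran; congr _%:R.
rewrite (_ : (N + d.+2 = d.+1 + N.+1)%N); last by lia.
rewrite iotaD count_cat (_ : count _ (iota 0 d.+1) = d.+1); last first.
  rewrite -[RHS](size_iota 0 d.+1); apply/eqP; rewrite -all_count; apply/allP => v.
  by rewrite mem_iota add0n ltnS => /andP[].
rewrite -[RHS]addn0; congr (_ + _)%N; apply/eqP; rewrite -leqn0 leqNgt -has_count.
by apply/hasPn => v; rewrite mem_iota -ltnNge => /andP[].
Qed.

Lemma size_biased_pmfE c N v : valid d c N -> v \in iota 0 (nverts (ran d c N)) ->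
  size_biased_pmf d (ran d c N) v =
  (multiplicity c N v + (v <= d)%N%:R) / (d.+1%:R * (nactive R d N + 1)).
Proof.
move=> vn; rewrite mem_iota add0n => /andP[_ vlt].
by rewrite /size_biased_pmf vlt size_biasE// /index_iota subn0 sum_size_bias.
Qed.

Let nactive1_gt0 N : 0 < d.+1%:R * (nactive R d N + 1).
Proof. by rewrite mulr_gt0// addr_gt0// nactive_gt0. Qed.

Lemma size_biased_pmf_sum c N : valid d c N ->
  \sum_(v <- iota 0 (nverts (ran d c N))) size_biased_pmf d (ran d c N) v = 1 :> R.
Proof.
move=> vn; rewrite (eq_big_seq (fun v =>
  size_bias d (ran d c N) v / (d.+1%:R * (nactive R d N + 1)))).
  by rewrite -mulr_suml sum_size_bias// divff// gt_eqF.
by move=> v vi; rewrite size_biased_pmfE// size_biasE//; move: vi; rewrite mem_iota => /andP[].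
Qed.

Definition vertex_average (f : nat -> nat -> R) X Y : R :=
  (\sum_(v <- X) \sum_(w <- Y) f v w) / d.+1%:R ^+ 2.

Lemma vertex_average_le c N X Y f g : valid d c N ->
  X \in active (ran d c N) -> Y \in active (ran d c N) ->
  {in X & Y, forall v w, f v w <= g v w} -> vertex_average f X Y <= vertex_average g X Y.
Proof.
move=> vn Xa Ya fg; rewrite ler_wpM2r ?invr_ge0 ?exprn_ge0//.
rewrite big_seq [leRHS]big_seq; apply: ler_sum => v vX.
by rewrite big_seq [leRHS]big_seq; apply: ler_sum => w wY; exact: fg.
Qed.

Lemma vertex_average_cst c N X Y k : valid d c N ->
  X \in active (ran d c N) -> Y \in active (ran d c N) ->
  vertex_average (fun _ _ => k) X Y = k.
Proof.
move=> vn Xa Ya; rewrite /vertex_average !big_const_seq !count_predT !iter_addr_0.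
rewrite (card_active_clique vn Xa) (card_active_clique vn Ya) -mulrnA.
by rewrite -[k *+ _]mulr_natr natrM -expr2 mulfK// expf_neq0// pnatr_eq0.
Qed.

(** The law dominates [A / (A + 1)] times that of a uniform vertex in a uniform active clique, the
    rest being the initial simplex. Domination for [f] and for [1 - f] bounds the difference by
    [1 - (A / (A + 1))^2], at most [2 / (A + 1)]. *)
Lemma size_biased_average c N (f : nat -> nat -> R) : valid d c N ->
  (forall v w, 0 <= f v w <= 1) ->
  `|\sum_(u <- iota 0 (nverts (ran d c N))) \sum_(v <- iota 0 (nverts (ran d c N)))
     size_biased_pmf d (ran d c N) u * size_biased_pmf d (ran d c N) v * f u v
    - pmean d c N (vertex_average f)| <= 2 / N.+1%:R.
Proof.
move=> vn f01; set r := iota _ _; set g := ran d c N.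
pose A := nactive R d N; pose D : R := d.+1%:R; pose m v := multiplicity c N v.
pose q v := size_biased_pmf d g v : R; pose W := (D * (A + 1))^-1.
have A0 : 0 < A by exact: nactive_gt0.
have D0 : 0 < D by [].
have W0 : 0 < W by rewrite invr_gt0 nactive1_gt0.
have mq v : v \in r -> 0 <= m v * W <= q v.
  move=> vr; rewrite mulr_ge0 ?multiplicity_ge0 ?(ltW W0)//=.
  by rewrite /q size_biased_pmfE// ler_wpM2r ?(ltW W0)// lerDl.
pose M h := \sum_(u <- r) \sum_(v <- r) (m u * W) * (m v * W) * h u v : R.
pose S h := \sum_(u <- r) \sum_(v <- r) q u * q v * h u v : R.
have M_pmean h : M h = (A / (A + 1)) ^+ 2 * pmean d c N (vertex_average h).
  have -> : M h = W ^+ 2 * \sum_(u <- r) m u * \sum_(v <- r) m v * h u v.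
    rewrite /M mulr_sumr; apply: eq_bigr => u _; rewrite !mulr_sumr.
    by apply: eq_bigr => v _; ring.
  rewrite (eq_bigr (fun u => m u * \sum_(Y <- active g) \sum_(v <- Y) h u v)); last first.
    by move=> u _; rewrite sum_multiplicity.
  rewrite sum_multiplicity// /pmean /vertex_average.
  rewrite [X in _ = _ * (X / _)](_ : _ = (\sum_(X <- active g) \sum_(v <- X)
      \sum_(Y <- active g) \sum_(w <- Y) h v w) / D ^+ 2); last first.
    rewrite mulr_suml; apply: eq_bigr => X _.
    by rewrite -mulr_suml exchange_big.
  by rewrite -/A /W; field; rewrite !gt_eqF// addr_gt0.
have MS : forall h, (forall v w, 0 <= h v w) -> M h <= S h.
  move=> h h0; rewrite /M /S big_seq [leRHS]big_seq; apply: ler_sum => u ur.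
  rewrite big_seq [leRHS]big_seq; apply: ler_sum => v vr.
  have /andP[? ?] := mq u ur; have /andP[? ?] := mq v vr.
  by apply: ler_wpM2r => //; apply: ler_pM.
have S1 : S (fun _ _ => 1) = 1.
  rewrite /S -[RHS](size_biased_pmf_sum vn); apply: eq_bigr => u _.
  rewrite -[RHS]mulr1 -[in RHS](size_biased_pmf_sum vn) mulr_sumr.
  by apply: eq_bigr => v _; rewrite mulr1.
have M1 : M (fun _ _ => 1) = (A / (A + 1)) ^+ 2.
  rewrite M_pmean [pmean _ _ _ _](_ : _ = 1) ?mulr1//.
  transitivity (pmean d c N (fun _ _ => 1 : R)); last exact: pmean_cst.
  rewrite /pmean; congr (_ / _); apply: eq_big_seq => X Xa; apply: eq_big_seq => Y Ya.
  exact: (vertex_average_cst _ vn Xa Ya).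
have SB h k : S (fun v w => h v w - k v w) = S h - S k.
  rewrite /S -sumrB; apply: eq_bigr => u _; rewrite -sumrB.
  by apply: eq_bigr => v _; rewrite mulrBr.
have MB h k : M (fun v w => h v w - k v w) = M h - M k.
  rewrite /M -sumrB; apply: eq_bigr => u _; rewrite -sumrB.
  by apply: eq_bigr => v _; rewrite mulrBr.
have SM : S f <= M f + (1 - (A / (A + 1)) ^+ 2).
  have := MS (fun v w => 1 - f v w)
    (fun v w => ltac:(by have /andP[_] := f01 v w; rewrite subr_ge0)).
  by rewrite SB MB S1 M1; lra.
have F0 : 0 <= pmean d c N (vertex_average f).
  rewrite -(pmean_cst 0 vn); apply: pmean_le => X Y Xa Ya.
  rewrite -(vertex_average_cst 0 vn Xa Ya); apply: (vertex_average_le vn Xa Ya) => v w _ _.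
  by have /andP[] := f01 v w.
have F1 : pmean d c N (vertex_average f) <= 1.
  rewrite -(pmean_cst 1 vn); apply: pmean_le => X Y Xa Ya.
  rewrite -(vertex_average_cst 1 vn Xa Ya); apply: (vertex_average_le vn Xa Ya) => v w _ _.
  by have /andP[] := f01 v w.
have MSf := MS f (fun v w => ltac:(by have /andP[] := f01 v w)).
set rho := (A / (A + 1)) ^+ 2 in M_pmean SM.
have rho0 : 0 <= rho by rewrite exprn_ge0// divr_ge0// addr_ge0 ?ltW.
have rho1 : rho <= 1.
  by rewrite exprn_ile1 ?divr_ge0 ?addr_ge0 ?(ltW A0)// ler_pdivrMr ?addr_gt0// mul1r lerDl.
have hrho : 1 - rho <= 2 / N.+1%:R.
  apply: (@le_trans _ _ (2 / (A + 1))).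
    have E a : a + 1 != 0 -> 2 / (a + 1) - (1 - (a / (a + 1)) ^+ 2) = (a + 1)^-1 ^+ 2 :> R.
      by move=> a1; field.
    by rewrite /rho -subr_ge0 E ?sqr_ge0// gt_eqF// addr_gt0.
  rewrite ler_wpM2l// lef_pV2 ?posrE ?addr_gt0//.
  by rewrite /A /nactive natr1 ler_nat; nia.
rewrite -/(S f) ler_distl; rewrite M_pmean in SM MSf.
move: F0 F1 SM MSf rho0 rho1 hrho; clearbody rho.
move: (pmean _ _ _ _) (S f) (2 / N.+1%:R) => a s k a0 a1 sM Ms r0 r1 rk.
have := mulr_ge0 (_ : 0 <= 1 - rho) a0; have := mulr_ge0 (_ : 0 <= 1 - rho) (_ : 0 <= 1 - a).
rewrite !subr_ge0 => /(_ r1 a1) h1 /(_ r1) h2.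
by apply/andP; split; lra.
Qed.

Lemma vertex_hop_squeeze n0 N b : (0 < n0 <= N)%N ->
  let PN := expect d N (fun c => let g := ran d c N in
    \sum_(u <- iota 0 (nverts g)) \sum_(v <- iota 0 (nverts g))
     size_biased_pmf d g u * size_biased_pmf d g v
       * (((vertex_hop g u v)%:R <= b)%R%:R : R)) in
  prob_phi_le N (b - gapK n0) - 2 / N.+1%:R <= PN /\
  PN <= prob_phi_le N (b + gapK n0) + 2 / n0%:R + 2 / N.+1%:R.
Proof.
move=> hn PN; pose f c v w : R := ((vertex_hop (ran d c N) v w)%:R <= b)%R%:R.
have : `|PN - expect d N (fun c => pmean d c N (vertex_average (f c)))| <= 2 / N.+1%:R.
  apply: expect_dist_le => c vn; apply: size_biased_average => // v w.
  by rewrite /f ler0n lern1 leq_b1.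
have [] := @squeeze n0 N b (fun c => vertex_average (f c)) hn.
  move=> c vn X Y Xa Ya.
  set lo := indic_le _ _ _ _; set hi := indic_le _ _ _ _ + _.
  rewrite -(vertex_average_cst lo vn Xa Ya) -(vertex_average_cst hi vn Xa Ya).
  split; apply: (vertex_average_le vn Xa Ya) => v w vX wY.
    by apply: indic_le_hop; [by []|by []|]; exact: vertex_hop_le.
  apply: hop_indic_le => anc; apply: vertex_hop_ge => //; first by case/andP: hn.
  exact/eqP.
move=> h1 h2; rewrite ler_distl => /andP[h3 h4]; split.
  by apply: le_trans h3; rewrite lerD2r.
by apply: (le_trans h4); rewrite lerD2r.
Qed.

End Sandwich.

(** * Convergence in distribution for either sampling law *)

Section Convergence.
Context {R : realType} {dT dZ : measure_display}
  {T : measurableType dT} {TZ : measurableType dZ}.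
Variables (P : probability T R) (PZ : probability TZ R) (Z : {RV PZ >-> R}).
Hypothesis Z_normal : forall A : set R, measurable A ->
  distribution PZ Z A = normal_prob 0 1 A.

Lemma cdf_normal x : cdf Z x = (Phi x)%:E.
Proof.
by rewrite /cdf Z_normal//; rewrite fineK// fin_num_measure.
Qed.

(** [Phi] is the cdf of the given [Z], so its tails follow from the general limits of a cdf. *)
Lemma Phi_tails (eta : R) : 0 < eta ->
  exists M : R, forall y, M <= y -> 1 - eta <= Phi y /\ Phi (- y) <= eta.
Proof.
move=> eta0.
have PhiE : fine \o cdf Z = @Phi R by apply/funext => y /=; rewrite cdf_normal.
have Phi0 : @Phi R @ -oo%R --> (0 : R) by rewrite -PhiE; exact/fine_cvg/cvg_cdfNy0.
have Phi1 : @Phi R @ +oo%R --> (1 : R) by rewrite -PhiE; exact/fine_cvg/cvg_cdfy1.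
have /cvgrPdist_le/(_ _ eta0) [M2 [_ hM2]] := Phi0.
have /cvgrPdist_le/(_ _ eta0) [M1 [_ hM1]] := Phi1.
exists (Num.max M1 (- M2) + 1) => y hy.
have y1 : M1 < y by apply: lt_le_trans hy; rewrite ltr_pwDr// le_max lexx.
have y2 : - y < M2.
  by rewrite ltrNl; apply: lt_le_trans hy; rewrite ltr_pwDr// le_max lexx orbT.
have /= := hM1 _ y1; have /= := hM2 _ y2.
by rewrite sub0r normrN ler_norml ler_distl => /andP[_ ?] /andP[_ ?]; split; lra.
Qed.

Variables (d : nat) (C : nat -> T -> {fset nat}).
Hypotheses (d_gt0 : (0 < d)%N) (C_ran : ran_process P d C).
Variables (K : countType) (q : apollonian -> K -> R) (supp : apollonian -> seq K)
  (hop : apollonian -> K -> K -> nat).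
Hypothesis supp_uniq : forall n c, valid d c n -> uniq (supp (ran d c n)).
Hypothesis supp_sum : forall n c, valid d c n ->
  \sum_(u <- supp (ran d c n)) q (ran d c n) u = 1.

Definition prob_hop_le (N : nat) (b : R) : R := expect d N (fun c =>
  let g := ran d c N in
  \sum_(u <- supp g) \sum_(v <- supp g) q g u * q g v * ((hop g u v)%:R <= b)%R%:R).

Hypothesis hop_squeeze : forall n0 N b, (0 < n0 <= N)%N ->
  prob_phi_le d N (b - gapK R n0) - 2 / N.+1%:R <= prob_hop_le N b /\
  prob_hop_le N b <= prob_phi_le d N (b + gapK R n0) + 2 / n0%:R + 2 / N.+1%:R.

(** [n0] is fixed before [N] and makes the collision probability small; [gapK n0] is then a
    constant, negligible on the scale [sqrt (log N)], and enters [clt_total] as [K]. *)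
Lemma prob_hop_cvg (x eta : R) : 0 < eta -> exists N0, forall N, (N0 <= N)%N ->
  `|prob_hop_le N (log_center R d N + x * log_scale R d N) - Phi x| <= eta.
Proof.
move=> eta0; have eta4 : 0 < eta / 4 by lra.
have inv_small (e : R) : 0 < e -> exists2 n0, (0 < n0)%N & forall n, (n0 <= n)%N -> 2 / n%:R <= e.
  move=> e0; exists (Num.bound (2 / e)).+1 => // n hn.
  have n0 : (0 < n)%N by apply: leq_trans hn.
  rewrite ler_pdivrMr ?ltr0n// -ler_pdivrMl// mulrC.
  apply: (le_trans (ltW (archi_boundP (_ : 0 <= 2 / e)))); first by rewrite divr_ge0// ltW.
  by rewrite ler_nat ltnW.
have [n0 n00 hn0] := inv_small _ eta4.
have [N1 hN1] := clt_total d_gt0 Phi_tails x (gapK_ge0 R n0) eta4.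
exists (maxn n0 N1) => N; rewrite geq_max => /andP[nN /hN1 hclt].
have hn : (0 < n0 <= N)%N by rewrite n00.
set b := log_center R d N + x * log_scale R d N.
have [lo hi] := hop_squeeze b hn.
have gk := gapK_ge0 R n0.
have h1 : `|prob_phi_le d N (b - gapK R n0) - Phi x| <= eta / 4.
  apply: hclt; rewrite (_ : _ - _ = - gapK R n0); last by rewrite /b; ring.
  by rewrite normrN ger0_norm.
have h2 : `|prob_phi_le d N (b + gapK R n0) - Phi x| <= eta / 4.
  apply: hclt; rewrite (_ : _ - _ = gapK R n0); last by rewrite /b; ring.
  by rewrite ger0_norm.
have h3 := hn0 _ (leqnn n0); have h4 := hn0 _ (leqW nN).
move: h1 h2 lo hi h3 h4; rewrite !ler_distl => /andP[+ +] /andP[+ +].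
move: (prob_phi_le _ _ _) (prob_phi_le _ _ _) (prob_hop_le _ _) (2 / n0%:R) (2 / N.+1%:R) => *.
by apply/andP; split; lra.
Qed.

Lemma hop_cvg_in_distribution (U V : nat -> T -> K) :
  (forall n, iid_given_ran P d C n q (U n) (V n)) ->
  cvg_in_distribution P (fun n w =>
    ((hop (ran d (fun k => C k w) n) (U n w) (V n w))%:R - log_center R d n)
    / log_scale R d n) Z.
Proof.
move=> UV; split=> [n|x _].
  move=> _ B mB; rewrite setTI.
  pose D g u v := `[< B (((hop g u v)%:R - log_center R d n) / log_scale R d n) >].
  rewrite (_ : _ @^-1` _ = [set w | D (ran d (fun k => C k w) n) (U n w) (V n w)]).
    exact: measurable_sample (UV n) D.
  by apply/seteqP; split => w /=; rewrite /D => /asboolP.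
rewrite cdf_normal.
have [N1 hN1] := log_scale_large d_gt0 (1 : R).
apply: cvg_trans (_ : (prob_hop_le n (log_center R d n + x * log_scale R d n))%:E
   @[n --> \oo] --> (Phi x)%:E).
  (* [log_scale] vanishes at [n = 1], so the event is rewritten only for large [n]. *)
  apply: near_eq_cvg; near=> n.
  have s0 : 0 < log_scale R d n.
    by apply: lt_le_trans (hN1 n _) => //; near: n; exact: nbhs_infty_ge.
  rewrite -(sample_probE C_ran (UV n) (fun c => supp_uniq (n := n) (c := c))
     (fun c => supp_sum (n := n) (c := c)) (fun g u v =>
       ((hop g u v)%:R <= log_center R d n + x * log_scale R d n)%R)).
  congr (P _); apply/seteqP; split => w /=; rewrite ler_pdivrMr// lerBlDl //.
apply: cvg_EFin; first exact: nearW.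
apply/cvgrPdist_le => e e0.
have [N0 hN0] := prob_hop_cvg x e0.
near=> n; rewrite distrC; apply: hN0; near: n; exact: nbhs_infty_ge.
Unshelve. all: by end_near. Qed.

End Convergence.

Unset Implicit Arguments.

Theorem theorem2p1 (R : realType) (d : nat) (hd : (2 <= d)%N)
    (dY : measure_display) (TY : measurableType dY) (PY : probability TY R)
    (X : 'I_d.+1 -> {RV PY >-> R})
    (X_indep : independent_rvs X)
    (X_geom : forall i : 'I_d.+1, geometric_rv (X i) (i.+1%:R / d.+1%:R))
    (dZ : measure_display) (TZ : measurableType dZ) (PZ : probability TZ R)
    (Z : {RV PZ >-> R})
    (Z_normal : forall A : set R, measurable A ->
       distribution PZ Z A = normal_prob 0 1 A)
    (dT : measure_display) (T : measurableType dT) (P : probability T R)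
    (C : nat -> T -> {fset nat})
    (C_ran : ran_process P d C) :
  let Y := fun w : TY => \sum_(i < d.+1) X i w in
  let mu := fine 'E_PY[Y] in
  let sigma2 := fine 'V_PY[Y] in
  let G := fun (n : nat) (w : T) => ran d (fun k => C k w) n in
  (forall U V : nat -> T -> {fset nat},
    (forall n, iid_given_ran P d C n active_pmf (U n) (V n)) ->
    cvg_in_distribution P
      (fun n w => ((clique_hop (G n w) (U n w) (V n w))%:R - hop_center d mu n)
                  / hop_scale d mu sigma2 n) Z)
  /\
  (forall U V : nat -> T -> nat,
    (forall n, iid_given_ran P d C n (size_biased_pmf d) (U n) (V n)) ->
    cvg_in_distribution P
      (fun n w => ((vertex_hop (G n w) (U n w) (V n w))%:R - hop_center d mu n)
                  / hop_scale d mu sigma2 n) Z).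
Proof.
move=> Y mu sigma2 G; have d_gt0 : (0 < d)%N by exact: leq_trans hd.
have muE : mu = mean_period R d by exact: sum_expectation.
have centerE n : hop_center d mu n = log_center R d n by rewrite muE.
have scaleE n : hop_scale d mu sigma2 n = log_scale R d n.
  by rewrite /hop_scale muE /sigma2 (sum_variance X_indep X_geom).
have -> : hop_center d mu = log_center R d by apply/funext.
have -> : hop_scale d mu sigma2 = log_scale R d by apply/funext.
split=> U V UV.
  apply: (hop_cvg_in_distribution Z_normal d_gt0 C_ran (supp := fun g => active g)) UV.
  - by move=> n c _; exact: fset_uniq.
  - by move=> n c; exact: active_pmf_sum.
  move=> n0 N b hn; rewrite /prob_hop_le /=.
  have -> : expect d N (fun c => \sum_(u <- active (ran d c N)) \sum_(v <- active (ran d c N))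
     active_pmf (ran d c N) u * active_pmf (ran d c N) v *
       ((clique_hop (ran d c N) u v)%:R <= b)%R%:R) =
    expect d N (fun c => pmean d c N (fun X Y =>
     (((clique_hop (ran d c N) X Y)%:R <= b)%R%:R : R))).
    by apply: eq_expect => c vn; rewrite active_pmf_pmean.
  have [h1 h2] := clique_hop_squeeze d_gt0 b hn.
  have h3 : 0 <= 2 / N.+1%:R :> R by [].
  by split; [apply: le_trans h1; rewrite gerBl|apply: (le_trans h2); rewrite lerDl].
apply: (hop_cvg_in_distribution Z_normal d_gt0 C_ran (supp := fun g => iota 0 (nverts g))) UV.
- by move=> n c _; exact: iota_uniq.
- by move=> n c; exact: size_biased_pmf_sum.
by move=> n0 N b hn; exact: vertex_hop_squeeze.
Qed.
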